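(* Let $(\psi_j)_{j\in\mathbb{Z}}$ be a family of wavelets such that $\psi_j\in L^1(\mathbb{R})\cap L^2(\mathbb{R})$ for all $j\in\mathbb{Z}$. Suppose that the wavelets are analytic, $$\hat\psi_j(\omega)=0\quad\text{for a.e. }\omega<0\text{ and all }j\in\mathbb{Z},$$ and that, for some $A,B>0$, $$A\leq\sum_{j\in\mathbb{Z}}|\hat\psi_j(\omega)|^2\leq B\quad\text{for a.e. }\omega>0 .$$ Let $U:L^2_+(\mathbb{R})/S^1\to L^2_{\mathbb{Z}}(\mathbb{R})$ be the operator $U(f)=(|f\star\psi_j|)_{j\in\mathbb{Z}}$, and suppose that $U$ is injective. Then: (i) The image of $U$, $I_U=\{U(f):f\in L^2_+(\mathbb{R})/S^1\}$, is closed in $L^2_{\mathbb{Z}}(\mathbb{R})$. (ii) The map $U^{-1}:I_U\to L^2_+(\mathbb{R})/S^1$ is continuous.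
   Context: Wavelets: $a>1$ is fixed, $\psi:\mathbb{R}\to\mathbb{C}$ is a function in $L^1\cap L^2(\mathbb{R})$ with $\int_{\mathbb{R}}\psi=0$, and $\psi_j(x)=a^{-j}\psi(a^{-j}x)$, i.e. $\hat\psi_j(\omega)=\hat\psi(a^j\omega)$. Fourier transform: $\hat f(\omega)=\int f(x)e^{-i\omega x}dx$, extended to $L^2$. $L^2_+(\mathbb{R})=\{f\in L^2(\mathbb{R}):\hat f(\omega)=0\text{ for a.e. }\omega<0\}$ (complex-valued functions). $L^2_+(\mathbb{R})/S^1$ is its quotient by the relation $f\sim g\iff f=e^{i\phi}g$ for some $\phi\in\mathbb{R}$, with the metric $\|f-g\|_{2,S^1}=\inf_{\phi\in\mathbb{R}}\|f-e^{i\phi}g\|_2$. $L^2_{\mathbb{Z}}(\mathbb{R})=\{(h_j)_{j\in\mathbb{Z}}\in L^2(\mathbb{R})^{\mathbb{Z}}:\sum_j\|h_j\|_2^2<+\infty\}$, with the metric $\|(h_j)-(h'_j)\|_2=\big(\sum_{j\in\mathbb{Z}}\|h_j-h'_j\|_2^2\big)^{1/2}$. *)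

(* Defs.v *)
From HB Require Import structures.
From mathcomp Require Import all_boot all_order all_algebra.
From mathcomp Require Import complex finmap ring lra.
From mathcomp Require Import all_classical all_reals all_analysis.
From mathcomp Require Import measurable_realfun.

Set Implicit Arguments.
Unset Strict Implicit.
Unset Printing Implicit Defensive.

Import Order.TTheory GRing.Theory Num.Theory.
Import numFieldNormedType.Exports.
Import Normc.
Arguments Normc.normc {R} x.

Local Open Scope classical_set_scope.
Local Open Scope ring_scope.
Local Open Scope complex_scope.
Local Open Scope quotient_scope.

Section ComplexFunctions.
Context {R : realType}.
Implicit Types (f g : R -> R[i]) (p : \bar R).

Local Notation mu := (@lebesgue_measure R).

Definition cmeasurable f :=
  measurable_fun setT (fun x => complex.Re (f x)) /\
  measurable_fun setT (fun x => complex.Im (f x)).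

Definition cnorm p f : \bar R := 'N[mu]_p[EFin \o normc \o f].

Definition cLp p : set (R -> R[i]) :=
  [set f | cmeasurable f /\ (cnorm p f < +oo)%E].

Definition l2norm f : R := fine (cnorm 2%:E f).

Definition cint f : R[i] :=
  (\int[mu]_x complex.Re (f x)) +i* (\int[mu]_x complex.Im (f x)).

Definition expi (t : R) : R[i] := cos t +i* sin t.

Definition fourier f (w : R) : R[i] :=
  cint (fun x => f x * expi (- (w * x))).

(* [g] is the Fourier transform of [f] in the sense of the continuous extension
   of [fourier] from L^1 `&` L^2 to L^2. *)
Definition is_fourierL2 f g :=
  cLp 2%:E g /\
  exists u : nat -> R -> R[i],
    [/\ forall n, cLp 1%:E (u n) /\ cLp 2%:E (u n),
        cnorm 2%:E (u n \- f) @[n --> \oo] --> 0%E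
      & cnorm 2%:E (fourier (u n) \- g) @[n --> \oo] --> 0%E].

Definition convolution f g (x : R) : R[i] := cint (fun y => f y * g (x - y)).

Definition L2plus : set (R -> R[i]) :=
  [set f | cLp 2%:E f /\
     exists2 g, is_fourierL2 f g & {ae mu, forall w, w < 0 -> g w = 0}].

Definition L2Zfam : set (int -> R -> R[i]) :=
  [set h | (forall j, cLp 2%:E (h j)) /\
     (\esum_(j in [set: int]) (l2norm (h j) ^+ 2)%:E < +oo)%E].

Definition distS1 f g : R :=
  inf [set l2norm (f \- (fun x => expi t * g x)) | t in [set: R]].

Definition distL2Z (h k : int -> R -> R[i]) : R :=
  Num.sqrt (fine (\esum_(j in [set: int]) (l2norm (h j \- k j) ^+ 2)%:E)).

(* The case t = 0 is a.e. equality: quotienting by this relation identifies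
   functions equal a.e. and functions equal up to a global phase at once. *)
Definition phase_eq (f g : L2plus) : bool :=
  `[< exists t, {ae mu, forall x, val f x = expi t * val g x} >].

Definition aeZ_eq (h k : L2Zfam) : bool :=
  `[< forall j, {ae mu, forall x, val h j x = val k j x} >].

End ComplexFunctions.

Section Facts.
Context {R : realType}.
Implicit Types (f g h : R -> R[i]).
Local Notation mu := (@lebesgue_measure R).

Lemma normc_ge0 (z : R[i]) : 0 <= normc z.
Proof. by case: z => a b; rewrite sqrtr_ge0. Qed.

Lemma normc_expi t : normc (expi t : R[i]) = 1.
Proof. by rewrite /= cos2Dsin2 sqrtr1. Qed.

Lemma expiD s t : expi (s + t) = expi s * expi t :> R[i].
Proof.
apply/eqP; rewrite eq_complex /= cosD sinD; apply/andP; split=> //.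
by rewrite addrC [sin s * _]mulrC.
Qed.

Lemma expi0 : expi 0 = 1 :> R[i].
Proof. by rewrite /expi cos0 sin0. Qed.

Lemma cmeasurable_normc f : cmeasurable f ->
  measurable_fun setT (normc \o f).
Proof.
move=> [mr mi].
have ms : measurable_fun setT (@Num.sqrt R).
  by apply: continuous_measurable_fun; exact: sqrt_continuous.
rewrite [X in measurable_fun _ X](_ : _ =
   Num.sqrt \o (fun x => complex.Re (f x) ^+ 2 + complex.Im (f x) ^+ 2)).
  apply: measurableT_comp ms _.
  by apply: measurable_funD; apply: measurable_funX.
by apply/funext => x /=; case: (f x).
Qed.

Lemma cmeasurableB f g : cmeasurable f -> cmeasurable g -> cmeasurable (f \- g).
Proof.
move=> [fr fi] [gr gi]; split.
  rewrite [X in measurable_fun _ X](_ : _ = (fun x => complex.Re (f x)) \- (fun x => complex.Re (g x))).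
    exact: measurable_funB.
  by apply/funext => x /=; case: (f x); case: (g x).
rewrite [X in measurable_fun _ X](_ : _ = (fun x => complex.Im (f x)) \- (fun x => complex.Im (g x))).
  exact: measurable_funB.
by apply/funext => x /=; case: (f x); case: (g x).
Qed.

Lemma cmeasurableZ (c : R[i]) f : cmeasurable f ->
  cmeasurable (fun x => c * f x).
Proof.
move=> [fr fi]; case: c => a b; split.
  rewrite [X in measurable_fun _ X](_ : _ =
    (fun x => a * complex.Re (f x)) \- (fun x => b * complex.Im (f x))).
    by apply: measurable_funB; apply: measurable_funM.
  by apply/funext => x /=; case: (f x).
rewrite [X in measurable_fun _ X](_ : _ =
  (fun x => a * complex.Im (f x)) \+ (fun x => b * complex.Re (f x))).
  by apply: measurable_funD; apply: measurable_funM.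
by apply/funext => x /=; case: (f x).
Qed.

Lemma cnorm_ge0 p f : (0 <= cnorm p f)%E.
Proof. exact: Lnorm_ge0. Qed.

Lemma eq_cnorm p f g : (forall x, normc (f x) = normc (g x)) ->
  cnorm p f = cnorm p g.
Proof. by move=> fg; apply: eq_Lnorm => x /=; rewrite fg. Qed.

Lemma le_cnorm f (g : R -> R) : cmeasurable f -> measurable_fun setT g ->
  (forall x, normc (f x) <= g x) ->
  (cnorm 2%:E f <= Lnorm mu 2%:E (EFin \o g))%E.
Proof.
move=> mf mg fg.
have g0 x : 0 <= g x by apply: le_trans (fg x); exact: normc_ge0.
have mnf := cmeasurable_normc mf.
rewrite /cnorm unlock /=.
apply: gt0_ler_poweR.
- by rewrite invr_ge0.
- by rewrite in_itv/= leey integral_ge0.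
- by rewrite in_itv/= leey integral_ge0.
- apply: ge0_le_integral => //.
  + apply/measurable_EFinP.
    apply: (@measurableT_comp _ _ _ _ _ _ (@powR R ^~ 2)) => //.
    exact: measurableT_comp mnf.
  + apply/measurable_EFinP.
    apply: (@measurableT_comp _ _ _ _ _ _ (@powR R ^~ 2)) => //.
    exact: measurableT_comp.
  + move=> x _; rewrite lee_fin.
    by apply: ge0_ler_powR; rewrite ?nnegrE // !ger0_norm ?normc_ge0.
Qed.

Lemma cnorm_triangle g f h : cmeasurable f -> cmeasurable g -> cmeasurable h ->
  (cnorm 2%:E (f \- h)%R <= cnorm 2%:E (f \- g)%R + cnorm 2%:E (g \- h)%R)%E.
Proof.
move=> mf mg mh.
have mfg := cmeasurable_normc (cmeasurableB mf mg).
have mgh := cmeasurable_normc (cmeasurableB mg mh).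
have p1 : 1 <= 2 :> R by rewrite ler1n.
apply: le_trans (minkowski_EFin mu mfg mgh p1).
apply: le_cnorm; first exact: cmeasurableB.
  exact: measurable_funD.
move=> x; rewrite /= (_ : f x - h x = (f x - g x) + (g x - h x)); last first.
  by rewrite addrA subrK.
exact: le_normcD.
Qed.

Lemma cnorm0 : cnorm 2%:E (fun=> 0 : R[i]) = 0%E.
Proof.
rewrite -(@Lnorm0 _ _ _ mu 2%:E) ?eqe ?pnatr_eq0//.
by apply: eq_Lnorm => x; congr EFin; exact: normc0.
Qed.

Lemma cnorm_eq0 f : cmeasurable f -> cnorm 2%:E f = 0%E ->
  {ae mu, forall x, f x = 0}.
Proof.
move=> /cmeasurable_normc mf /Lnorm_eq0_eq0 -/(_ _)[]//.
  exact/measurable_EFinP.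
move=> N [mN N0 sN]; exists N; split=> // x /= fx; apply: sN => /=.
by move=> /(_ I) [] /eq0_normc.
Qed.

Lemma cnormC p f g : cnorm p (f \- g) = cnorm p (g \- f).
Proof. by apply: eq_cnorm => x /=; rewrite -opprB normcN. Qed.

Lemma cmeasurable0 : cmeasurable (fun=> 0 : R[i]).
Proof. by split; exact: measurable_cst. Qed.

Lemma cL2_0 : cLp 2%:E (fun=> 0 : R[i]).
Proof. by split; [exact: cmeasurable0|rewrite cnorm0]. Qed.

Lemma cL2B f g : cLp 2%:E f -> cLp 2%:E g -> cLp 2%:E (f \- g).
Proof.
move=> [mf nf] [mg ng]; split; first exact: cmeasurableB.
have k0 (k : R -> R[i]) : cnorm 2%:E (k \- (fun=> 0)) = cnorm 2%:E k.
  by apply: eq_cnorm => x; rewrite /= subr0.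
have := cnorm_triangle mf cmeasurable0 mg.
rewrite [X in (_ <= _ + X)%E]cnormC !k0 => /le_lt_trans; apply.
by rewrite lte_add_pinfty.
Qed.

Lemma cL2_expi t f : cLp 2%:E f -> cLp 2%:E (fun x => expi t * f x).
Proof.
move=> [mf nf]; split; first exact: cmeasurableZ.
rewrite (@eq_cnorm _ _ f)// => x.
by rewrite normcM normc_expi mul1r.
Qed.

Lemma l2normE f : cLp 2%:E f -> cnorm 2%:E f = (l2norm f)%:E.
Proof. by move=> [_ nf]; rewrite fineK// ge0_fin_numE// cnorm_ge0. Qed.

Lemma l2norm_ge0 f : 0 <= l2norm f.
Proof. exact/fine_ge0/cnorm_ge0. Qed.

Lemma eq_l2norm f g : (forall x, normc (f x) = normc (g x)) ->
  l2norm f = l2norm g.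
Proof. by move=> fg; congr fine; exact: eq_cnorm. Qed.

Lemma l2norm_triangle g f h : cLp 2%:E f -> cLp 2%:E g -> cLp 2%:E h ->
  l2norm (f \- h) <= l2norm (f \- g) + l2norm (g \- h).
Proof.
move=> f2 g2 h2; rewrite -lee_fin EFinD -!l2normE; try exact: cL2B.
by apply: cnorm_triangle; [case: f2|case: g2|case: h2].
Qed.

Lemma l2norm_eq0 f g : cLp 2%:E f -> cLp 2%:E g -> l2norm (f \- g) = 0 ->
  {ae mu, forall x, f x = g x}.
Proof.
move=> f2 g2 fg0; have fg2 := cL2B f2 g2.
have : {ae mu, forall x, (f \- g) x = 0}.
  by apply: cnorm_eq0; [case: fg2|rewrite l2normE// fg0].
by apply: (@filterS _ _ (ae_filter_ringOfSetsType mu)) => x /= /eqP; rewrite subr_eq0 => /eqP.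
Qed.

End Facts.

Section Facts1.
Context {R : realType}.
Implicit Types (f g h : R -> R[i]).
Local Notation mu := (@lebesgue_measure R).

Lemma cnorm_ae f g : cmeasurable f -> cmeasurable g ->
  {ae mu, forall x, normc (f x) = normc (g x)} ->
  cnorm 2%:E f = cnorm 2%:E g.
Proof.
move=> mf mg fg; rewrite /cnorm unlock.
have m2 (k : R -> R[i]) : cmeasurable k ->
    measurable_fun setT (EFin \o (fun x => `|normc (k x)| `^ 2)).
  move=> mk; apply/measurable_EFinP.
  have mn := cmeasurable_normc mk.
  apply: (@measurableT_comp _ _ _ _ _ _ (@powR R ^~ 2)) => //.
  exact: measurableT_comp mn.
congr (_ `^ _)%E; apply: ge0_ae_eq_integral => //=; first exact: m2.
  exact: m2.
by apply: (@filterS _ _ (ae_filter_ringOfSetsType mu)) fg => x /= ->.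
Qed.

Lemma l2norm_ae f g : cmeasurable f -> cmeasurable g ->
  {ae mu, forall x, normc (f x) = normc (g x)} -> l2norm f = l2norm g.
Proof. by move=> mf mg fg; congr fine; exact: cnorm_ae. Qed.

Lemma l2normZ (c : R[i]) f : cLp 2%:E f ->
  l2norm (fun x => c * f x) = normc c * l2norm f.
Proof.
move=> [mf nf].
have nfL : normc \o f \in Lfun mu 2%:E.
  by rewrite inE; apply/andP; split; rewrite inE//; exact: cmeasurable_normc.
have p1 : (1 <= 2%:E :> \bar R)%E by rewrite lee_fin ler1n.
have := LnormZ (Lfun_Sub p1 nfL) (normc c).
rewrite ger0_norm ?normc_ge0// => /(congr1 fine).
rewrite fineM//; last by rewrite ge0_fin_numE// cnorm_ge0.
move=> <-; congr fine; apply: eq_Lnorm => x /=.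
by rewrite normcM.
Qed.

Lemma normc_le (z : R[i]) : normc z <= `|complex.Re z| + `|complex.Im z|.
Proof.
case: z => a b.
rewrite (_ : a +i* b = (a +i* 0) + (0 +i* b)); last first.
  by apply/eqP; rewrite eq_complex /= addr0 add0r !eqxx.
apply: le_trans (le_normcD _ _) _.
by rewrite /= expr0n /= addr0 !add0r !addr0 !sqrtr_sqr.
Qed.

Local Notation rot t g := (fun x => expi t * g x).

Lemma l2norm_rot_continuous f g : cLp 2%:E f -> cLp 2%:E g ->
  continuous (fun t => l2norm (f \- rot t g)).
Proof.
move=> f2 g2 s.
pose G t := (`|cos t - cos s| + `|sin t - sin s|) * l2norm g : R.
have GP t t' : normc (expi t - expi t' : R[i]) * l2norm g <=
    (`|cos t - cos t'| + `|sin t - sin t'|) * l2norm g.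
  by rewrite ler_wpM2r ?l2norm_ge0//; exact: normc_le.
have FG t t' : l2norm (f \- rot t g) <= l2norm (f \- rot t' g) +
    (`|cos t' - cos t| + `|sin t' - sin t|) * l2norm g.
  have := l2norm_triangle f2 (cL2_expi t' g2) (cL2_expi t g2).
  move=> /le_trans; apply; rewrite lerD2l; apply: le_trans (GP _ _).
  rewrite -l2normZ// le_eqVlt; apply/orP; left; apply/eqP.
  by apply: eq_l2norm => x /=; rewrite mulrBl.
have cc : `|cos t - cos s| @[t --> s] --> (0 : R).
  have := cvg_norm (cvgB (@continuous_cos R s) (cvg_cst (cos s))).
  by rewrite subrr normr0; exact.
have cs : `|sin t - sin s| @[t --> s] --> (0 : R).
  have := cvg_norm (cvgB (@continuous_sin R s) (cvg_cst (sin s))).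
  by rewrite subrr normr0; exact.
have G0 : G t @[t --> s] --> (0 : R).
  have := cvgM (cvgD cc cs) (cvg_cst (l2norm g)).
  by rewrite addr0 mul0r; exact.
apply: (@squeeze_cvgr _ _ _ _ (fun t => l2norm (f \- rot s g) - G t)
   (fun t => l2norm (f \- rot s g) + G t)).
- apply: nearW => t; rewrite lerBlDr; apply/andP; split.
    exact: FG.
  by apply: le_trans (FG _ s) _; rewrite /G distrC [ `|sin t - _|]distrC.
- by have := cvgB (cvg_cst (l2norm (f \- rot s g))) G0; rewrite subr0; exact.
- by have := cvgD (cvg_cst (l2norm (f \- rot s g))) G0; rewrite addr0; exact.
Qed.

Lemma expi_reduce t :
  exists2 s, s \in `[(- pi), (pi : R)] & expi s = expi t :> R[i].
Proof.
have c1 : -1 <= cos t <= 1 by rewrite cos_geN1 cos_le1.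
have a0 := acos_ge0 c1; have api := acos_lepi c1.
have ca : cos (acos (cos t)) = cos t by apply: acosK; rewrite in_itv.
have s2 : sin (acos (cos t)) ^+ 2 = sin t ^+ 2 by rewrite !sin2cos2 ca.
have pi0 := pi_ge0 R.
move/eqP: s2; rewrite eqf_sqr => /orP[/eqP s1|/eqP s1].
  exists (acos (cos t)); last by rewrite /expi ca s1.
  by rewrite in_itv /= api andbT (le_trans _ a0)// oppr_le0.
exists (- acos (cos t)); last by rewrite /expi cosN sinN ca s1 opprK.
by rewrite in_itv /= lerN2 api /= (le_trans _ pi0)// oppr_le0.
Qed.

Lemma distS1_le f g t : distS1 f g <= l2norm (f \- rot t g).
Proof.
apply: ge_inf; last by exists t.
by exists 0 => _ [s _ <-]; exact: l2norm_ge0.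
Qed.

Lemma distS1_attained f g : cLp 2%:E f -> cLp 2%:E g ->
  exists t, distS1 f g = l2norm (f \- rot t g).
Proof.
move=> f2 g2.
have pi2 : - pi <= pi :> R by rewrite (@le_trans _ _ 0)// ?oppr_le0 pi_ge0.
have [c _ cP] := EVT_min pi2
  (continuous_subspaceT (l2norm_rot_continuous f2 g2)).
exists c; apply/eqP; rewrite eq_le distS1_le/=.
apply: lb_le_inf; first by exists (l2norm (f \- rot 0 g)); exists 0.
move=> _ [t _ <-]; have [s sI <-] := expi_reduce t; exact: cP.
Qed.

Lemma distS1xx f : distS1 f f = 0.
Proof.
apply/eqP; rewrite eq_le; apply/andP; split.
  apply: le_trans (distS1_le f f 0) _.
  rewrite (@eq_l2norm _ _ (fun=> 0)); first by rewrite /l2norm cnorm0.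
  by move=> x /=; rewrite expi0 mul1r subrr.
apply: lb_le_inf; first by exists (l2norm (f \- rot 0 f)); exists 0.
by move=> _ [s _ <-]; exact: l2norm_ge0.
Qed.

Lemma rotK t f g x : normc (g x - expi (- t) * f x) = normc (f x - expi t * g x).
Proof.
rewrite -[RHS]mul1r -(normc_expi (- t)) -normcM mulrBr mulrA -expiD addNr expi0.
by rewrite mul1r -normcN opprB.
Qed.

Lemma distS1C_le f g : cLp 2%:E f -> cLp 2%:E g -> distS1 g f <= distS1 f g.
Proof.
move=> f2 g2; have [t ->] := distS1_attained f2 g2.
apply: le_trans (distS1_le g f (- t)) _.
by rewrite (@eq_l2norm _ _ (f \- rot t g))// => x; exact: rotK.
Qed.

Lemma distS1C f g : cLp 2%:E f -> cLp 2%:E g -> distS1 f g = distS1 g f.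
Proof. by move=> f2 g2; apply/eqP; rewrite eq_le !distS1C_le. Qed.

Lemma distS1_triangle g f h : cLp 2%:E f -> cLp 2%:E g -> cLp 2%:E h ->
  distS1 f h <= distS1 f g + distS1 g h.
Proof.
move=> f2 g2 h2.
have [s ->] := distS1_attained f2 g2; have [t ->] := distS1_attained g2 h2.
apply: le_trans (distS1_le f h (s + t)) _.
apply: le_trans (l2norm_triangle f2 (cL2_expi s g2) (cL2_expi (s + t) h2)) _.
rewrite lerD2l le_eqVlt; apply/orP; left; apply/eqP; apply: eq_l2norm => x /=.
by rewrite expiD -mulrA -mulrBr normcM normc_expi mul1r.
Qed.

Lemma distS1_eq0 f g : cLp 2%:E f -> cLp 2%:E g -> distS1 f g = 0 ->
  exists t, {ae mu, forall x, f x = expi t * g x}.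
Proof.
move=> f2 g2; have [t ->] := distS1_attained f2 g2 => fg0.
by exists t; exact: l2norm_eq0 f2 (cL2_expi t g2) fg0.
Qed.

End Facts1.

Section EllTwo.
Context {R : realType} {I : choiceType}.
Implicit Types a b c d : I -> R.

Local Notation sumsq a := (\esum_(j in [set: I]) (a j ^+ 2)%:E)%E.

Lemma sumsq_ge0 a : (0 <= sumsq a)%E.
Proof. by apply: esum_ge0 => j _; rewrite lee_fin sqr_ge0. Qed.

Lemma sumsq_triangle a b c :
  (forall j, 0 <= a j) -> (forall j, 0 <= b j) -> (forall j, 0 <= c j) ->
  (forall j, c j <= a j + b j) ->
  (sumsq a < +oo -> sumsq b < +oo ->
   sumsq c < +oo /\
   (Num.sqrt (fine (sumsq c)) <=
    Num.sqrt (fine (sumsq a)) + Num.sqrt (fine (sumsq b)))%R)%E.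
Proof.
move=> a0 b0 c0 cab Sa Sb.
have sqK d : (sumsq d < +oo -> sumsq d = (Num.sqrt (fine (sumsq d)) ^+ 2)%:E)%E.
  move=> Sd; rewrite sqr_sqrtr; last exact/fine_ge0/sumsq_ge0.
  by rewrite fineK// ge0_fin_numE// sumsq_ge0.
set A := Num.sqrt (fine (sumsq a)); set B := Num.sqrt (fine (sumsq b)).
have A0 : 0 <= A by exact: sqrtr_ge0.
have B0 : 0 <= B by exact: sqrtr_ge0.
have finle d (F : set I) : finite_set F -> (sumsq d < +oo)%E ->
    \sum_(j <- fset_set F) d j ^+ 2 <= Num.sqrt (fine (sumsq d)) ^+ 2.
  move=> finF Sd; rewrite -lee_fin -sqK// -sumEFin; apply: esum_ge.
  by exists F; [split|rewrite fsbig_finite].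
have key e : 0 < e -> (sumsq c <= ((A + B + e + e) ^+ 2)%:E)%E.
  move=> e0; apply: ub_ereal_sup => _ [F [finF _] <-].
  rewrite fsbig_finite//= sumEFin lee_fin.
  pose A' := A + e; pose B' := B + e.
  have A'0 : 0 < A' by rewrite ltr_wpDl.
  have B'0 : 0 < B' by rewrite ltr_wpDl.
  have A'n : A' != 0 by rewrite gt_eqF.
  have B'n : B' != 0 by rewrite gt_eqF.
  have sA : \sum_(j <- fset_set F) a j ^+ 2 <= A' ^+ 2.
    apply: le_trans (finle a F finF Sa) _.
    by rewrite lerXn2r ?nnegrE// ?lerDl ltW.
  have sB : \sum_(j <- fset_set F) b j ^+ 2 <= B' ^+ 2.
    apply: le_trans (finle b F finF Sb) _.
    by rewrite lerXn2r ?nnegrE// ?lerDl ltW.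
  have cj j : c j ^+ 2 <= (A' + B') / A' * a j ^+ 2 + (A' + B') / B' * b j ^+ 2.
    apply: (@le_trans _ _ ((a j + b j) ^+ 2)).
      by rewrite lerXn2r ?nnegrE ?addr_ge0.
    rewrite -subr_ge0.
    rewrite (_ : _ - _ = (B' * a j - A' * b j) ^+ 2 / (A' * B')).
      by apply: divr_ge0; [exact: sqr_ge0|apply: mulr_ge0; exact: ltW].
    by field; rewrite A'n B'n.
  apply: le_trans (ler_sum _ (fun j _ => cj j)) _.
  rewrite big_split /= -!mulr_sumr.
  apply: (@le_trans _ _ ((A' + B') / A' * A' ^+ 2 + (A' + B') / B' * B' ^+ 2)).
    by apply: lerD; apply: ler_wpM2l => //;
      apply: divr_ge0; rewrite ?addr_ge0 // ltW.
  rewrite (_ : A + B + e + e = A' + B'); last by rewrite /A' /B'; ring.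
  by rewrite le_eqVlt; apply/orP; left; apply/eqP; field; rewrite A'n B'n.
have Sc : (sumsq c < +oo)%E.
  by apply: le_lt_trans (key 1 ltr01) _; rewrite ltry.
split=> //; apply/ler_addgt0Pl => e e0.
have e20 : 0 < e / 2 by rewrite divr_gt0.
have h : Num.sqrt (fine (sumsq c)) ^+ 2 <= (A + B + e / 2 + e / 2) ^+ 2.
  by rewrite -lee_fin -sqK//; exact: key.
have {}h : Num.sqrt (fine (sumsq c)) <= A + B + e / 2 + e / 2.
  move: h; rewrite ler_pXn2r// nnegrE ?sqrtr_ge0//.
  by rewrite !addr_ge0 // ltW.
by apply: le_trans h _; rewrite [e in leRHS]splitr; lra.
Qed.

Lemma sumsq_eq0 a : (sumsq a < +oo)%E -> Num.sqrt (fine (sumsq a)) = 0 ->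
  forall j, a j = 0.
Proof.
move=> Sa /eqP; rewrite sqrtr_eq0 => le0 j.
have S0 : sumsq a = 0%E.
  rewrite -[LHS]fineK ?ge0_fin_numE ?sumsq_ge0//; congr EFin.
  by apply/eqP; rewrite eq_le le0/= fine_ge0 ?sumsq_ge0.
have : ((a j ^+ 2)%:E <= sumsq a)%E.
  apply: esum_ge; exists [set j]; first by split.
  by rewrite fsbig_set1.
rewrite S0 lee_fin => h; apply/eqP; rewrite -sqrf_eq0 eq_le h/=.
exact: sqr_ge0.
Qed.

End EllTwo.

Section L2Zfacts.
Context {R : realType}.
Local Notation mu := (@lebesgue_measure R).
Implicit Types h k l : int -> R -> R[i].

Lemma L2ZfamB h k : L2Zfam h -> L2Zfam k -> L2Zfam (fun j => h j \- k j).
Proof.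
move=> [h2 hS] [k2 kS]; split; first by move=> j; exact: cL2B.
have t j : l2norm (h j \- k j) <= l2norm (h j) + l2norm (k j).
  have k0 (f : R -> R[i]) : l2norm (f \- (fun=> 0)) = l2norm f.
    by apply: eq_l2norm => x; rewrite /= subr0.
  have := l2norm_triangle (h2 j) cL2_0 (k2 j).
  rewrite k0 (_ : l2norm ((fun=> 0) \- k j) = l2norm (k j))//.
  by apply: eq_l2norm => x; rewrite /= sub0r normcN.
by have [] := sumsq_triangle (fun j => l2norm_ge0 _) (fun j => l2norm_ge0 _)
  (fun j => l2norm_ge0 _) t hS kS.
Qed.

Lemma L2Zfam0 : L2Zfam (fun _ _ => 0 : R[i]).
Proof.
split=> [j|]; first exact: cL2_0.
by rewrite esum1// => j _; rewrite /l2norm cnorm0 expr0n.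
Qed.

Lemma distL2Z_triangle k h l : L2Zfam h -> L2Zfam k -> L2Zfam l ->
  distL2Z h l <= distL2Z h k + distL2Z k l.
Proof.
move=> hZ kZ lZ; have [_ hk] := L2ZfamB hZ kZ; have [_ kl] := L2ZfamB kZ lZ.
have t j : l2norm (h j \- l j) <= l2norm (h j \- k j) + l2norm (k j \- l j).
  by apply: l2norm_triangle; [case: hZ|case: kZ|case: lZ].
by have [] := sumsq_triangle (fun j => l2norm_ge0 _) (fun j => l2norm_ge0 _)
  (fun j => l2norm_ge0 _) t hk kl.
Qed.

Lemma distL2ZC h k : distL2Z h k = distL2Z k h.
Proof.
congr (Num.sqrt (fine _)); apply: eq_esum => j _; congr (_ ^+ 2)%:E.
by apply: eq_l2norm => x; rewrite /= -opprB normcN.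
Qed.

Lemma distL2Zxx h : distL2Z h h = 0.
Proof.
rewrite /distL2Z esum1 ?sqrtr0// => j _.
rewrite (_ : l2norm _ = 0) ?expr0n//.
rewrite (@eq_l2norm _ _ (fun=> 0)); first by rewrite /l2norm cnorm0.
by move=> x /=; rewrite subrr.
Qed.

Lemma distL2Z_eq0 h k : L2Zfam h -> L2Zfam k -> distL2Z h k = 0 ->
  forall j, {ae mu, forall x, h j x = k j x}.
Proof.
move=> hZ kZ hk0 j; have [_ hkS] := L2ZfamB hZ kZ.
apply: l2norm_eq0; [by case: hZ|by case: kZ|].
exact: (sumsq_eq0 hkS hk0).
Qed.

End L2Zfacts.

Section Quotients.
Context {R : realType}.
Local Notation mu := (@lebesgue_measure R).

Lemma phase_eq_refl : reflexive (@phase_eq R).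
Proof.
move=> f; apply/asboolP; exists 0; apply: aeW => x.
by rewrite expi0 mul1r.
Qed.

Lemma phase_eq_sym : symmetric (@phase_eq R).
Proof.
suff H f g : phase_eq f g -> @phase_eq R g f by move=> f g; apply/idP/idP; exact: H.
move=> /asboolP[t fg]; apply/asboolP; exists (- t).
apply: (@filterS _ _ (ae_filter_ringOfSetsType mu)) fg => x ->.
by rewrite mulrA -expiD addNr expi0 mul1r.
Qed.

Lemma phase_eq_trans : transitive (@phase_eq R).
Proof.
move=> g f h /asboolP[s fg] /asboolP[t gh]; apply/asboolP; exists (s + t).
apply: (@filterS2 _ _ (ae_filter_ringOfSetsType mu)) fg gh => x -> ->.
by rewrite mulrA -expiD.
Qed.

Lemma aeZ_eq_refl : reflexive (@aeZ_eq R).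
Proof. by move=> h; apply/asboolP => j; exact: aeW. Qed.

Lemma aeZ_eq_sym : symmetric (@aeZ_eq R).
Proof.
suff H h k : aeZ_eq h k -> @aeZ_eq R k h by move=> h k; apply/idP/idP; exact: H.
move=> /asboolP hk; apply/asboolP => j.
exact: (@filterS _ _ (ae_filter_ringOfSetsType mu)) (hk j).
Qed.

Lemma aeZ_eq_trans : transitive (@aeZ_eq R).
Proof.
move=> k h l /asboolP hk /asboolP kl; apply/asboolP => j.
by apply: (@filterS2 _ _ (ae_filter_ringOfSetsType mu)) (hk j) (kl j) => x -> ->.
Qed.

Canonical phase_equiv :=
  EquivRel (@phase_eq R) phase_eq_refl phase_eq_sym phase_eq_trans.
Canonical aeZ_equiv :=
  EquivRel (@aeZ_eq R) aeZ_eq_refl aeZ_eq_sym aeZ_eq_trans.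

End Quotients.

Definition L2plusS1 (R : realType) : Type := {eq_quot @phase_eq R}.
HB.instance Definition _ (R : realType) := Choice.on (L2plusS1 R).
HB.instance Definition _ (R : realType) := EqQuotient.on (L2plusS1 R).

Definition L2Z (R : realType) : Type := {eq_quot @aeZ_eq R}.
HB.instance Definition _ (R : realType) := Choice.on (L2Z R).
HB.instance Definition _ (R : realType) := EqQuotient.on (L2Z R).

Section Metrics.
Context {R : realType}.

Lemma L2plus_L2 (f : @L2plus R) : cLp 2%:E (val f).
Proof. by have /set_mem[] := valP f. Qed.

Lemma L2Z_fam (h : @L2Zfam R) : L2Zfam (val h).
Proof. exact: set_mem (valP h). Qed.

Definition mdistS1 (f g : L2plusS1 R) : R := distS1 (val (repr f)) (val (repr g)).

Definition mdistL2Z (h k : L2Z R) : R := distL2Z (val (repr h)) (val (repr k)).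

Lemma mdistS1xx f : mdistS1 f f = 0.
Proof. exact: distS1xx. Qed.

Lemma mdistS1_positivity f g : mdistS1 f g = 0 -> f = g.
Proof.
move=> fg; rewrite -[f]reprK -[g]reprK; apply/eqmodP/asboolP.
by apply: distS1_eq0 fg; exact: L2plus_L2.
Qed.

Lemma mdistS1C f g : mdistS1 f g = mdistS1 g f.
Proof. by apply: distS1C; exact: L2plus_L2. Qed.

Lemma mdistS1_triangle g f h : mdistS1 f h <= mdistS1 f g + mdistS1 g h.
Proof. by apply: distS1_triangle; exact: L2plus_L2. Qed.

Lemma mdistL2Zxx h : mdistL2Z h h = 0.
Proof. exact: distL2Zxx. Qed.

Lemma mdistL2Z_positivity h k : mdistL2Z h k = 0 -> h = k.
Proof.
move=> hk; rewrite -[h]reprK -[k]reprK; apply/eqmodP/asboolP.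
by apply: distL2Z_eq0 hk; exact: L2Z_fam.
Qed.

Lemma mdistL2ZC h k : mdistL2Z h k = mdistL2Z k h.
Proof. exact: distL2ZC. Qed.

Lemma mdistL2Z_triangle k h l : mdistL2Z h l <= mdistL2Z h k + mdistL2Z k l.
Proof. by apply: distL2Z_triangle; exact: L2Z_fam. Qed.

End Metrics.

HB.instance Definition _ (R : realType) := isMetric.Build R (L2plusS1 R)
  mdistS1xx mdistS1_positivity mdistS1C mdistS1_triangle.

HB.instance Definition _ (R : realType) := isMetric.Build R (L2Z R)
  mdistL2Zxx mdistL2Z_positivity mdistL2ZC mdistL2Z_triangle.

(* The two distances do not depend on the choice of representatives. *)
Section MetricsRepr.
Context {R : realType}.
Local Notation mu := (@lebesgue_measure R).

Lemma mdist_L2plusS1 (f g : @L2plus R) :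
  mdist (\pi_(L2plusS1 R) f) (\pi_(L2plusS1 R) g) = distS1 (val f) (val g).
Proof.
have H (u v : @L2plus R) : u = v %[mod L2plusS1 R] ->
    forall w : @L2plus R, distS1 (val u) (val w) = distS1 (val v) (val w).
  move=> /eqmodP/asboolP[t uv] w.
  have u2 := L2plus_L2 u; have v2 := L2plus_L2 v; have w2 := L2plus_L2 w.
  have uv0 : distS1 (val u) (val v) = 0.
    apply/eqP; rewrite eq_le; apply/andP; split.
      apply: le_trans (distS1_le _ _ t) _.
      have [um _] := u2; have [vm _] := cL2_expi t v2.
      rewrite (@l2norm_ae _ _ (fun=> 0)); first by rewrite /l2norm cnorm0.
      - exact: cmeasurableB.
      - exact: cmeasurable0.
      by apply: (@filterS _ _ (ae_filter_ringOfSetsType mu)) uv => x /= ->; rewrite subrr.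
    by have [s ->] := distS1_attained u2 v2; exact: l2norm_ge0.
  apply/eqP; rewrite eq_le; apply/andP; split.
    by rewrite (le_trans (distS1_triangle u2 v2 w2))// uv0 add0r.
  by rewrite (le_trans (distS1_triangle v2 u2 w2))// (distS1C v2 u2) uv0 add0r.
rewrite /mdist/= /mdistS1.
rewrite (H _ f); last by rewrite reprK.
rewrite [LHS]distS1C; [|exact: L2plus_L2|exact: L2plus_L2].
rewrite (H _ g); last by rewrite reprK.
by apply: distS1C; exact: L2plus_L2.
Qed.

Lemma mdist_L2Z (h k : @L2Zfam R) :
  mdist (\pi_(L2Z R) h) (\pi_(L2Z R) k) = distL2Z (val h) (val k).
Proof.
rewrite /mdist/= /mdistL2Z.
have hE : repr (\pi_(L2Z R) h) = h %[mod L2Z R] by rewrite reprK.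
have kE : repr (\pi_(L2Z R) k) = k %[mod L2Z R] by rewrite reprK.
move/eqmodP/asboolP: hE => hE; move/eqmodP/asboolP: kE => kE.
congr (Num.sqrt (fine _)); apply: eq_esum => j _; congr (_ ^+ 2)%:E.
have c (u : @L2Zfam R) : cmeasurable (val u j).
  by have [/(_ j)[]] := L2Z_fam u.
apply: l2norm_ae; [by apply: cmeasurableB; exact: c|by apply: cmeasurableB; exact: c|].
by apply: (@filterS2 _ _ (ae_filter_ringOfSetsType mu)) (hE j) (kE j) => x /= -> ->.
Qed.

End MetricsRepr.

Section WaveletModulus.
Context {R : realType}.

Definition wavelet_family (a : R) (psi_ : int -> R -> R[i]) :=
  exists psi : R -> R[i],
    [/\ cLp 1%:E psi, cLp 2%:E psi, cint psi = 0
      & forall j x, psi_ j x = (a ^ (- j))%:C * psi (a ^ (- j) * x)].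

Definition wavelet_modulus (psi_ : int -> R -> R[i]) (f : R -> R[i]) :
    int -> R -> R[i] :=
  fun j x => (normc (convolution f (psi_ j) x))%:C.

Definition L2Zfam_zero : @L2Zfam R := SigSub (mem_set L2Zfam0).

(* [insubd] returns its default [L2Zfam_zero] only on families that are not
   square-summable; this does not happen for analytic wavelets with a bounded
   Littlewood-Paley sum, the setting in which [wavelet_modulus_op] is used. *)
Definition wavelet_modulus_op (psi_ : int -> R -> R[i]) (f : L2plusS1 R) :
    L2Z R :=
  \pi_(L2Z R) (insubd L2Zfam_zero (wavelet_modulus psi_ (val (repr f)))).

End WaveletModulus.

(* Main.v *)
Require Import Defs.
From mathcomp Require Import all_boot all_order all_algebra.
From mathcomp Require Import complex ring lra.
From mathcomp Require Import all_classical all_reals all_analysis.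
From mathcomp Require Import measurable_realfun.

Set Implicit Arguments.
Unset Strict Implicit.
Unset Printing Implicit Defensive.

Import Order.TTheory GRing.Theory Num.Theory.
Import numFieldNormedType.Exports.
Import Normc.

Local Open Scope classical_set_scope.
Local Open Scope ring_scope.
Local Open Scope complex_scope.
Local Open Scope quotient_scope.

(** Write [W f] for the family of moduli [|f * psi_j|].  The Littlewood-Paley
inequality and Plancherel's formula make [f |-> (f * psi_j)_j] a frame on
[L2plus]: [A |f|^2 <= sum_j |f * psi_j|^2 <= B |f|^2] ([frame_bounds],
[L2plus_frame]).  Closedness of the image and continuity of the inverse both
follow from one compactness statement ([wavelet_modulus_compact]): if
[W f_n --> h] then some functions [f_n] come arbitrarily close to an [f] in
[L2plus] with [W f = h].  For closedness this is applied to a sequence of the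
image converging to [h].  For continuity of the inverse, a sequence
contradicting it at [U g] has a term close to a class [G] with [U G = U g], and
[G = g] because [U] has a left inverse.

The compactness statement rests on the fact that taking moduli loses only
phases, and that the phases of the functions [f_n * psi_j] converge along a
subsequence.  By the lower frame bound the [f_n] are bounded in [L^2].  Each
[psi_j] is continuous under translation in [L^2], so for each [j] the functions
[f_n * psi_j] are uniformly bounded and equicontinuous; a diagonal argument over
[j] and the rationals gives a subsequence along which [f_n * psi_j] converges at
every point to a limit [F_j] ([conv_pointwise_subsequence]).

Pointwise convergence improves to convergence in [L^2] because the moduli
already converge there.  Indeed [|c - F|] is at most [||c| - h|] plus a
nonnegative defect which is dominated by [|h| + |F|] and which tends to [0]
together with [c - F] ([modulus_defect]); dominated convergence applies to the
defect for each [j], and then to the sum over [j], since by Fatou's lemma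
[|F_j| <= |h_j|] in norm.  Hence the families [(f_n * psi_j)_j] form a Cauchy
sequence for the norm [(sum_j |.|^2)^(1/2)].  The lower frame bound, applied to
differences, makes the subsequence of [f_n] Cauchy in [L^2]; its limit is in
[L2plus] ([cL2_complete], [L2plus_closed]), and its image is [h] because [W] is
Lipschitz by the upper frame bound.

Plancherel's formula on the intersection of [L^1] and [L^2] ([plancherel]) is
proved with the Poisson kernel, the Fourier transform of [exp (- e |w|)]:
damping the power spectrum by this factor turns its integral into
[int u (u * P_e)] ([damped_power_poisson]), which gives an upper bound for every
integrable function, and an equality when the function is moreover continuous
and bounded.  The lower bound in general is reduced to that case by
convolution with tent functions, which is continuous and bounded, and converges
to the given function at every Lebesgue point ([plancherel_ge]).  The formula passes
to the Fourier transform on [L^2] by density ([plancherelL2]). *)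

(** * Affine changes of variable *)

Section Affine.
Context {R : realType}.
Local Notation mu := (@lebesgue_measure R).

Lemma measurable_affine (c d : R) : measurable_fun setT (fun x : R => c * x + d).
Proof.
by apply: measurable_funD => //; apply: measurable_funM.
Qed.

Lemma preimage_affine_pos (c d a b : R) : 0 < c ->
  (fun x : R => c * x + d) @^-1` `]a, b]%classic = `](a - d) / c, (b - d) / c]%classic.
Proof.
move=> c0; apply/seteqP; split => x /=; rewrite !in_itv/= => /andP[h1 h2];
  apply/andP; split.
- by rewrite ltr_pdivrMr// mulrC ltrBlDr.
- by rewrite ler_pdivlMr// mulrC lerBrDr.
- by move: h1; rewrite ltr_pdivrMr// mulrC ltrBlDr.
- by move: h2; rewrite ler_pdivlMr// mulrC lerBrDr.
Qed.

Lemma preimage_affine_neg (c d a b : R) : c < 0 ->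
  (fun x : R => c * x + d) @^-1` `]a, b]%classic = `[(b - d) / c, (a - d) / c[%classic.
Proof.
move=> c0; apply/seteqP; split => x /=; rewrite !in_itv/= => /andP[h1 h2];
  apply/andP; split.
- by rewrite ler_ndivrMr// mulrC lerBrDr.
- by rewrite ltr_ndivlMr// mulrC ltrBlDr.
- by move: h2; rewrite ltr_ndivlMr// mulrC ltrBlDr.
- by move: h1; rewrite ler_ndivrMr// mulrC lerBrDr.
Qed.

Lemma lebesgue_measure_affine (c d a b : R) : c != 0 ->
  (`|c|%:E * mu ((fun x : R => c * x + d)%R @^-1` `]a, b]%classic))%E = mu `]a, b]%classic.
Proof.
move=> cn0; case: (ltgtP c 0) cn0 => // c0 _.
  rewrite preimage_affine_neg// !lebesgue_measure_itv/= !lte_fin.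
  rewrite ltr_ndivrMr// mulfVK ?lt_eqF// ltrD2r.
  case: ifPn => ab; last by rewrite mule0.
  rewrite -!EFinB -EFinM; congr EFin; rewrite ltr0_norm//.
  by field; rewrite lt_eqF.
rewrite preimage_affine_pos// !lebesgue_measure_itv/= !lte_fin.
rewrite ltr_pdivrMr// mulfVK ?gt_eqF// ltrD2r.
case: ifPn => ab; last by rewrite mule0.
rewrite -!EFinB -EFinM; congr EFin; rewrite gtr0_norm//.
by field; rewrite gt_eqF.
Qed.

(** Both [mu] and [|c|] times the image of [mu] under [x |-> c x + d] give its
length to every interval, so they agree by uniqueness of Lebesgue measure. *)
Lemma ge0_integral_affine (c d : R) (f : R -> \bar R) : c != 0 ->
  measurable_fun setT f -> (forall x, 0 <= f x)%E ->
  (\int[mu]_x f (c * x + d)%R = `|c|^-1%:E * \int[mu]_x f x)%E.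
Proof.
move=> c0 mf f0.
pose phi : measurableTypeR R -> measurableTypeR R := fun x => c * x + d.
have mphi : measurable_fun setT phi by exact: measurable_affine.
pose nu0 : {measure set (measurableTypeR R) -> \bar R} :=
  measure_function_pushforward__canonical__measure_function_Measure mu mphi.
pose nu : {measure set (measurableTypeR R) -> \bar R} :=
  mscale (NngNum (normr_ge0 c)) nu0.
have munu A : measurable A -> mu A = nu A.
  apply: lebesgue_measure_unique => X [[a b] /= _ <-].
  by rewrite /nu /mscale/= /pushforward lebesgue_measure_affine.
rewrite [in RHS](@eq_measure_integral _ _ _ setT nu)//; last first.
  by move=> A mA _; exact: munu.
rewrite /nu ge0_integral_mscale//= ge0_integral_pushforward//.
by rewrite muleA -EFinM mulVf ?normr_eq0// mul1e.
Qed.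

Lemma integral_isometry (c d : R) (f : R -> \bar R) : `|c| = 1 ->
  measurable_fun setT f ->
  (\int[mu]_x f (c * x + d)%R = \int[mu]_x f x)%E.
Proof.
move=> c1 mf.
have c0 : c != 0 by rewrite -normr_eq0 c1 oner_eq0.
rewrite [LHS]integralE [RHS]integralE.
have H (g : R -> \bar R) : measurable_fun setT g -> (forall x, 0 <= g x)%E ->
   (\int[mu]_x g (c * x + d)%R = \int[mu]_x g x)%E.
  by move=> mg g0; rewrite ge0_integral_affine// c1 invr1 mul1e.
congr (_ - _)%E.
  rewrite -(H (f^\+)%E); [|exact: measurable_funepos|by []].
  by apply: eq_integral => x _; rewrite funepos_comp.
rewrite -(H (f^\-)%E); [|exact: measurable_funeneg|by []].
by apply: eq_integral => x _; rewrite funeneg_comp.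
Qed.

Lemma integral_translate (d : R) (f : R -> \bar R) : measurable_fun setT f ->
  (\int[mu]_x f (x + d)%R = \int[mu]_x f x)%E.
Proof.
move=> mf; rewrite -[RHS](@integral_isometry 1 d f) ?normr1//.
by apply: eq_integral => x _; rewrite mul1r.
Qed.

Lemma integral_reflect (d : R) (f : R -> \bar R) : measurable_fun setT f ->
  (\int[mu]_x f (d - x)%R = \int[mu]_x f x)%E.
Proof.
move=> mf; rewrite -[RHS](@integral_isometry (-1) d f) ?normrN1//.
by apply: eq_integral => x _; rewrite mulN1r addrC.
Qed.

Lemma Rintegral_translate (d : R) (f : R -> R) : measurable_fun setT f ->
  \int[mu]_x f (x + d) = \int[mu]_x f x.
Proof.
move=> mf; congr fine; apply: (integral_translate d (f := EFin \o f)).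
exact/measurable_EFinP.
Qed.

Lemma Rintegral_reflect (d : R) (f : R -> R) : measurable_fun setT f ->
  \int[mu]_x f (d - x) = \int[mu]_x f x.
Proof.
move=> mf; congr fine; apply: (integral_reflect d (f := EFin \o f)).
exact/measurable_EFinP.
Qed.

Lemma integrable_affine (c d : R) (f : R -> R) : c != 0 ->
  mu.-integrable setT (EFin \o f) ->
  mu.-integrable setT (EFin \o (fun x => f (c * x + d))).
Proof.
move=> c0 /integrableP[mf fi].
have mfe : measurable_fun setT f by exact/measurable_EFinP.
apply/integrableP; split.
  apply/measurable_EFinP; apply: (measurableT_comp mfe).
  exact: measurable_affine.
rewrite (ge0_integral_affine d c0 (f := fun x => `|(f x)%:E|%E))//.
  by rewrite lte_mul_pinfty.
by apply: measurableT_comp.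
Qed.

Lemma Rintegral_affine (c d : R) (f : R -> R) : c != 0 ->
  mu.-integrable setT (EFin \o f) ->
  \int[mu]_x f (c * x + d) = `|c|^-1 * \int[mu]_x f x.
Proof.
move=> c0 fi; have mf : measurable_fun setT f.
  by apply/measurable_EFinP; case/integrableP: fi.
have H (g : R -> \bar R) : measurable_fun setT g -> (forall x, 0 <= g x)%E ->
   (\int[mu]_x g (c * x + d)%R = `|c|^-1%:E * \int[mu]_x g x)%E.
  by move=> mg g0; rewrite ge0_integral_affine.
have mfe : measurable_fun setT (EFin \o f) by exact/measurable_EFinP.
rewrite /Rintegral.
have -> : (\int[mu]_x (f (c * x + d)%R)%:E = `|c|^-1%:E * \int[mu]_x (f x)%:E)%E.
  rewrite [LHS]integralE [in RHS]integralE muleBr//; last first.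
    rewrite fin_num_adde_defr//.
    apply: integrable_pos_fin_num => //.
  congr (_ - _)%E.
    rewrite -(H ((EFin \o f)^\+)%E); [|exact: measurable_funepos|by []].
    by apply: eq_integral => x _; rewrite (funepos_comp (EFin \o f)).
  rewrite -(H ((EFin \o f)^\-)%E); [|exact: measurable_funeneg|by []].
  by apply: eq_integral => x _; rewrite (funeneg_comp (EFin \o f)).
by rewrite fineM// integrable_fin_num.
Qed.
End Affine.

(** * Complex-valued integrable functions *)

Section ComplexBasics.
Context {R : realType}.
Local Notation mu := (@lebesgue_measure R).
Implicit Types (f g : R -> R[i]).

Lemma ReM (x y : R[i]) : complex.Re (x * y) =
  complex.Re x * complex.Re y - complex.Im x * complex.Im y.
Proof. by case: x => a b; case: y => c d. Qed.

Lemma ImM (x y : R[i]) : complex.Im (x * y) =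
  complex.Re x * complex.Im y + complex.Im x * complex.Re y.
Proof. by case: x => a b; case: y => c d. Qed.

Lemma ReD (x y : R[i]) : complex.Re (x + y) = complex.Re x + complex.Re y.
Proof. by case: x => a b; case: y => c d. Qed.

Lemma ImD (x y : R[i]) : complex.Im (x + y) = complex.Im x + complex.Im y.
Proof. by case: x => a b; case: y => c d. Qed.

Lemma ReB (x y : R[i]) : complex.Re (x - y) = complex.Re x - complex.Re y.
Proof. by case: x => a b; case: y => c d. Qed.

Lemma ImB (x y : R[i]) : complex.Im (x - y) = complex.Im x - complex.Im y.
Proof. by case: x => a b; case: y => c d. Qed.

Lemma complex_ext (x y : R[i]) : complex.Re x = complex.Re y ->
  complex.Im x = complex.Im y -> x = y.
Proof. by case: x => a b; case: y => c d /= -> ->. Qed.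

Lemma normc2E (x : R[i]) : normc x ^+ 2 = complex.Re x ^+ 2 + complex.Im x ^+ 2.
Proof. by case: x => a b /=; rewrite sqr_sqrtr// addr_ge0// sqr_ge0. Qed.

Lemma Re_le_normc (x : R[i]) : `|complex.Re x| <= normc x.
Proof.
rewrite -(@ler_pXn2r _ 2)// ?nnegrE ?normc_ge0//.
by rewrite normc2E real_normK ?num_real// lerDl sqr_ge0.
Qed.

Lemma Im_le_normc (x : R[i]) : `|complex.Im x| <= normc x.
Proof.
rewrite -(@ler_pXn2r _ 2)// ?nnegrE ?normc_ge0//.
by rewrite normc2E real_normK ?num_real// lerDr sqr_ge0.
Qed.

Lemma normc_real (x : R) : normc x%:C = `|x|.
Proof. by rewrite /= expr0n/= addr0 sqrtr_sqr. Qed.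

Lemma cmeasurableD f g : cmeasurable f -> cmeasurable g -> cmeasurable (f \+ g).
Proof.
move=> [fr fi] [gr gi]; split.
  by under eq_fun do rewrite ReD; exact: measurable_funD.
by under eq_fun do rewrite ImD; exact: measurable_funD.
Qed.

Lemma cmeasurableM f g : cmeasurable f -> cmeasurable g -> cmeasurable (f \* g).
Proof.
move=> [fr fi] [gr gi]; split.
  by under eq_fun do rewrite ReM; apply: measurable_funB; exact: measurable_funM.
by under eq_fun do rewrite ImM; apply: measurable_funD; exact: measurable_funM.
Qed.

Lemma cmeasurable_comp f (h : R -> R) : cmeasurable f -> measurable_fun setT h ->
  cmeasurable (f \o h).
Proof.
by move=> [fr fi] mh; split; [exact: measurableT_comp fr mh|exact: measurableT_comp fi mh].
Qed.

Lemma cmeasurable_real (h : R -> R) : measurable_fun setT h ->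
  cmeasurable (fun x => (h x)%:C).
Proof. by move=> mh; split => //=; exact: measurable_cst. Qed.

Lemma cmeasurable_expi (h : R -> R) : measurable_fun setT h ->
  cmeasurable (fun x => expi (h x)).
Proof.
move=> mh; split => /=.
  apply: measurableT_comp mh; apply: continuous_measurable_fun; exact: continuous_cos.
apply: measurableT_comp mh; apply: continuous_measurable_fun; exact: continuous_sin.
Qed.

Lemma cL1P f : cLp 1%:E f <->
  cmeasurable f /\ mu.-integrable setT (EFin \o (normc \o f)).
Proof.
split=> -[mf nf]; split=> //.
  apply/integrableP; split; first by apply/measurable_EFinP; exact: cmeasurable_normc.
  by move: nf; rewrite /cnorm Lnorm1.
by move/integrableP : nf => [_]; rewrite /cnorm Lnorm1.
Qed.

Lemma cL1_dom f (g : R -> R) : cmeasurable f ->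
  mu.-integrable setT (EFin \o g) -> (forall x, normc (f x) <= g x) ->
  cLp 1%:E f.
Proof.
move=> mf ig fg; apply/cL1P; split=> //.
apply: le_integrable ig => //; first by apply/measurable_EFinP; exact: cmeasurable_normc.
move=> x _ /=; rewrite lee_fin ger0_norm ?normc_ge0//.
by rewrite (le_trans (fg x))// ler_norm.
Qed.

Lemma cL1_normc f : cLp 1%:E f -> mu.-integrable setT (EFin \o (normc \o f)).
Proof. by move/cL1P => []. Qed.

Lemma cL1_Re f : cLp 1%:E f -> mu.-integrable setT (EFin \o (fun x => complex.Re (f x))).
Proof.
move=> /cL1P[[mr mi] nf]; apply: le_integrable nf => //.
  exact/measurable_EFinP.
by move=> x _ /=; rewrite lee_fin [leRHS]ger0_norm ?normc_ge0// Re_le_normc.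
Qed.

Lemma cL1_Im f : cLp 1%:E f -> mu.-integrable setT (EFin \o (fun x => complex.Im (f x))).
Proof.
move=> /cL1P[[mr mi] nf]; apply: le_integrable nf => //.
  exact/measurable_EFinP.
by move=> x _ /=; rewrite lee_fin [leRHS]ger0_norm ?normc_ge0// Im_le_normc.
Qed.

Lemma cL1D f g : cLp 1%:E f -> cLp 1%:E g -> cLp 1%:E (f \+ g).
Proof.
move=> f1 g1; apply: (@cL1_dom _ (fun x => normc (f x) + normc (g x))).
- by apply: cmeasurableD; [case: f1|case: g1].
- exact: (integrableD _ (cL1_normc f1) (cL1_normc g1)).
- by move=> x; exact: le_normcD.
Qed.

Lemma cL1M f g (M : R) : cLp 1%:E f -> cmeasurable g ->
  (forall x, normc (g x) <= M) -> cLp 1%:E (f \* g).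
Proof.
move=> f1 mg gM; apply: (@cL1_dom _ (fun x => normc (f x) * M)).
- by apply: cmeasurableM => //; case: f1.
- exact: (integrableZr _ _ (cL1_normc f1)).
- by move=> x; rewrite normcM ler_wpM2l ?normc_ge0.
Qed.

Lemma cL1Z (c : R[i]) f : cLp 1%:E f -> cLp 1%:E (fun x => c * f x).
Proof.
move=> f1; apply: (@cL1_dom _ (fun x => normc c * normc (f x))).
- by apply: cmeasurableZ; case: f1.
- exact: (integrableZl _ _ (cL1_normc f1)).
- by move=> x; rewrite normcM.
Qed.

Lemma cL1B f g : cLp 1%:E f -> cLp 1%:E g -> cLp 1%:E (f \- g).
Proof.
move=> f1 g1; have := cL1D f1 (cL1Z (-1) g1).
by congr (cLp _ _); apply/funext => x /=; rewrite mulN1r.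
Qed.

Lemma cL1_affine f (c d : R) : c != 0 -> cLp 1%:E f ->
  cLp 1%:E (fun x => f (c * x + d)).
Proof.
move=> c0 f1; apply/cL1P; split.
  by apply: cmeasurable_comp; [case: f1|exact: measurable_affine].
exact: (integrable_affine d c0 (cL1_normc f1)).
Qed.

Lemma eq_cint f g : f =1 g -> cint f = cint g.
Proof. by move=> /funext ->. Qed.

Lemma cintD f g : cLp 1%:E f -> cLp 1%:E g -> cint (f \+ g) = cint f + cint g.
Proof.
move=> f1 g1; apply: complex_ext; rewrite ?ReD ?ImD /=.
  under eq_Rintegral do rewrite ReD.
  by apply: RintegralD => //; exact: cL1_Re.
under eq_Rintegral do rewrite ImD.
by apply: RintegralD => //; exact: cL1_Im.
Qed.

Lemma cintZ (c : R[i]) f : cLp 1%:E f -> cint (fun x => c * f x) = c * cint f.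
Proof.
move=> f1; have i1 := cL1_Re f1; have i2 := cL1_Im f1.
have Z (k : R) (h : R -> R) : mu.-integrable setT (EFin \o h) ->
   mu.-integrable setT (EFin \o (fun x => k * h x)).
  by move=> ih; exact: (integrableZl _ _ ih).
apply: complex_ext; rewrite ?ReM ?ImM /=.
  under eq_Rintegral do rewrite ReM.
  rewrite RintegralB//; [|exact: Z i1|exact: Z i2].
  by rewrite RintegralZl// RintegralZl.
under eq_Rintegral do rewrite ImM.
rewrite RintegralD//; [|exact: Z i2|exact: Z i1].
by rewrite RintegralZl// RintegralZl.
Qed.

Lemma cintB f g : cLp 1%:E f -> cLp 1%:E g -> cint (f \- g) = cint f - cint g.
Proof.
move=> f1 g1; rewrite -mulN1r -cintZ// -cintD//; last exact: cL1Z.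
by apply: eq_cint => x /=; rewrite mulN1r.
Qed.

(** Rotating the value of an integral onto the positive real axis is what
reduces [normc_cint] to the triangle inequality for real integrals. *)
Lemma unit_phase (z : R[i]) : z != 0 ->
  exists2 c : R[i], normc c = 1 & complex.Re (c * z) = normc z.
Proof.
move=> z0; have nz : normc z != 0 by apply: contra_neq z0 => /eq0_normc.
exists ((z^*)%C * ((normc z)^-1)%:C).
  rewrite normcM normc_real ger0_norm ?invr_ge0 ?normc_ge0//.
  have -> : normc (z^*)%C = normc z by case: (z) => a b /=; rewrite sqrrN.
  by rewrite mulfV.
move: nz (normc2E z); clear z0; case: z => a b /=.
set n := Num.sqrt _ => n0 h.
apply: (mulfI n0); rewrite -[RHS]expr2 h.
by field.
Qed.

Lemma normc_cint f : cLp 1%:E f -> normc (cint f) <= \int[mu]_x normc (f x).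
Proof.
move=> f1; set I := cint f.
have [->|I0] := eqVneq I 0; first by rewrite normc0 Rintegral_ge0// => x _; exact: normc_ge0.
have [c nc cI] := unit_phase I0.
rewrite -cI /I -cintZ//=.
apply: le_Rintegral => //; [exact: (cL1_Re (cL1Z _ f1))|exact: cL1_normc|].
move=> x _; apply: (le_trans (ler_norm _)); apply: (le_trans (Re_le_normc _)).
by rewrite normcM nc mul1r.
Qed.

Lemma cint_translate (d : R) f : cmeasurable f ->
  cint (fun x => f (x + d)) = cint f.
Proof.
move=> [mr mi]; apply: complex_ext => /=.
  exact: (Rintegral_translate d mr).
exact: (Rintegral_translate d mi).
Qed.

(** The squared [L^2] norm as an extended real, defined also when it is
infinite: this is the form in which monotone convergence, Fatou's lemma and
Tonelli's theorem apply. *)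
Definition energy f : \bar R := (\int[mu]_x (normc (f x) ^+ 2)%:E)%E.

Lemma energy_ge0 f : (0 <= energy f)%E.
Proof. by apply: integral_ge0 => x _; rewrite lee_fin sqr_ge0. Qed.

Lemma measurable_normc2 f : cmeasurable f ->
  measurable_fun setT (fun x => (normc (f x) ^+ 2)%:E).
Proof.
by move=> mf; apply/measurable_EFinP; apply: measurable_funX; exact: cmeasurable_normc.
Qed.

Lemma cnorm2_energy f : cnorm 2%:E f = (energy f `^ 2^-1)%E.
Proof.
rewrite /cnorm unlock /=; congr (_ `^ _)%E.
by apply: eq_integral => x _; rewrite /= powR_mulrn// ger0_norm// normc_ge0.
Qed.

Lemma cL2P f : cLp 2%:E f <-> cmeasurable f /\ (energy f < +oo)%E.
Proof.
split=> -[mf nf]; split=> //; move: nf; rewrite cnorm2_energy.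
  by apply: contraTT; rewrite -!leNgt !leye_eq => /eqP ->; rewrite poweRyr ?invr_eq0.
by move=> /poweR_lty; apply.
Qed.

Lemma energyE f : cLp 2%:E f -> energy f = (l2norm f ^+ 2)%:E.
Proof.
move=> f2; have [mf fe] := (cL2P f).1 f2.
have -> : energy f = (cnorm 2%:E f `^ 2)%E.
  by rewrite cnorm2_energy -poweRrM ?energy_ge0// mulVf// poweRe1// energy_ge0.
by rewrite l2normE// poweR_EFin powR_mulrn// l2norm_ge0.
Qed.

Lemma cL2_integrable f : cLp 2%:E f ->
  mu.-integrable setT (EFin \o (fun x => normc (f x) ^+ 2)).
Proof.
move=> /cL2P[mf fe]; apply/integrableP; split; first exact: measurable_normc2.
rewrite (_ : (\int[_]_(x in _) _)%E = energy f)//; apply: eq_integral => x _ /=.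
by rewrite ger0_norm// sqr_ge0.
Qed.

End ComplexBasics.

(** * The Cauchy-Schwarz inequality *)

Section CauchySchwarz.
Context {R : realType}.
Local Notation mu := (@lebesgue_measure R).
Implicit Types (f g : R -> R[i]).

Lemma cL2_affine f (c d : R) : c != 0 -> cLp 2%:E f ->
  cLp 2%:E (fun x => f (c * x + d)).
Proof.
move=> c0 /cL2P[mf fe]; apply/cL2P; split.
  by apply: cmeasurable_comp mf _; exact: measurable_affine.
rewrite /energy (ge0_integral_affine d c0 (f := fun x => (normc (f x) ^+ 2)%:E)).
- by rewrite lte_mul_pinfty.
- exact: measurable_normc2.
- by move=> x; rewrite lee_fin sqr_ge0.
Qed.

Lemma energy_reflect f (d : R) : cmeasurable f ->
  energy (fun x => f (d - x)) = energy f.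
Proof.
move=> mf; apply: (integral_reflect d (f := fun x => (normc (f x) ^+ 2)%:E)).
exact: measurable_normc2.
Qed.

Lemma cL2_reflect f (d : R) : cLp 2%:E f -> cLp 2%:E (fun x => f (d - x)).
Proof.
move=> f2; have := cL2_affine d (_ : -1 != 0) f2.
rewrite oppr_eq0 oner_eq0 => /(_ isT).
by congr (cLp _ _); apply/funext => x; rewrite mulN1r addrC.
Qed.

Lemma l2norm_reflect f (d : R) : cmeasurable f ->
  l2norm (fun x => f (d - x)) = l2norm f.
Proof. by move=> mf; rewrite /l2norm !cnorm2_energy energy_reflect. Qed.

Lemma cL2M f g : cLp 2%:E f -> cLp 2%:E g -> cLp 1%:E (f \* g).
Proof.
move=> f2 g2; apply: (@cL1_dom _ _ (fun x => normc (f x) ^+ 2 + normc (g x) ^+ 2)).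
- by apply: cmeasurableM; [case: f2|case: g2].
- exact: (integrableD _ (cL2_integrable f2) (cL2_integrable g2)).
move=> x; rewrite normcM; set a := normc (f x); set b := normc (g x).
have := sqr_ge0 (a - b); have := sqr_ge0 a; have := sqr_ge0 b; nra.
Qed.

Lemma Rintegral_cauchy_schwarz f g : cLp 2%:E f -> cLp 2%:E g ->
  \int[mu]_x (normc (f x * g x)) <= l2norm f * l2norm g.
Proof.
move=> f2 g2.
have := @hoelder _ _ _ mu (normc \o f) (normc \o g) 2 2
  (cmeasurable_normc f2.1) (cmeasurable_normc g2.1) ltac:(by []) ltac:(by []).
(* The exponents are conjugate: [2^-1 + 2^-1 = 1]. *)
rewrite -[_^-1]mul1r -splitr => /(_ erefl).
rewrite Lnorm1 -/(cnorm 2%:E f) -/(cnorm 2%:E g) !l2normE// -EFinM => h.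
have i1 := cL1_normc (cL2M f2 g2).
rewrite -lee_fin; apply: le_trans h; rewrite /Rintegral fineK; last exact: integrable_fin_num.
rewrite le_eqVlt; apply/orP; left; apply/eqP; apply: eq_integral => x _ /=.
by rewrite normcM ger0_norm// mulr_ge0// normc_ge0.
Qed.

Lemma cauchy_schwarz f g : cLp 2%:E f -> cLp 2%:E g ->
  normc (cint (f \* g)) <= l2norm f * l2norm g.
Proof.
move=> f2 g2; apply: le_trans (Rintegral_cauchy_schwarz f2 g2).
exact: normc_cint (cL2M f2 g2).
Qed.

End CauchySchwarz.

(** * Iterated integrals *)

Section FubiniReal.
Context {R : realType}.
Local Notation mu := (@lebesgue_measure R).

Lemma integrable_le (f g : R -> R) : measurable_fun setT f ->
  (forall x, `|f x| <= g x) -> mu.-integrable setT (EFin \o g) ->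
  mu.-integrable setT (EFin \o f).
Proof.
move=> mf fg ig; apply: le_integrable ig => //; first exact/measurable_EFinP.
by move=> x _ /=; rewrite lee_fin (le_trans (fg x))// ler_norm.
Qed.

Lemma integrable_scale (k : R) (f : R -> R) : mu.-integrable setT (EFin \o f) ->
  mu.-integrable setT (EFin \o (fun x => k * f x)).
Proof. by move=> h; exact: (integrableZl _ _ h). Qed.

Lemma integrable_normr (f : R -> R) : mu.-integrable setT (EFin \o f) ->
  mu.-integrable setT (EFin \o (fun x => `|f x|)).
Proof. exact: integrable_norm. Qed.

Lemma measurable_abseE d (T : measurableType d) (f : T -> R) :
  measurable_fun setT f -> measurable_fun setT (fun x => `|(f x)%:E|%E).
Proof. by move=> mf; apply/measurable_EFinP; exact: measurableT_comp. Qed.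

(** The sections may fail to be integrable: the integrals of positive and negative
parts are measurable by Tonelli's theorem, and so is [fine] of their difference. *)
Lemma measurable_Rintegral (h : R * R -> R) : measurable_fun setT h ->
  measurable_fun setT (fun x => \int[mu]_y h (x, y)).
Proof.
move=> mh; rewrite /Rintegral; apply: (measurableT_comp (@fine_measurable R setT measurableT)).
have mh' : measurable_fun setT (EFin \o h) by exact/measurable_EFinP.
rewrite (_ : (fun x => _) = ((fun x => \int[mu]_y (EFin \o h)^\+ (x, y)) \-
    (fun x => \int[mu]_y (EFin \o h)^\- (x, y)))%E); last first.
  apply/funext => x; rewrite [LHS]integralE.
  by under eq_integral do rewrite (funepos_comp (EFin \o h));
     under [X in (_ - X)%E]eq_integral do rewrite (funeneg_comp (EFin \o h)).
apply: emeasurable_funB.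
  by apply: (measurable_fun_fubini_tonelli_F (m2 := mu) (EFin \o h)^\+%E) => //; exact: measurable_funepos.
by apply: (measurable_fun_fubini_tonelli_F (m2 := mu) (EFin \o h)^\-%E) => //; exact: measurable_funeneg.
Qed.

(** The finite double integral alone gives integrable sections only almost
everywhere; asking it of all sections makes the iterated integrals equal
without exceptional sets. *)
Lemma Rfubini (h : R * R -> R) : measurable_fun setT h ->
  (forall x, mu.-integrable setT (fun y => (h (x, y))%:E)) ->
  (forall y, mu.-integrable setT (fun x => (h (x, y))%:E)) ->
  (\int[mu]_x \int[mu]_y `|(h (x, y))%:E| < +oo)%E ->
  \int[mu]_x (\int[mu]_y h (x, y)) = \int[mu]_y (\int[mu]_x h (x, y)).
Proof.
move=> mh i1 i2 hoo.
have mh' : measurable_fun setT (EFin \o h) by exact/measurable_EFinP.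
have ih : (mu \x mu)%E.-integrable setT (EFin \o h).
  by apply/integrable12ltyP.
have := Fubini ih => /(congr1 fine) /= E.
rewrite /Rintegral; transitivity (fine (\int[mu]_x \int[mu]_y (h (x, y))%:E)%E).
  by congr fine; apply: eq_integral => x _; rewrite fineK ?integrable_fin_num.
by rewrite E; congr fine; apply: eq_integral => y _; rewrite fineK ?integrable_fin_num.
Qed.

Lemma integrable_prod_dom (h : R * R -> R) (a b : R -> R) : measurable_fun setT h ->
  mu.-integrable setT (EFin \o a) -> mu.-integrable setT (EFin \o b) ->
  (forall x y, `|h (x, y)| <= `|a x| * `|b y|) ->
  [/\ forall x, mu.-integrable setT (fun y => (h (x, y))%:E),
      forall y, mu.-integrable setT (fun x => (h (x, y))%:E) &
      (\int[mu]_x \int[mu]_y `|(h (x, y))%:E| < +oo)%E].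
Proof.
move=> mh ia ib hab.
have ma : measurable_fun setT a by apply/measurable_EFinP; case/integrableP: ia.
have mb : measurable_fun setT b by apply/measurable_EFinP; case/integrableP: ib.
have m1 x : measurable_fun setT (fun y => h (x, y)).
  exact: (measurableT_comp mh (measurable_fun_pair (measurable_cst _) (@measurable_id _ _ _))).
have m2 y : measurable_fun setT (fun x => h (x, y)).
  exact: (measurableT_comp mh (measurable_fun_pair (@measurable_id _ _ _) (measurable_cst _))).
split.
- move=> x; apply: (@integrable_le (fun y => h (x, y)) (fun y => `|a x| * `|b y|)) => //.
  exact/integrable_scale/integrable_normr.
- move=> y; apply: (@integrable_le (fun x => h (x, y)) (fun x => `|b y| * `|a x|)) => //.
    by move=> x; rewrite mulrC.
  exact/integrable_scale/integrable_normr.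
- move/integrableP: (ia) => [_ ia']; move/integrableP: (ib) => [_ ib'].
  have ib0 : (0 <= \int[mu]_y `|(b y)%:E|)%E by apply: integral_ge0.
  have H x : (\int[mu]_y `|(h (x, y))%:E| <= `|(a x)%:E| * \int[mu]_y `|(b y)%:E|)%E.
    rewrite -ge0_integralZl//; [|exact: (measurable_abseE mb)].
    apply: ge0_le_integral => //.
    + exact: (measurable_abseE (m1 x)).
    + by apply/measurable_funeM; exact: (measurable_abseE mb).
    + by move=> y _; rewrite /= -EFinM lee_fin.
  apply: (@le_lt_trans _ _ (\int[mu]_x (`|(a x)%:E| * \int[mu]_y `|(b y)%:E|))%E).
    apply: ge0_le_integral => //.
    + by move=> x _; apply: integral_ge0.
    + apply: (measurable_fun_fubini_tonelli_F (m2 := mu) (fun z => `|(h z)%:E|%E)) => //.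
      exact: measurable_abseE.
    + apply: emeasurable_funM; last exact: measurable_cst.
      exact: (measurable_abseE ma).
  rewrite ge0_integralZr//; [|exact: (measurable_abseE ma)].
  rewrite lte_mul_pinfty ?integral_ge0//.
  by rewrite ge0_fin_numE ?integral_ge0.
Qed.

End FubiniReal.

(** * Convolution and Fourier transform of integrable functions *)

Section Convolution.
Context {R : realType}.
Local Notation mu := (@lebesgue_measure R).
Implicit Types (f g u v : R -> R[i]).

(** Measurability on the plane: [cmeasurable] only concerns functions of one
real variable. *)
Definition cmeasurable2 (h : R * R -> R[i]) :=
  measurable_fun setT (fun z => complex.Re (h z)) /\
  measurable_fun setT (fun z => complex.Im (h z)).

Lemma cmeasurable2_comp f (k : R * R -> R) : cmeasurable f -> measurable_fun setT k ->
  cmeasurable2 (fun z => f (k z)).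
Proof.
by move=> [fr fi] mk; split; [exact: measurableT_comp fr mk|exact: measurableT_comp fi mk].
Qed.

Lemma cmeasurable2M (h k : R * R -> R[i]) : cmeasurable2 h -> cmeasurable2 k ->
  cmeasurable2 (fun z => h z * k z).
Proof.
move=> [fr fi] [gr gi]; split.
  by under eq_fun do rewrite ReM; apply: measurable_funB; exact: measurable_funM.
by under eq_fun do rewrite ImM; apply: measurable_funD; exact: measurable_funM.
Qed.

Lemma cmeasurable2_cint (h : R * R -> R[i]) : cmeasurable2 h ->
  cmeasurable (fun x => cint (fun y => h (x, y))).
Proof. by move=> [hr hi]; split; [exact: (measurable_Rintegral hr)|exact: (measurable_Rintegral hi)]. Qed.

Lemma measurable_normc_2 (h : R * R -> R[i]) : cmeasurable2 h ->
  measurable_fun setT (fun z => normc (h z)).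
Proof.
move=> [mr mi].
have ms : measurable_fun setT (@Num.sqrt R).
  by apply: continuous_measurable_fun; exact: sqrt_continuous.
rewrite [X in measurable_fun _ X](_ : _ =
   Num.sqrt \o (fun x => complex.Re (h x) ^+ 2 + complex.Im (h x) ^+ 2)).
  apply: measurableT_comp ms _.
  by apply: measurable_funD; apply: measurable_funX.
by apply/funext => x /=; case: (h x).
Qed.

Lemma cfubini (h : R * R -> R[i]) : cmeasurable2 h ->
  (forall x, cLp 1%:E (fun y => h (x, y))) ->
  (forall y, cLp 1%:E (fun x => h (x, y))) ->
  (\int[mu]_x \int[mu]_y (normc (h (x, y)))%:E < +oo)%E ->
  cint (fun x => cint (fun y => h (x, y))) = cint (fun y => cint (fun x => h (x, y))).
Proof.
move=> mh h1 h2 hoo.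
have mn := measurable_normc_2 mh.
have H (k : R * R -> R) : measurable_fun setT k -> (forall z, `|k z| <= normc (h z)) ->
    (\int[mu]_x \int[mu]_y `|(k (x, y))%:E| < +oo)%E.
  move=> mk kh; apply: le_lt_trans hoo; apply: ge0_le_integral => //.
  - by move=> x _; apply: integral_ge0.
  - apply: (measurable_fun_fubini_tonelli_F (m2 := mu) (fun z => `|(k z)%:E|%E)) => //.
    exact: measurable_abseE.
  - apply: (measurable_fun_fubini_tonelli_F (m2 := mu) (fun z => (normc (h z))%:E)) => //.
      exact/measurable_EFinP.
    by move=> z; rewrite lee_fin normc_ge0.
  move=> x _; apply: ge0_le_integral => //.
  - apply: measurable_abseE.
    exact: (measurableT_comp mk (measurable_fun_pair (measurable_cst x) (@measurable_id _ _ _))).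
  - apply/measurable_EFinP.
    exact: (measurableT_comp mn (measurable_fun_pair (measurable_cst x) (@measurable_id _ _ _))).
  - by move=> y _; rewrite lee_fin.
case: (mh) => mr mi.
apply: complex_ext => /=.
  apply: (Rfubini mr) => [x|y|].
  - exact: cL1_Re (h1 x).
  - exact: cL1_Re (h2 y).
  - by apply: (H _ mr) => z; exact: Re_le_normc.
apply: (Rfubini mi) => [x|y|].
- exact: cL1_Im (h1 x).
- exact: cL1_Im (h2 y).
- by apply: (H _ mi) => z; exact: Im_le_normc.
Qed.

Lemma cL1_cint (h : R * R -> R[i]) : cmeasurable2 h ->
  (forall x, cLp 1%:E (fun y => h (x, y))) ->
  (\int[mu]_x \int[mu]_y (normc (h (x, y)))%:E < +oo)%E ->
  cLp 1%:E (fun x => cint (fun y => h (x, y))).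
Proof.
move=> mh h1 hoo; have mc := cmeasurable2_cint mh.
apply/cL1P; split=> //; apply/integrableP; split.
  by apply/measurable_EFinP; exact: cmeasurable_normc.
apply: le_lt_trans hoo; apply: ge0_le_integral => //.
- by apply: measurable_abseE; exact: cmeasurable_normc.
- apply: (measurable_fun_fubini_tonelli_F (m2 := mu) (fun z => (normc (h z))%:E)) => //.
    by apply/measurable_EFinP; exact: measurable_normc_2.
  by move=> z; rewrite lee_fin normc_ge0.
- move=> x _; rewrite /= ger0_norm ?normc_ge0//.
  have := normc_cint (h1 x); rewrite -lee_fin /Rintegral fineK//.
  by apply: integrable_fin_num => //; exact: cL1_normc.
Qed.

Lemma cmeasurable2_conv f g : cmeasurable f -> cmeasurable g ->
  cmeasurable2 (fun z : R * R => f z.2 * g (z.1 - z.2)).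
Proof.
move=> mf mg; apply: (cmeasurable2M (h := fun z => f z.2) (k := fun z => g (z.1 - z.2))).
  by apply: cmeasurable2_comp mf _.
by apply: cmeasurable2_comp mg _; exact: measurable_funB.
Qed.

Lemma cmeasurable_conv f g : cmeasurable f -> cmeasurable g ->
  cmeasurable (convolution f g).
Proof. by move=> mf mg; exact: (cmeasurable2_cint (cmeasurable2_conv mf mg)). Qed.

Lemma conv_section f g x : cLp 2%:E f -> cLp 2%:E g ->
  cLp 1%:E (fun y => f y * g (x - y)).
Proof. by move=> f2 g2; exact: (cL2M f2 (cL2_reflect x g2)). Qed.

Lemma conv_bounded f g x : cLp 2%:E f -> cLp 2%:E g ->
  normc (convolution f g x) <= l2norm f * l2norm g.
Proof.
move=> f2 g2; rewrite -(l2norm_reflect x g2.1).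
exact: (cauchy_schwarz f2 (cL2_reflect x g2)).
Qed.

Lemma convB f1 f2 g x : cLp 2%:E f1 -> cLp 2%:E f2 -> cLp 2%:E g ->
  convolution (f1 \- f2) g x = convolution f1 g x - convolution f2 g x.
Proof.
move=> h1 h2 hg; rewrite -cintB; [|exact: conv_section..].
by apply: eq_cint => y /=; rewrite mulrBl.
Qed.

(** Tonelli: integrating first in [x], where translation invariance removes
[y], the double integral factors as the product of the two [L^1] norms. *)
Lemma conv_absolutely_integrable u v : cLp 1%:E u -> cLp 1%:E v ->
  (\int[mu]_x \int[mu]_y (normc (u y * v (x - y)))%:E < +oo)%E.
Proof.
move=> u1 v1; have [[mu' iu] [mv iv]] := ((cL1P u).1 u1, (cL1P v).1 v1).
have mh := measurable_normc_2 (cmeasurable2_conv mu' mv).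
rewrite (@fubini_tonelli _ _ _ _ _ mu mu (fun z => (normc (u z.2 * v (z.1 - z.2)))%:E)); last 2 first.
- exact/measurable_EFinP.
- by move=> z; rewrite lee_fin normc_ge0.
have E y : (\int[mu]_x (normc (u y * v (x - y)))%:E =
    (normc (u y))%:E * \int[mu]_x (normc (v x))%:E)%E.
  rewrite -(integral_translate (- y) (f := fun x => (normc (v x))%:E)); last first.
    by apply/measurable_EFinP; exact: cmeasurable_normc.
  rewrite -ge0_integralZl//; last 3 first.
  - apply/measurable_EFinP.
    apply: (measurableT_comp (cmeasurable_normc mv)); exact: measurable_funD.
  - by move=> x _; rewrite lee_fin normc_ge0.
  - by rewrite lee_fin normc_ge0.
  by apply: eq_integral => x _; rewrite normcM.
rewrite /=; under eq_integral do rewrite E.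
rewrite ge0_integralZr//; last 3 first.
- by apply/measurable_EFinP; exact: cmeasurable_normc.
- by move=> x _; rewrite lee_fin normc_ge0.
- by apply: integral_ge0 => x _; rewrite lee_fin normc_ge0.
have iu' := integrable_fin_num measurableT iu.
have iv' := integrable_fin_num measurableT iv.
rewrite -(fineK iu') -(fineK iv') -EFinM; exact: ltry.
Qed.

Lemma cL1_conv u v : cLp 1%:E u -> cLp 2%:E u -> cLp 1%:E v -> cLp 2%:E v ->
  cLp 1%:E (convolution u v).
Proof.
move=> u1 u2 v1 v2; apply: (cL1_cint (h := fun z => u z.2 * v (z.1 - z.2))).
- by apply: cmeasurable2_conv; [case: u1|case: v1].
- by move=> x; exact: conv_section.
- exact: (conv_absolutely_integrable u1 v1).
Qed.

Lemma cL2_bounded f (M : R) : cLp 1%:E f -> (forall x, normc (f x) <= M) -> cLp 2%:E f.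
Proof.
move=> f1 fM; apply/cL2P; split; first by case: f1.
have i := integrable_scale M (cL1_normc f1).
apply: le_lt_trans (integrable_lty measurableT i).
apply: ge0_le_integral => //.
- by move=> x _; rewrite lee_fin sqr_ge0.
- by apply: measurable_normc2; case: f1.
- by case/integrableP: i.
- by move=> x _; rewrite lee_fin expr2 ler_wpM2r// normc_ge0.
Qed.

Lemma cL2_conv u v : cLp 1%:E u -> cLp 2%:E u -> cLp 1%:E v -> cLp 2%:E v ->
  cLp 2%:E (convolution u v).
Proof.
move=> u1 u2 v1 v2; apply: (cL2_bounded (M := l2norm u * l2norm v)).
  exact: cL1_conv.
by move=> x; exact: conv_bounded.
Qed.

Lemma cL1_shift f (d : R) : cLp 1%:E f -> cLp 1%:E (fun x => f (x - d)).
Proof.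
move=> f1; have := cL1_affine (- d) (_ : 1 != 0) f1.
rewrite oner_eq0 => /(_ isT); congr (cLp _ _).
by apply/funext => x; rewrite mul1r.
Qed.

Lemma fourier_section f w : cLp 1%:E f -> cLp 1%:E (fun x => f x * expi (- (w * x))).
Proof.
move=> f1; apply: (cL1M (M := 1)) => //.
  by apply: cmeasurable_expi; apply: measurableT_comp => //; apply: measurable_funM.
by move=> x; rewrite normc_expi.
Qed.

Lemma cmeasurable_fourier f : cmeasurable f -> cmeasurable (fourier f).
Proof.
move=> mf; apply: (cmeasurable2_cint (h := fun z => f z.2 * expi (- (z.1 * z.2)))).
apply: (cmeasurable2M (h := fun z => f z.2) (k := fun z => expi (- (z.1 * z.2)))).
  by apply: cmeasurable2_comp mf _.
apply: (cmeasurable2_comp (f := expi) (k := fun z => (- (z.1 * z.2)))).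
  exact: (cmeasurable_expi (h := id)).
by apply: measurableT_comp => //; exact: measurable_funM.
Qed.

Lemma fourier_bound f w : cLp 1%:E f ->
  normc (fourier f w) <= \int[mu]_x normc (f x).
Proof.
move=> f1; apply: le_trans (normc_cint (fourier_section w f1)) _.
rewrite le_eqVlt; apply/orP; left; apply/eqP; apply: eq_Rintegral => x _.
by rewrite normcM normc_expi mulr1.
Qed.

Lemma fourierB f g w : cLp 1%:E f -> cLp 1%:E g ->
  fourier (f \- g) w = fourier f w - fourier g w.
Proof.
move=> f1 g1; rewrite -cintB; [|exact: fourier_section..].
by apply: eq_cint => x /=; rewrite mulrBl.
Qed.

Lemma fourier_translate f (d w : R) : cLp 1%:E f ->
  fourier (fun x => f (x - d)) w = expi (- (w * d)) * fourier f w.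
Proof.
move=> f1; rewrite /fourier -cintZ; last exact: fourier_section.
rewrite -[RHS](cint_translate (- d)); last first.
  apply: cmeasurableZ; by case: (fourier_section w f1).
apply: eq_cint => x; rewrite mulrCA; congr (_ * _).
by rewrite -expiD; congr expi; ring.
Qed.

(** The substitution [x - y] turns the inner integral of the exchanged double
integral into the transform of a translate, hence into
[expi (- (w y))] times the transform of [v]. *)
Lemma fourier_conv u v w : cLp 1%:E u -> cLp 2%:E u -> cLp 1%:E v -> cLp 2%:E v ->
  fourier (convolution u v) w = fourier u w * fourier v w.
Proof.
move=> u1 u2 v1 v2.
pose h (z : R * R) := u z.2 * v (z.1 - z.2) * expi (- (w * z.1)).
have mh : cmeasurable2 h.
  apply: (cmeasurable2M (k := fun z => expi (- (w * z.1)))).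
    by apply: cmeasurable2_conv; [case: u1|case: v1].
  apply: (cmeasurable2_comp (f := expi) (k := fun z => (- (w * z.1)))).
    exact: (cmeasurable_expi (h := id)).
  by apply: measurableT_comp => //; exact: measurable_funM.
transitivity (cint (fun x => cint (fun y => h (x, y)))).
  apply: eq_cint => x; rewrite mulrC -cintZ; last exact: conv_section.
  by apply: eq_cint => y; rewrite mulrC.
rewrite cfubini//; last 3 first.
- move=> x; have := cL1Z (expi (- (w * x))) (conv_section x u2 v2).
  by congr (cLp _ _); apply/funext => y; rewrite mulrC.
- move=> y; apply: (cL1M (M := 1)).
  + exact: (cL1Z (u y) (cL1_shift y v1)).
  + by rewrite /=; apply: cmeasurable_expi; apply: measurableT_comp => //; apply: measurable_funM.
  + by move=> x; rewrite normc_expi.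
- rewrite (_ : (\int[mu]_x _)%E =
      (\int[mu]_x \int[mu]_y (normc (u y * v (x - y)))%:E)%E).
    exact: (conv_absolutely_integrable u1 v1).
  apply: eq_integral => x _; apply: eq_integral => y _.
  by rewrite /h /= [in LHS]normcM normc_expi mulr1.
rewrite mulrC -cintZ; last exact: fourier_section.
apply: eq_cint => y; rewrite /h /=.
transitivity (u y * fourier (fun x => v (x - y)) w).
  rewrite -cintZ; first by apply: eq_cint => x; rewrite mulrA.
  exact/fourier_section/cL1_shift.
by rewrite fourier_translate//; ring.
Qed.

End Convolution.

(** * The Poisson kernel *)

Section Poisson.
Context {R : realType}.
Local Notation mu := (@lebesgue_measure R).

(** The Fourier transform of [w |-> exp (- e |w|)] at [t]. *)
Definition poisson (e t : R) : R := 2 * (e / (e ^+ 2 + t ^+ 2)).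

Lemma denom_gt0 (e t : R) : 0 < e -> 0 < e ^+ 2 + t ^+ 2.
Proof. by move=> e0; rewrite ltr_pwDl ?exprn_gt0// sqr_ge0. Qed.

Lemma poisson_ge0 (e t : R) : 0 < e -> 0 <= poisson e t.
Proof. by move=> e0; rewrite mulr_ge0// divr_ge0 ?ltW// denom_gt0. Qed.

Lemma poisson_le (e t : R) : 0 < e -> poisson e t <= 2 / e.
Proof.
move=> e0; rewrite ler_wpM2l// ler_pdivrMr ?denom_gt0//.
by rewrite mulrDr expr2 mulrA mulVf ?gt_eqF// mul1r lerDl mulr_ge0 ?sqr_ge0// invr_ge0 ltW.
Qed.

Lemma continuous_poisson (e : R) : 0 < e -> continuous (poisson e).
Proof.
move=> e0 t; apply: cvgM; first exact: cvg_cst.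
apply: cvgM; first exact: cvg_cst.
apply: cvgV; first by rewrite gt_eqF// denom_gt0.
apply: cvgD; first exact: cvg_cst.
exact: exprn_continuous.
Qed.

Lemma measurable_poisson (e : R) : 0 < e -> measurable_fun setT (poisson e).
Proof. by move=> e0; apply: continuous_measurable_fun; exact: continuous_poisson. Qed.

Lemma expR_mul_cvg0 (e : R) : 0 < e -> expR (- e * x) @[x --> +oo] --> (0 : R).
Proof.
move=> e0; rewrite (_ : (fun x => expR (- e * x)) =
               (fun z => expR (- z)) \o (fun z => e * z)); last first.
  by apply/funext => x; rewrite /= mulNr.
apply: (@cvg_comp _ _ _ _ _ _ (pinfty_nbhs R)); last exact: cvgr_expR.
exact: gt0_cvgMry.
Qed.

Lemma is_derive_mulr (k w : R) : is_derive w 1 (fun x : R => k * x) k.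
Proof.
have := is_deriveZ (f := id) k (is_derive_id w 1).
by rewrite /GRing.scale /= mulr1.
Qed.

(** The term [- e^-1] comes from the summand [1] of [1 + cos (t w)], the other
one from [cos (t w)]. *)
Let primitive (e t : R) (w : R) :=
  expR (- e * w) * ((t * sin (t * w) - e * cos (t * w)) / (e ^+ 2 + t ^+ 2) - e^-1).

Lemma is_derive_primitive (e t w : R) : 0 < e ->
  is_derive w 1 (primitive e t) (expR (- e * w) * (1 + cos (t * w))).
Proof.
move=> e0.
have de := is_derive1_comp (is_derive_expR (- e * w)) (is_derive_mulr (- e) w).
have ds := is_derive1_comp (is_derive_sin (t * w)) (is_derive_mulr t w).
have dc := is_derive1_comp (is_derive_cos (t * w)) (is_derive_mulr t w).
have d1 := is_deriveB (is_deriveZ t ds) (is_deriveZ e dc).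
have d2 := is_deriveZ (e ^+ 2 + t ^+ 2)^-1 d1.
have d3 := is_deriveB d2 (is_derive_cst (e^-1) w 1).
have d4 := is_deriveM de d3.
rewrite (_ : primitive e t = (expR \o *%R (- e)) *
  ((e ^+ 2 + t ^+ 2)^-1 *: (t *: (sin \o *%R t) - e *: (cos \o *%R t)) - cst e^-1)).
  apply: (is_derive_eq d4).
  rewrite /GRing.scale /= /cst.
  have D0 : e ^+ 2 + t ^+ 2 != 0 by rewrite gt_eqF// denom_gt0.
  rewrite [X in _ + X * _](_ : _ =
    (e ^+ 2 + t ^+ 2)^-1 * (t * sin (t * w) - e * cos (t * w)) - e^-1)//.
  by field; rewrite D0 gt_eqF.
apply/funext => x; rewrite /primitive !fctE /GRing.scale/=.
by congr (_ * (_ - _)); rewrite mulrC.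
Qed.

Lemma cvg_primitive (e t : R) : 0 < e -> primitive e t x @[x --> +oo] --> (0 : R).
Proof.
move=> e0; pose C := (`|t| + e) / (e ^+ 2 + t ^+ 2) + e^-1.
have c0 : expR (- e * x) * C @[x --> +oo] --> (0 : R).
  by rewrite -[X in _ --> X](mul0r C); apply: cvgMl; exact: expR_mul_cvg0.
apply: (@squeeze_cvgr _ _ _ _ (fun x => - (expR (- e * x) * C)) (fun x => expR (- e * x) * C)) => //.
  apply: nearW => x; rewrite -ler_norml normrM [ `|expR _|]ger0_norm ?expR_ge0//.
  rewrite ler_wpM2l ?expR_ge0//.
  have e1 : 0 <= e^-1 by rewrite invr_ge0 ltW.
  have D1 : 0 <= (e ^+ 2 + t ^+ 2)^-1 by rewrite invr_ge0 ltW// denom_gt0.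
  apply: (le_trans (ler_normB _ _)); rewrite [ `|e^-1|]ger0_norm//.
  rewrite lerD2r normrM [ `|_^-1|]ger0_norm// ler_wpM2r//.
  apply: (le_trans (ler_normB _ _)); rewrite !normrM (ger0_norm (ltW e0)).
  apply: lerD.
    by rewrite ler_piMr// ler_norml sin_geN1 sin_le1.
  by rewrite ler_piMr ?(ltW e0)// ler_norml cos_geN1 cos_le1.
by rewrite -oppr0; apply: cvgN.
Qed.

Lemma continuous_exp_cos (e t : R) : continuous (fun w : R => expR (- e * `|w|) * (1 + cos (t * w))).
Proof.
move=> w; apply: cvgM.
  apply: (@continuous_comp _ _ _ (fun w => - e * `|w|) expR); last exact: continuous_expR.
  by apply: cvgM; [exact: cvg_cst|exact: norm_continuous].
apply: cvgD; first exact: cvg_cst.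
apply: (@continuous_comp _ _ _ (fun w => t * w) cos); last exact: continuous_cos.
by apply: cvgM; [exact: cvg_cst|exact: cvg_id].
Qed.

(** The summand [1] makes the integrand nonnegative, as the fundamental
theorem of calculus on a half-line requires; its contribution is subtracted in
[Rintegral_exp_cos]. *)
Lemma integral_exp_cos1_half (e t : R) : 0 < e ->
  (\int[mu]_(w in `[0%R, +oo[) (expR (- e * `|w|) * (1 + cos (t * w)))%:E =
   (e^-1 + e / (e ^+ 2 + t ^+ 2))%:E)%E.
Proof.
move=> e0.
have dP w := is_derive_primitive t w e0.
rewrite (@ge0_continuous_FTC2y _ _ (primitive e t) _ 0).
- rewrite /primitive !mulr0 expR0 sin0 cos0 -EFinB; congr EFin.
  by rewrite mulr0 mulr1 mul1r !sub0r mulNr opprB opprK.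
- by move=> x _; rewrite mulr_ge0 ?expR_ge0// -lerBlDl sub0r cos_geN1.
- exact/continuous_subspaceT/continuous_exp_cos.
- exact: cvg_primitive.
- by move=> x _; case: (dP x).
- apply: cvg_at_right_filter; apply: differentiable_continuous.
  by apply/derivable1_diffP; case: (dP 0).
- move=> x; rewrite in_itv/= andbT => x0; rewrite derive1E (@derive_val _ _ _ _ _ _ _ (dP x)).
  by rewrite gtr0_norm.
Qed.

Lemma integral_exp_cos1 (e t : R) : 0 < e ->
  (\int[mu]_w (expR (- e * `|w|) * (1 + cos (t * w)))%:E =
   (2 / e + poisson e t)%:E)%E.
Proof.
move=> e0; rewrite ge0_symfun_integralT//.
- rewrite -[X in integral _ X _]set_itvE integral_exp_cos1_half// -EFinM; congr EFin.
  by rewrite mulrDr.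
- exact: continuous_exp_cos.
- by move=> x /=; rewrite normrN mulrN cosN.
Qed.

Lemma integrable_exp_cos1 (e t : R) : 0 < e ->
  mu.-integrable setT (EFin \o (fun w => expR (- e * `|w|) * (1 + cos (t * w)))).
Proof.
move=> e0; apply/integrableP; split.
  by apply/measurable_EFinP; apply: continuous_measurable_fun; exact: continuous_exp_cos.
under eq_integral.
  move=> x _; rewrite /= ger0_norm; last first.
    by rewrite mulr_ge0 ?expR_ge0// -lerBlDl sub0r cos_geN1.
  over.
by rewrite integral_exp_cos1// ltry.
Qed.

Lemma integrable_exp_abs (e : R) : 0 < e ->
  mu.-integrable setT (EFin \o (fun w => expR (- e * `|w|))).
Proof.
move=> e0; have := integrable_scale 2^-1 (integrable_exp_cos1 0 e0).
congr (_.-integrable _ _); apply/funext => w /=; congr EFin.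
by rewrite mul0r cos0; field.
Qed.

Lemma Rintegral_exp_abs (e : R) : 0 < e -> \int[mu]_w expR (- e * `|w|) = 2 / e.
Proof.
move=> e0; have := integral_exp_cos1 0 e0 => /(congr1 fine) /=.
rewrite /poisson expr0n/= addr0 => h.
have : \int[mu]_w (2 * expR (- e * `|w|)) = 2 / e + 2 * (e / e ^+ 2).
  rewrite -h; apply: eq_Rintegral => w _.
  by rewrite mul0r cos0; ring.
rewrite RintegralZl//; last exact: integrable_exp_abs.
have e_n0 : e != 0 by rewrite gt_eqF.
move=> h'; apply: (@mulfI _ 2) => //; rewrite h'.
by field.
Qed.

Lemma Rintegral_exp_cos (e t : R) : 0 < e ->
  \int[mu]_w (expR (- e * `|w|) * cos (t * w)) = poisson e t.
Proof.
move=> e0; transitivity (\int[mu]_w (expR (- e * `|w|) * (1 + cos (t * w)) - expR (- e * `|w|))).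
  by apply: eq_Rintegral => w _; rewrite mulrDr mulr1 [X in X - _]addrC addrK.
rewrite RintegralB//; [|exact: integrable_exp_cos1|exact: integrable_exp_abs].
rewrite Rintegral_exp_abs// /Rintegral integral_exp_cos1//=.
by rewrite [X in X - _]addrC addrK.
Qed.

(** [2 atan] is a primitive of the kernel for [e = 1], and increases by [2 pi]
over the line. *)
Lemma integral_poisson1 : (\int[mu]_s (poisson 1 s)%:E = (2 * pi)%:E)%E.
Proof.
rewrite ge0_symfun_integralT//; last 3 first.
- by move=> x; exact: poisson_ge0.
- exact: continuous_poisson.
- by move=> x; rewrite /poisson /= sqrrN.
rewrite -[X in integral _ X _]set_itvE (@ge0_continuous_FTC2y _ _ (2 *: atan) _ pi).
- by rewrite fctE atan0 scaler0 oppe0 adde0 -EFinM.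
- by move=> x _; exact: poisson_ge0.
- exact/continuous_subspaceT/continuous_poisson.
- rewrite (_ : pi = 2 *: (pi / 2) :> R); last by rewrite /GRing.scale/=; field.
  by apply: cvgZr; exact: cvgy_atan.
- by move=> x _; apply: derivableZ; exact: derivable_atan.
- apply: cvg_at_right_filter; apply: cvgZr; exact: continuous_atan.
- move=> x _; rewrite derive1E.
  have dx := is_deriveZ 2 (is_derive1_atan x).
  by rewrite (@derive_val _ _ _ _ _ _ _ dx) /poisson expr1n mul1r.
Qed.

Lemma integrable_poisson1 : mu.-integrable setT (EFin \o poisson 1).
Proof.
apply/integrableP; split; first by apply/measurable_EFinP; exact: measurable_poisson.
under eq_integral do rewrite /= ger0_norm ?poisson_ge0//.
by rewrite integral_poisson1 ltry.
Qed.

Lemma poisson_scale (e s : R) : 0 < e -> poisson e (e * s) * e = poisson 1 s.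
Proof.
move=> e0; rewrite /poisson.
have e1 : e != 0 by rewrite gt_eqF.
have e2 : 1 + s ^+ 2 != 0 by rewrite gt_eqF// ltr_pwDl// sqr_ge0.
have e3 : e ^+ 2 + (e * s) ^+ 2 != 0 by rewrite gt_eqF// denom_gt0.
by field; rewrite e2 e3.
Qed.

Lemma integral_poisson (e : R) : 0 < e -> (\int[mu]_s (poisson e s)%:E = (2 * pi)%:E)%E.
Proof.
move=> e0; have e1 : e != 0 by rewrite gt_eqF.
have := ge0_integral_affine 0 e1 (f := fun x => (poisson e x)%:E).
have mp := measurable_poisson e0.
move=> /(_ _ _)/wrap[]; first exact/measurable_EFinP.
  by move=> x; rewrite lee_fin poisson_ge0.
rewrite -integral_poisson1 => h.
transitivity (e%:E * \int[mu]_x (poisson e (e * x + 0))%:E)%E.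
  by rewrite h muleA -EFinM gtr0_norm// mulfV// mul1e.
rewrite -ge0_integralZl//; last 3 first.
- apply/measurable_EFinP; apply: (measurableT_comp mp); exact: measurable_affine.
- by move=> x _; rewrite lee_fin poisson_ge0.
- by rewrite lee_fin ltW.
by apply: eq_integral => x _; rewrite -EFinM addr0 -(poisson_scale x e0) mulrC.
Qed.

End Poisson.

(** * The power spectrum damped by an exponential *)

Section RealPlancherel.
Context {R : realType}.
Local Notation mu := (@lebesgue_measure R).

Lemma measurable_cos : measurable_fun setT (@cos R).
Proof. by apply: continuous_measurable_fun; exact: continuous_cos. Qed.

Lemma measurable_sin : measurable_fun setT (@sin R).
Proof. by apply: continuous_measurable_fun; exact: continuous_sin. Qed.

Lemma cvg_norm_le (a_ : nat -> R) (a b : R) :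
  a_ n @[n --> \oo] --> a -> (forall n, `|a_ n| <= b) -> `|a| <= b.
Proof.
move=> ca ab; have h : `|a_ n| @[n --> \oo] --> `|a| by apply: cvg_norm.
rewrite -(cvg_lim (@Rhausdorff R) h); apply: limr_le.
  by apply/cvg_ex; exists `|a|.
exact: nearW.
Qed.

Lemma cvg_continuous_comp (k : R -> R) (a_ : nat -> R) (l : R) : continuous k ->
  a_ n @[n --> \oo] --> l -> k (a_ n) @[n --> \oo] --> k l.
Proof. by move=> ck ca; apply: (cvg_comp a_ k ca); exact: ck. Qed.

(** Pointwise convergence everywhere and a domination valid everywhere spare
the exceptional sets and give a statement about real integrals. *)
Lemma Rintegral_dct (f_ : nat -> R -> R) (f g : R -> R) :
  (forall n, measurable_fun setT (f_ n)) ->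
  (forall x, f_ n x @[n --> \oo] --> f x) ->
  mu.-integrable setT (EFin \o g) -> (forall n x, `|f_ n x| <= g x) ->
  \int[mu]_x f_ n x @[n --> \oo] --> \int[mu]_x f x.
Proof.
move=> mf ff ig fg.
have mEf n : measurable_fun setT (EFin \o f_ n) by exact/measurable_EFinP.
have := @dominated_cvg _ _ _ mu setT measurableT (fun n => EFin \o f_ n) (EFin \o f) (EFin \o g).
move=> /(_ _ _ _ ig)/wrap[].
- by move=> n; exact: mEf.
- by move=> x _; apply: cvg_EFin; [exact: nearW|exact: ff].
- by [].
move=> /(_ _)/wrap[]; first by move=> n x _; rewrite lee_fin.
move=> h.
have mf' : measurable_fun setT f.
  by apply: (measurable_fun_cvg mf) => x _; exact: ff.
have fgf x : `|f x| <= g x.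
  by apply: cvg_norm_le (ff x) _ => n; exact: fg.
have fi : mu.-integrable setT (EFin \o f) by exact: integrable_le ig.
apply: fine_cvg; rewrite fineK ?integrable_fin_num//.
Qed.

(** Cosine and sine transforms of a real function: up to sign, the real and
imaginary parts of its Fourier transform. *)
Definition cosp (u : R -> R) (w : R) : R := \int[mu]_x (u x * cos (w * x)).
Definition sinp (u : R -> R) (w : R) : R := \int[mu]_x (u x * sin (w * x)).

(** The power spectrum [|u^|^2] of a real function. *)
Definition power (u : R -> R) (w : R) : R := cosp u w ^+ 2 + sinp u w ^+ 2.

Lemma power_ge0 u w : 0 <= power u w.
Proof. by rewrite addr_ge0// sqr_ge0. Qed.

Section Fixed.
Variables (u : R -> R).
Hypothesis iu : mu.-integrable setT (EFin \o u).

Let mu_ : measurable_fun setT u.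
Proof. by apply/measurable_EFinP; case/integrableP: iu. Qed.

Let N := \int[mu]_x `|u x|.

Let measurable_cos_comp (k : R -> R) : measurable_fun setT k -> measurable_fun setT (fun x => cos (k x)).
Proof.
move=> mk; apply: (measurableT_comp (f := cos)) => //.
exact: measurable_cos.
Qed.

Let measurable_sin_comp (k : R -> R) : measurable_fun setT k -> measurable_fun setT (fun x => sin (k x)).
Proof.
move=> mk; apply: (measurableT_comp (f := sin)) => //.
exact: measurable_sin.
Qed.

Lemma integrable_bounded_mul (k : R -> R) : measurable_fun setT k ->
  (forall x, `|k x| <= 1) -> mu.-integrable setT (EFin \o (fun x => u x * k x)).
Proof.
move=> mk k1; apply: (@integrable_le _ _ (fun x => `|u x|)); last exact: integrable_normr.
  exact: measurable_funM.
by move=> x; rewrite normrM ler_piMr.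
Qed.

Let cos1 (x : R) : `|cos x| <= 1. Proof. by rewrite ler_norml cos_geN1 cos_le1. Qed.
Let sin1 (x : R) : `|sin x| <= 1. Proof. by rewrite ler_norml sin_geN1 sin_le1. Qed.

Let icos w : mu.-integrable setT (EFin \o (fun x => u x * cos (w * x))).
Proof. by apply: integrable_bounded_mul => //; apply: measurable_cos_comp; exact: measurable_funM. Qed.

Let isin w : mu.-integrable setT (EFin \o (fun x => u x * sin (w * x))).
Proof. by apply: integrable_bounded_mul => //; apply: measurable_sin_comp; exact: measurable_funM. Qed.

Let cosp_le w : `|cosp u w| <= N.
Proof.
apply: (le_trans (le_normr_Rintegral measurableT (icos w))).
apply: le_Rintegral => //; [exact: integrable_normr (icos w)|exact: integrable_normr|].
by move=> x _; rewrite normrM ler_piMr.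
Qed.

Let sinp_le w : `|sinp u w| <= N.
Proof.
apply: (le_trans (le_normr_Rintegral measurableT (isin w))).
apply: le_Rintegral => //; [exact: integrable_normr (isin w)|exact: integrable_normr|].
by move=> x _; rewrite normrM ler_piMr.
Qed.

Let measurable_cosp : measurable_fun setT (cosp u).
Proof.
apply: (measurable_Rintegral (h := fun z => u z.2 * cos (z.1 * z.2))).
apply: measurable_funM; first exact: (measurableT_comp mu_ measurable_snd).
apply: (measurableT_comp (f := cos)); last exact: measurable_funM.
exact: measurable_cos.
Qed.

Let measurable_sinp : measurable_fun setT (sinp u).
Proof.
apply: (measurable_Rintegral (h := fun z => u z.2 * sin (z.1 * z.2))).
apply: measurable_funM; first exact: (measurableT_comp mu_ measurable_snd).
apply: (measurableT_comp (f := sin)); last exact: measurable_funM.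
exact: measurable_sin.
Qed.

Lemma measurable_power : measurable_fun setT (power u).
Proof. by apply: measurable_funD; apply: measurable_funX. Qed.

(** For real [u], the product of its transform with [expi (w x)] has this
real part; it expresses the power spectrum as one integral against [u]
([powerD]) while being itself an integral of cosines of [x - y] ([DE]). *)
Let D w x := cosp u w * cos (w * x) + sinp u w * sin (w * x).

Let D_le w x : `|D w x| <= N + N.
Proof.
apply: (le_trans (ler_normD _ _)); apply: lerD; rewrite normrM.
  by apply: le_trans (cosp_le w); rewrite ler_piMr.
by apply: le_trans (sinp_le w); rewrite ler_piMr.
Qed.

Let powerD w : power u w = \int[mu]_x (u x * D w x).
Proof.
transitivity (\int[mu]_x (cosp u w * (u x * cos (w * x)) + sinp u w * (u x * sin (w * x)))).
  rewrite RintegralD//; [|exact/integrable_scale/icos|exact/integrable_scale/isin].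
  by rewrite !RintegralZl// -/(cosp u w) -/(sinp u w) /power !expr2.
by apply: eq_Rintegral => x _; rewrite /D; ring.
Qed.

Let DE w x : D w x = \int[mu]_y (u y * cos ((x - y) * w)).
Proof.
transitivity (\int[mu]_y (cos (w * x) * (u y * cos (w * y)) + sin (w * x) * (u y * sin (w * y)))).
  rewrite RintegralD//; [|exact/integrable_scale/icos|exact/integrable_scale/isin].
  by rewrite !RintegralZl// -/(cosp u w) -/(sinp u w) /D; ring.
apply: eq_Rintegral => y _; rewrite mulrBl cosB (mulrC x) (mulrC y); ring.
Qed.

Let M0 : 0 <= N + N.
Proof. by apply: le_trans (D_le 0 0); exact: normr_ge0. Qed.

(** The factor [exp (- e |w|)] makes the triple integral of
[exp (- e |w|) u x u y cos ((x - y) w)] absolutely convergent, so the integral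
over [w] can be done first and produces the Poisson kernel at [x - y]. *)
Lemma damped_power_poisson (e : R) : 0 < e ->
  \int[mu]_w (expR (- e * `|w|) * power u w) =
  \int[mu]_x (u x * \int[mu]_y (u y * poisson e (x - y))).
Proof.
move=> e0; have iE := integrable_exp_abs e0.
have mE : measurable_fun setT (fun w : R => expR (- e * `|w|)).
  by apply/measurable_EFinP; case/integrableP: iE.
pose h (z : R * R) := expR (- e * `|z.1|) * (u z.2 * D z.1 z.2).
have mh : measurable_fun setT h.
  apply: measurable_funM; first exact: (measurableT_comp mE measurable_fst).
  apply: measurable_funM; first exact: (measurableT_comp mu_ measurable_snd).
  apply: measurable_funD; apply: measurable_funM.
  - exact: (measurableT_comp measurable_cosp measurable_fst).
  - apply: (measurableT_comp (f := cos)); last exact: measurable_funM.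
    exact: measurable_cos.
  - exact: (measurableT_comp measurable_sinp measurable_fst).
  - apply: (measurableT_comp (f := sin)); last exact: measurable_funM.
    exact: measurable_sin.
have iE' := integrable_scale (N + N) iE.
have [|i1 i2 i3] := integrable_prod_dom mh iE' iu.
  move=> w x; rewrite /h /= !normrM [leRHS]mulrAC mulrC ler_wpM2r//.
  rewrite [leLHS]mulrC ler_wpM2r//.
  by rewrite (ger0_norm M0); exact: D_le.
transitivity (\int[mu]_w \int[mu]_x h (w, x)).
  apply: eq_Rintegral => w _; rewrite powerD -RintegralZl//.
  apply: (@integrable_le _ _ (fun x => (N + N) * `|u x|)).
  - by apply: measurable_funM => //; apply: measurable_funD; apply: measurable_funM => //;
      [apply: measurable_cos_comp|apply: measurable_sin_comp]; exact: measurable_funM.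
  - by move=> x; rewrite normrM mulrC ler_wpM2r// D_le.
  - exact/integrable_scale/integrable_normr.
rewrite Rfubini//; apply: eq_Rintegral => x _; rewrite /h /=.
transitivity (u x * \int[mu]_w (expR (- e * `|w|) * D w x)).
  rewrite -RintegralZl//; first by apply: eq_Rintegral => w _; ring.
  apply: (@integrable_le _ _ (fun w => (N + N) * expR (- e * `|w|))) => //.
  - apply: measurable_funM => //; apply: measurable_funD; apply: measurable_funM => //.
      by apply: measurable_cos_comp; exact: measurable_funM.
    by apply: measurable_sin_comp; exact: measurable_funM.
  - by move=> w; rewrite normrM (ger0_norm (expR_ge0 _)) mulrC ler_wpM2r ?expR_ge0.
congr (_ * _).
pose k (z : R * R) := expR (- e * `|z.1|) * (u z.2 * cos ((x - z.2) * z.1)).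
have mk : measurable_fun setT k.
  apply: measurable_funM; first exact: (measurableT_comp mE measurable_fst).
  apply: measurable_funM; first exact: (measurableT_comp mu_ measurable_snd).
  apply: (measurableT_comp (f := cos)).
    exact: measurable_cos.
  by apply: measurable_funM => //; exact: measurable_funB.
have [|j1 j2 j3] := integrable_prod_dom mk iE iu.
  by move=> w y; rewrite /k /= !normrM ler_wpM2l// ler_piMr.
transitivity (\int[mu]_w \int[mu]_y k (w, y)).
  apply: eq_Rintegral => w _; rewrite DE -RintegralZl//.
  apply: integrable_bounded_mul => //; apply: measurable_cos_comp.
  by apply: measurable_funM => //; exact: measurable_funB.
rewrite Rfubini//; apply: eq_Rintegral => y _; rewrite /k /=.
rewrite -Rintegral_exp_cos// -RintegralZl//; first by apply: eq_Rintegral => w _; ring.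
apply: (@integrable_le _ _ (fun w => expR (- e * `|w|))) => //.
  by apply: measurable_funM => //; apply: measurable_cos_comp; exact: measurable_funM.
by move=> w; rewrite normrM (ger0_norm (expR_ge0 _)) ler_piMr ?expR_ge0.
Qed.

Lemma integrable_exp_power (e : R) : 0 < e ->
  mu.-integrable setT (EFin \o (fun w => expR (- e * `|w|) * power u w)).
Proof.
move=> e0; have iE := integrable_exp_abs e0.
apply: (@integrable_le _ _ (fun w => (N ^+ 2 + N ^+ 2) * expR (- e * `|w|))).
- apply: measurable_funM; last exact: measurable_power.
  by apply/measurable_EFinP; case/integrableP: iE.
- move=> w; rewrite normrM (ger0_norm (expR_ge0 _)) mulrC ler_wpM2r ?expR_ge0//.
  have N0 : 0 <= N by apply: le_trans (cosp_le w).
  have sqN (y : R) : `|y| <= N -> y ^+ 2 <= N ^+ 2.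
    by move=> yN; rewrite -(real_normK (num_real y)) lerXn2r ?nnegrE.
  rewrite ger0_norm ?power_ge0//; apply: lerD; apply: sqN; first exact: cosp_le.
  exact: sinp_le.
- exact: integrable_scale.
Qed.

(** The damping factors increase to [1]: monotone convergence. *)
Lemma damped_power_cvg :
  (\int[mu]_w (expR (- n.+1%:R^-1 * `|w|) * power u w))%:E @[n --> \oo] -->
  (\int[mu]_w (power u w)%:E)%E.
Proof.
have mE n : measurable_fun setT (fun w : R => expR (- n.+1%:R^-1 * `|w|)).
  apply/measurable_EFinP; have := @integrable_exp_abs R n.+1%:R^-1.
  by rewrite invr_gt0 ltr0n => /(_ isT)/integrableP[].
have mEP n : measurable_fun setT (fun w : R => expR (- n.+1%:R^-1 * `|w|) * power u w).
  by apply: measurable_funM (mE n) _; exact: measurable_power.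
have := @cvg_monotone_convergence _ _ _ mu setT measurableT
  (fun n w => (expR (- n.+1%:R^-1 * `|w|) * power u w)%:E).
move=> /(_ _ _ _)/wrap[].
- by move=> n; apply/measurable_EFinP; exact: mEP.
- by move=> n w _; rewrite lee_fin mulr_ge0 ?expR_ge0 ?power_ge0.
- move=> w _ m n mn; rewrite lee_fin ler_wpM2r ?power_ge0// ler_expR.
  by rewrite ler_wpM2r// lerN2 lef_pV2 ?posrE// ler_nat.
rewrite (_ : (\int[mu]_(x in _) _)%E = (\int[mu]_w (power u w)%:E)%E); last first.
  apply: eq_integral => w _; apply/cvg_lim => //.
  apply: cvg_EFin; first exact: nearW.
  rewrite -[X in _ --> X]mul1r; apply: cvgMl.
  have h : - n.+1%:R^-1 * `|w| @[n --> \oo] --> (0 : R).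
    rewrite -(mul0r `|w|); apply: cvgMl; rewrite -oppr0; apply: cvgN.
    exact: cvg_harmonic.
  by rewrite -[X in _ --> X](@expR0 R); apply: cvg_continuous_comp h; exact: continuous_expR.
apply: cvg_trans; apply: near_eq_cvg; apply: nearW => n.
rewrite /Rintegral fineK//; apply: integrable_fin_num => //.
by apply: integrable_exp_power; rewrite invr_gt0 ltr0n.
Qed.

End Fixed.
End RealPlancherel.

(** * Integral of the power spectrum *)

Section RealBounds.
Context {R : realType}.
Local Notation mu := (@lebesgue_measure R).

Lemma measurable_fubini_EFin (k : R * R -> R) : measurable_fun setT k ->
  (forall z, 0 <= k z) -> measurable_fun setT (fun x : R => (\int[mu]_y (k (x, y))%:E)%E).
Proof.
move=> mk k0; apply: (measurable_fun_fubini_tonelli_F (m2 := mu) (EFin \o k)).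
  exact/measurable_EFinP.
by move=> z; rewrite lee_fin.
Qed.

Lemma fine_le_abse (x : \bar R) : (`|fine x|%:E <= `|x|)%E.
Proof. by case: x => [r| |] //=; rewrite ?normr0 ?leey. Qed.

(** The kernel has mass [2 pi] in either of its variables. *)
Lemma integral_conv_poisson (q : R -> R) (e : R) : 0 < e ->
  measurable_fun setT q -> (forall x, 0 <= q x) ->
  (\int[mu]_x \int[mu]_y (q x * poisson e (x - y))%:E = (2 * pi)%:E * \int[mu]_x (q x)%:E)%E /\
  (\int[mu]_x \int[mu]_y (q y * poisson e (x - y))%:E = (2 * pi)%:E * \int[mu]_x (q x)%:E)%E.
Proof.
move=> e0 mq q0; have mp := measurable_poisson e0.
have mpE : measurable_fun setT (fun x => (poisson e x)%:E) by exact/measurable_EFinP.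
have mqE : measurable_fun setT (fun x => (q x)%:E) by exact/measurable_EFinP.
have qE0 x : (0 <= (q x)%:E)%E by rewrite lee_fin.
have pE0 x : (0 <= (poisson e x)%:E)%E by rewrite lee_fin poisson_ge0.
have mpx x : measurable_fun setT (fun y : R => (poisson e (x - y))%:E).
  by apply/measurable_EFinP; apply: (measurableT_comp mp); exact: measurable_funB.
have mpy y : measurable_fun setT (fun x : R => (poisson e (x - y))%:E).
  by apply/measurable_EFinP; apply: (measurableT_comp mp); exact: measurable_funB.
split.
  rewrite muleC -ge0_integralZr//; last by rewrite lee_fin mulr_ge0// pi_ge0.
  apply: eq_integral => x _; rewrite -(integral_poisson e0).
  rewrite -(integral_reflect x (f := fun y => (poisson e y)%:E))//.
  by rewrite -ge0_integralZl//; exact: (mpx x).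
rewrite (@fubini_tonelli _ _ _ _ _ mu mu (fun z => (q z.2 * poisson e (z.1 - z.2))%:E)); last 2 first.
- apply/measurable_EFinP; apply: measurable_funM.
    exact: (measurableT_comp mq measurable_snd).
  by apply: (measurableT_comp mp); exact: measurable_funB.
- by move=> z; rewrite lee_fin mulr_ge0// poisson_ge0.
rewrite muleC -ge0_integralZr//; last by rewrite lee_fin mulr_ge0// pi_ge0.
apply: eq_integral => y _; rewrite -(integral_poisson e0).
rewrite -(integral_translate (- y) (f := fun y => (poisson e y)%:E))//.
by rewrite -ge0_integralZl//; exact: (mpy y).
Qed.

Lemma integrable_mul_poisson (u : R -> R) (e x : R) : 0 < e ->
  mu.-integrable setT (EFin \o u) ->
  mu.-integrable setT (EFin \o (fun y => u y * poisson e (x - y))).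
Proof.
move=> e0 iu; apply: (@integrable_le _ _ (fun y => (2 / e) * `|u y|)).
- apply: measurable_funM; first by apply/measurable_EFinP; case/integrableP: iu.
  by apply: (measurableT_comp (measurable_poisson e0)); exact: measurable_funB.
- by move=> y; rewrite normrM mulrC ler_wpM2r// ger0_norm ?poisson_ge0// poisson_le.
- exact/integrable_scale/integrable_normr.
Qed.

(** By [2 |u x| |u y| <= u x ^2 + u y ^2] and the mass of the kernel in each
variable.  The bound is independent of [e], and meaningful when [u] is not square
integrable. *)
Lemma damped_power_le (u : R -> R) (e : R) : 0 < e ->
  mu.-integrable setT (EFin \o u) ->
  ((\int[mu]_w (expR (- e * `|w|) * power u w))%:E <=
   (2 * pi)%:E * \int[mu]_x (u x ^+ 2)%:E)%E.
Proof.
move=> e0 iu; rewrite damped_power_poisson//.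
have mu_ : measurable_fun setT u by apply/measurable_EFinP; case/integrableP: iu.
have mp := measurable_poisson e0.
(* Normalized so that [|u x * u y| <= q x + q y]. *)
pose q x := 2^-1 * u x ^+ 2.
have mq : measurable_fun setT q by apply: measurable_funM => //; exact: measurable_funX.
have q0 x : 0 <= q x by rewrite mulr_ge0// sqr_ge0.
have [E1 E2] := integral_conv_poisson e0 mq q0.
have m1 : measurable_fun setT (fun z : R * R => q z.1 * poisson e (z.1 - z.2)).
  apply: measurable_funM; first exact: (measurableT_comp mq measurable_fst).
  by apply: (measurableT_comp mp); exact: measurable_funB.
have m2 : measurable_fun setT (fun z : R * R => q z.2 * poisson e (z.1 - z.2)).
  apply: measurable_funM; first exact: (measurableT_comp mq measurable_snd).
  by apply: (measurableT_comp mp); exact: measurable_funB.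
have m12 : measurable_fun setT (fun z : R * R => q z.1 * poisson e (z.1 - z.2) +  q z.2 * poisson e (z.1 - z.2)).
  exact: measurable_funD.
have p0 (x y : R) : 0 <= poisson e (x - y) by exact: poisson_ge0.
have sec x (k : R * R -> R) : measurable_fun setT k -> measurable_fun setT (fun y => k (x, y)).
  move=> mk; exact: (measurableT_comp mk (measurable_fun_pair (measurable_cst x) (@measurable_id _ _ _))).
apply: (@le_trans _ _ (\int[mu]_x \int[mu]_y
    (q x * poisson e (x - y) + q y * poisson e (x - y))%:E)%E); last first.
  rewrite le_eqVlt; apply/orP; left; apply/eqP.
  transitivity (\int[mu]_x ((\int[mu]_y (q x * poisson e (x - y))%:E) +
     (\int[mu]_y (q y * poisson e (x - y))%:E)))%E.
    apply: eq_integral => x _.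
    under eq_integral do rewrite EFinD.
    rewrite ge0_integralD//.
    - by move=> y _; rewrite lee_fin mulr_ge0.
    - by apply/measurable_EFinP; exact: (sec x _ m1).
    - by move=> y _; rewrite lee_fin mulr_ge0.
    - by apply/measurable_EFinP; exact: (sec x _ m2).
  rewrite ge0_integralD//; last 4 first.
  - by move=> x _; apply: integral_ge0 => y _; rewrite lee_fin mulr_ge0.
  - by apply: (measurable_fubini_EFin m1) => z; rewrite mulr_ge0.
  - by move=> x _; apply: integral_ge0 => y _; rewrite lee_fin mulr_ge0.
  - by apply: (measurable_fubini_EFin m2) => z; rewrite mulr_ge0.
  rewrite E1 E2.
  have -> : (\int[mu]_x (q x)%:E = 2^-1%:E * \int[mu]_x (u x ^+ 2)%:E)%E.
    rewrite -ge0_integralZl//.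
    - by apply/measurable_EFinP; exact: measurable_funX.
    - by move=> x _; rewrite lee_fin sqr_ge0.
  rewrite -ge0_muleDr.
  - by rewrite -ge0_muleDl ?lee_fin// -EFinD -[2^-1]mul1r -splitr mul1e.
  - by rewrite mule_ge0// integral_ge0// => x _; rewrite lee_fin sqr_ge0.
  - by rewrite mule_ge0// integral_ge0// => x _; rewrite lee_fin sqr_ge0.
pose V x := \int[mu]_y (u y * poisson e (x - y)).
have mV : measurable_fun setT V.
  apply: (measurable_Rintegral (h := fun z => u z.2 * poisson e (z.1 - z.2))).
  apply: measurable_funM; first exact: (measurableT_comp mu_ measurable_snd).
  by apply: (measurableT_comp mp); exact: measurable_funB.
have muV : measurable_fun setT (fun x => (u x * V x)%:E).
  by apply/measurable_EFinP; exact: measurable_funM.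
rewrite /Rintegral; apply: (@le_trans _ _ (`|\int[mu]_x (u x * V x)%:E|)%E).
  by apply: le_trans (fine_le_abse _); rewrite lee_fin ler_norm.
apply: (le_trans (le_abse_integral mu measurableT muV)).
apply: ge0_le_integral => //.
- exact: measurableT_comp.
- by apply: (measurable_fubini_EFin m12) => z; rewrite addr_ge0// mulr_ge0.
move=> x _.
have iux := integrable_mul_poisson x e0 iu.
rewrite /V -RintegralZl// /=; apply: (le_trans (fine_le_abse _)).
have mk : measurable_fun setT (fun y => u x * (u y * poisson e (x - y))).
  by apply: measurable_funM => //; apply/measurable_EFinP; case/integrableP: iux.
apply: (le_trans (le_abse_integral mu measurableT _)); first exact/measurable_EFinP.
apply: ge0_le_integral => //.
- exact: measurable_abseE.
- by apply/measurable_EFinP; exact: (sec x _ m12).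
move=> y _ /=; rewrite lee_fin -mulrDl mulrA normrM (ger0_norm (p0 _ _)) ler_wpM2r//.
rewrite normrM /q -!(real_normK (num_real (u _))).
have := sqr_ge0 (`|u x| - `|u y|).
set a := `|u x|; set b := `|u y| => h; rewrite -subr_ge0.
rewrite (_ : _ - _ = 2^-1 * (a - b) ^+ 2); first by rewrite mulr_ge0.
by field.
Qed.

Lemma power_le (u : R -> R) : mu.-integrable setT (EFin \o u) ->
  (\int[mu]_w (power u w)%:E <= (2 * pi)%:E * \int[mu]_x (u x ^+ 2)%:E)%E.
Proof.
move=> iu; have h := damped_power_cvg iu; rewrite -(cvg_lim _ h)//.
apply: lime_le; first by apply/cvg_ex; eexists; exact: h.
by apply: nearW => n; apply: damped_power_le => //; rewrite invr_gt0 ltr0n.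
Qed.

(** After rescaling, the mean is one of [u (x - e s)] against the fixed kernel
[poisson 1 s], so continuity at [x] and boundedness allow dominated
convergence. *)
Lemma conv_poisson_cvg (u : R -> R) (M x : R) : continuous u -> (forall x, `|u x| <= M) ->
  mu.-integrable setT (EFin \o u) ->
  \int[mu]_y (u y * poisson n.+1%:R^-1 (x - y)) @[n --> \oo] --> u x * (2 * pi).
Proof.
move=> cu uM iu.
have mu_ : measurable_fun setT u by apply/measurable_EFinP; case/integrableP: iu.
have M0 : 0 <= M by apply: le_trans (uM 0).
have mp1 : measurable_fun setT (@poisson R 1) by exact: measurable_poisson.
have E n : \int[mu]_y (u y * poisson n.+1%:R^-1 (x - y)) =
    \int[mu]_s (u (- n.+1%:R^-1 * s + x) * poisson 1 s).
  set e : R := n.+1%:R^-1; have e0 : 0 < e by rewrite invr_gt0 ltr0n.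
  have eN : - e != 0 by rewrite oppr_eq0 gt_eqF.
  have := Rintegral_affine x eN (integrable_mul_poisson x e0 iu).
  rewrite normrN (gtr0_norm e0) => /(congr1 ( *%R e)).
  rewrite mulrA mulfV ?gt_eqF// mul1r => <-.
  rewrite -RintegralZl//; last exact: (integrable_affine x eN (integrable_mul_poisson x e0 iu)).
  apply: eq_Rintegral => s _; rewrite -(poisson_scale s e0).
  rewrite (_ : x - _ = e * s); first by ring.
  by rewrite mulNr opprD opprK addrCA subrr addr0.
have -> : u x * (2 * pi) = \int[mu]_s (u x * poisson 1 s).
  rewrite RintegralZl//; last exact: integrable_poisson1.
  by rewrite /Rintegral integral_poisson1.
under eq_cvg do rewrite E.
apply: (Rintegral_dct (g := fun s => M * poisson 1 s)).
- move=> n; apply: measurable_funM => //.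
  by apply: (measurableT_comp mu_); exact: measurable_affine.
- move=> s; apply: cvgMl.
  have h : - n.+1%:R^-1 * s + x @[n --> \oo] --> x.
    rewrite -[X in _ --> X]add0r; apply: cvgD; last exact: cvg_cst.
    rewrite -(mul0r s); apply: cvgMl; rewrite -oppr0; apply: cvgN.
    exact: cvg_harmonic.
  exact: (cvg_comp _ _ h (cu x)).
- exact/integrable_scale/integrable_poisson1.
- by move=> n s; rewrite normrM (ger0_norm (poisson_ge0 s ltr01)) ler_wpM2r// poisson_ge0.
Qed.

(** The damped spectra have integral [int u (u * P_e)], and [u * P_e] tends to
[2 pi u] while staying bounded by [2 pi M]: dominated convergence with
dominating function [2 pi M |u|]. *)
Lemma power_continuous (u : R -> R) (M : R) : continuous u -> (forall x, `|u x| <= M) ->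
  mu.-integrable setT (EFin \o u) ->
  (\int[mu]_w (power u w)%:E = (2 * pi)%:E * \int[mu]_x (u x ^+ 2)%:E)%E.
Proof.
move=> cu uM iu.
have mu_ : measurable_fun setT u by apply/measurable_EFinP; case/integrableP: iu.
have M0 : 0 <= M by apply: le_trans (uM 0).
have i2 : mu.-integrable setT (EFin \o (fun x => u x ^+ 2)).
  apply: (@integrable_le _ _ (fun x => M * `|u x|)).
  - exact: measurable_funX.
  - by move=> x; rewrite expr2 normrM ler_wpM2r.
  - exact/integrable_scale/integrable_normr.
have h := damped_power_cvg iu.
have ip n x : mu.-integrable setT (EFin \o (fun y => u y * poisson n.+1%:R^-1 (x - y))).
  by apply: integrable_mul_poisson => //; rewrite invr_gt0 ltr0n.
have h2 : (\int[mu]_w (expR (- n.+1%:R^-1 * `|w|) * power u w)) @[n --> \oo] -->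
    \int[mu]_x (u x * (u x * (2 * pi))).
  under eq_cvg do rewrite damped_power_poisson ?invr_gt0 ?ltr0n//.
  apply: (Rintegral_dct (g := fun x => (M * (2 * pi)) * `|u x|)).
  - move=> n; apply: measurable_funM => //.
    apply: (measurable_Rintegral (h := fun z => u z.2 * poisson n.+1%:R^-1 (z.1 - z.2))).
    apply: measurable_funM; first exact: (measurableT_comp mu_ measurable_snd).
    apply: (measurableT_comp (f := poisson n.+1%:R^-1)); last exact: measurable_funB.
    by apply: measurable_poisson; rewrite invr_gt0 ltr0n.
  - move=> x; apply: cvgM; first exact: cvg_cst.
    exact: conv_poisson_cvg uM iu.
  - exact/integrable_scale/integrable_normr.
  - move=> n x; rewrite normrM mulrC ler_wpM2r//.
    have e0 : 0 < n.+1%:R^-1 :> R by rewrite invr_gt0 ltr0n.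
    apply: (le_trans (le_normr_Rintegral measurableT (ip n x))).
    apply: (@le_trans _ _ (\int[mu]_y (M * poisson n.+1%:R^-1 (x - y)))).
      have mpe := measurable_poisson e0.
      have ipe : mu.-integrable setT (EFin \o poisson n.+1%:R^-1).
        apply/integrableP; split; first exact/measurable_EFinP.
        under eq_integral do rewrite /= ger0_norm ?poisson_ge0//.
        by rewrite integral_poisson// ltry.
      apply: le_Rintegral => //.
      + exact: integrable_normr (ip n x).
      + apply: integrable_scale.
        have := integrable_affine x (_ : -1 != 0) ipe.
        rewrite oppr_eq0 oner_eq0 => /(_ isT); congr (_.-integrable _ _).
        by apply/funext => y /=; rewrite mulN1r addrC.
      + by move=> y _; rewrite normrM (ger0_norm (poisson_ge0 _ e0)) ler_wpM2r// poisson_ge0.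
    have mpe := measurable_poisson e0.
    have ipe : mu.-integrable setT (EFin \o poisson n.+1%:R^-1).
      apply/integrableP; split; first exact/measurable_EFinP.
      under eq_integral do rewrite /= ger0_norm ?poisson_ge0//.
      by rewrite integral_poisson// ltry.
    rewrite (Rintegral_reflect x (f := fun y => M * poisson n.+1%:R^-1 y)); last exact: measurable_funM.
    by rewrite RintegralZl// /Rintegral integral_poisson.
have h3 : (\int[mu]_w (expR (- n.+1%:R^-1 * `|w|) * power u w))%:E @[n --> \oo] -->
    (\int[mu]_x (u x * (u x * (2 * pi))))%:E.
  by apply: cvg_EFin; [exact: nearW|exact: h2].
rewrite -(cvg_lim _ h)// (cvg_lim _ h3)//.
rewrite (_ : \int[mu]_x (u x * (u x * (2 * pi))) = \int[mu]_x (2 * pi * u x ^+ 2)); last first.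
  by apply: eq_Rintegral => x _; ring.
by rewrite RintegralZl// EFinM; congr (_ * _)%E; rewrite /Rintegral fineK// integrable_fin_num.
Qed.

End RealBounds.

(** * Fatou's lemma *)

Section Fatou.
Context {R : realType}.
Local Notation mu := (@lebesgue_measure R).

(** The form of Fatou's lemma in which only a bound on the integrals is
known and the limit is taken almost everywhere. *)
Lemma fatou_bound (f_ : nat -> R -> R) (f : R -> R) (K : \bar R) :
  (forall n, measurable_fun setT (f_ n)) -> (forall n x, 0 <= f_ n x) ->
  measurable_fun setT f -> (forall x, 0 <= f x) ->
  {ae mu, forall x, f_ n x @[n --> \oo] --> f x} ->
  (forall n, \int[mu]_x (f_ n x)%:E <= K)%E -> (\int[mu]_x (f x)%:E <= K)%E.
Proof.
move=> mf_ f_0 mf f0 ff fK.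
have mE n : measurable_fun setT (fun x : R => (f_ n x)%:E) by exact/measurable_EFinP.
have mE' n : measurable_fun setT (fun x : R => einfs (fun n => (f_ n x)%:E) n).
  exact: (measurable_fun_einfs mE).
have mL : measurable_fun setT (fun x => limn_einf (fun n => (f_ n x)%:E)).
  apply: (emeasurable_fun_cvg _ _ mE') => x _.
  by rewrite limn_einf_lim; exact: is_cvg_einfs.
have L0 x : (0 <= limn_einf (fun n => (f_ n x)%:E))%E.
  rewrite limn_einf_lim; apply: lime_ge; first exact: is_cvg_einfs.
  apply: nearW => n; apply: le_ereal_inf_tmp => _ [m _ <-]; by rewrite lee_fin.
rewrite (@ge0_ae_eq_integral _ _ _ mu setT _ (fun x => limn_einf (fun n => (f_ n x)%:E)))//.
- apply: (le_trans (fatou mu measurableT mE _)); first by move=> n x _; rewrite lee_fin.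
  rewrite limn_einf_lim; apply: lime_le; first exact: is_cvg_einfs.
  apply: nearW => n; apply: le_trans (fK n); apply: ereal_inf_lbound.
  by exists n => //=.
- exact/measurable_EFinP.
- by move=> x _; rewrite lee_fin.
- apply: (@filterS _ _ (ae_filter_ringOfSetsType mu)) ff => x /= fx _.
  have h : (f_ n x)%:E @[n --> \oo] --> (f x)%:E by apply: cvg_EFin; [exact: nearW|exact: fx].
  by rewrite (cvg_limn_einf_sup h).1.
Qed.

End Fatou.

(** * Plancherel's formula for continuous bounded functions *)

Section Plancherel.
Context {R : realType}.
Local Notation mu := (@lebesgue_measure R).
Implicit Types (f g : R -> R[i]).

Lemma energy_ReIm f : cmeasurable f ->
  energy f = (\int[mu]_x (complex.Re (f x) ^+ 2)%:E + \int[mu]_x (complex.Im (f x) ^+ 2)%:E)%E.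
Proof.
move=> [mr mi]; rewrite /energy.
under eq_integral do rewrite normc2E EFinD.
rewrite ge0_integralD//.
- by move=> x _; rewrite lee_fin sqr_ge0.
- by apply/measurable_EFinP; exact: measurable_funX.
- by move=> x _; rewrite lee_fin sqr_ge0.
- by apply/measurable_EFinP; exact: measurable_funX.
Qed.

Let integrable_cos (a : R -> R) w : mu.-integrable setT (EFin \o a) ->
  mu.-integrable setT (EFin \o (fun x => a x * cos (w * x))).
Proof.
move=> ia; apply: integrable_bounded_mul => //.
  by apply: (measurableT_comp (f := cos)); [exact: measurable_cos|exact: measurable_funM].
by move=> x; rewrite ler_norml cos_geN1 cos_le1.
Qed.

Let integrable_sin (a : R -> R) w : mu.-integrable setT (EFin \o a) ->
  mu.-integrable setT (EFin \o (fun x => a x * sin (w * x))).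
Proof.
move=> ia; apply: integrable_bounded_mul => //.
  by apply: (measurableT_comp (f := sin)); [exact: measurable_sin|exact: measurable_funM].
by move=> x; rewrite ler_norml sin_geN1 sin_le1.
Qed.

Lemma fourier_ReIm f w : cLp 1%:E f ->
  complex.Re (fourier f w) = cosp (fun x => complex.Re (f x)) w + sinp (fun x => complex.Im (f x)) w /\
  complex.Im (fourier f w) = cosp (fun x => complex.Im (f x)) w - sinp (fun x => complex.Re (f x)) w.
Proof.
move=> f1; have iR := cL1_Re f1; have iI := cL1_Im f1.
rewrite /fourier /cosp /sinp /=; split.
  rewrite -RintegralD//; [|exact: integrable_cos|exact: integrable_sin].
  by apply: eq_Rintegral => x _; rewrite ReM /= cosN sinN; ring.
rewrite -RintegralB//; [|exact: integrable_cos|exact: integrable_sin].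
by apply: eq_Rintegral => x _; rewrite ImM /= cosN sinN; ring.
Qed.

Lemma cospN (a : R -> R) w : cosp a (- w) = cosp a w.
Proof. by apply: eq_Rintegral => x _; rewrite mulNr cosN. Qed.

Lemma sinpN (a : R -> R) w : mu.-integrable setT (EFin \o a) -> sinp a (- w) = - sinp a w.
Proof.
move=> ia; rewrite /sinp -[RHS]mulN1r -RintegralZl//; last exact: integrable_sin.
by apply: eq_Rintegral => x _; rewrite mulNr sinN; ring.
Qed.

(** The cross terms between the real and the imaginary part of [f] are odd in
[w]; adding the values at [w] and [- w] removes them. *)
Lemma normc2_fourier_sym f w : cLp 1%:E f ->
  normc (fourier f w) ^+ 2 + normc (fourier f (- w)) ^+ 2 =
  2 * (power (fun x => complex.Re (f x)) w + power (fun x => complex.Im (f x)) w).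
Proof.
move=> f1; have iR := cL1_Re f1; have iI := cL1_Im f1.
have [R1 I1] := fourier_ReIm w f1; have [R2 I2] := fourier_ReIm (- w) f1.
rewrite !normc2E R1 R2 I1 I2 !cospN !sinpN// /power; ring.
Qed.

(** Integrals over the line do not change under [w |-> - w].  Stated in this
symmetric form, the identity is free of the subtraction of possibly infinite
quantities. *)
Lemma energy_symmetrize f (p : R -> R) : cmeasurable f ->
  measurable_fun setT p -> (forall w, 0 <= p w) ->
  (forall w, normc (f w) ^+ 2 + normc (f (- w)) ^+ 2 = 2 * p w) ->
  energy f = (\int[mu]_w (p w)%:E)%E.
Proof.
move=> mf mp p0 fp.
have mf2 := measurable_normc2 mf.
have mfN : measurable_fun setT (fun w : R => (normc (f (- w)) ^+ 2)%:E).
  apply: (measurable_normc2 (f := fun w => f (- w))).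
  by apply: (cmeasurable_comp mf).
have EN : (\int[mu]_w (normc (f (- w)) ^+ 2)%:E = energy f)%E.
  rewrite -[RHS](energy_reflect 0 mf) /energy.
  by apply: eq_integral => w _; rewrite sub0r.
have E2 : (energy f + energy f = 2%:E * \int[mu]_w (p w)%:E)%E.
  transitivity (\int[mu]_w ((normc (f w) ^+ 2)%:E + (normc (f (- w)) ^+ 2)%:E))%E.
    rewrite ge0_integralD//.
    - by rewrite EN.
    - by move=> x _; rewrite lee_fin sqr_ge0.
    - by move=> x _; rewrite lee_fin sqr_ge0.
  rewrite -ge0_integralZl//; last 2 first.
  - exact/measurable_EFinP.
  - by move=> x _; rewrite lee_fin.
  by apply: eq_integral => w _; rewrite -EFinD -EFinM fp.
(* Both sides may be infinite, so [2] is cancelled by a case analysis. *)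
have half (x : \bar R) : x = (2^-1%:E * (x + x))%E.
  by case: x => [r| |]//=; rewrite ?gt0_muley ?gt0_muleNy ?lte_fin// -EFinD -EFinM; congr EFin; field.
by rewrite [LHS]half E2 muleA -EFinM mulVf// mul1e.
Qed.

Lemma energy_fourier f : cLp 1%:E f -> energy (fourier f) =
  (\int[mu]_w (power (fun x => complex.Re (f x)) w)%:E +
   \int[mu]_w (power (fun x => complex.Im (f x)) w)%:E)%E.
Proof.
move=> f1; have iR := cL1_Re f1; have iI := cL1_Im f1.
have mP1 := measurable_power iR; have mP2 := measurable_power iI.
rewrite (@energy_symmetrize _ (fun w => power (fun x => complex.Re (f x)) w +
   power (fun x => complex.Im (f x)) w)).
- rewrite -ge0_integralD//.
  + by move=> w _; rewrite lee_fin power_ge0.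
  + exact/measurable_EFinP.
  + by move=> w _; rewrite lee_fin power_ge0.
  + exact/measurable_EFinP.
- by apply: cmeasurable_fourier; case: f1.
- exact: measurable_funD.
- by move=> w; rewrite addr_ge0// power_ge0.
- by move=> w; exact: normc2_fourier_sym.
Qed.

Lemma plancherel_le f : cLp 1%:E f ->
  (energy (fourier f) <= (2 * pi)%:E * energy f)%E.
Proof.
move=> f1; have iR := cL1_Re f1; have iI := cL1_Im f1.
rewrite energy_fourier// energy_ReIm; last by case: f1.
rewrite ge0_muleDr.
- by apply: leeD; exact: power_le.
- by apply: integral_ge0 => x _; rewrite lee_fin sqr_ge0.
- by apply: integral_ge0 => x _; rewrite lee_fin sqr_ge0.
Qed.

Lemma plancherel_continuous f (M : R) : cLp 1%:E f ->
  continuous (fun x => complex.Re (f x)) -> continuous (fun x => complex.Im (f x)) ->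
  (forall x, normc (f x) <= M) ->
  (energy (fourier f) = (2 * pi)%:E * energy f)%E.
Proof.
move=> f1 cR cI fM; have iR := cL1_Re f1; have iI := cL1_Im f1.
rewrite energy_fourier// energy_ReIm; last by case: f1.
rewrite ge0_muleDr; last 2 first.
- by apply: integral_ge0 => x _; rewrite lee_fin sqr_ge0.
- by apply: integral_ge0 => x _; rewrite lee_fin sqr_ge0.
rewrite (@power_continuous _ _ M)//; last by move=> x; exact: le_trans (Re_le_normc _) (fM x).
by rewrite (@power_continuous _ _ M)// => x; exact: le_trans (Im_le_normc _) (fM x).
Qed.

End Plancherel.

(** * Regularization by tent functions *)

Section Tent.
Context {R : realType}.
Local Notation mu := (@lebesgue_measure R).

(** A compactly supported, bounded, Lipschitz kernel: boundedness and the
support give convergence at Lebesgue points, the Lipschitz bound gives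
continuity of the convolutions. *)
Definition tent (y : R) : R := Num.max 0 (1 - `|y|).

Lemma tent_ge0 y : 0 <= tent y.
Proof. by rewrite /tent le_max lexx. Qed.

Lemma tent_le1 y : tent y <= 1.
Proof. by rewrite /tent ge_max ler01 /= lerBlDr lerDl. Qed.

Lemma tent_eq0 y : 1 <= `|y| -> tent y = 0.
Proof. by move=> y1; rewrite /tent max_l// subr_le0. Qed.

Lemma tent_lipschitz y z : `|tent y - tent z| <= `|y - z|.
Proof.
have h := ler_dist_dist y z; have h0 := normr_ge0 (y - z).
have : - `|y - z| <= `|y| - `|z| <= `|y - z| by rewrite -ler_norml.
move=> /andP[h1 h2]; rewrite ler_norml /tent.
case: (leP 0 (1 - `|y|)) => hy; case: (leP 0 (1 - `|z|)) => hz; apply/andP; split; lra.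
Qed.

Lemma continuous_tent : continuous tent.
Proof.
move=> y; apply: (@continuous_max R R (cst 0) (fun y => 1 - `|y|)).
  exact: cvg_cst.
by apply: cvgB; [exact: cvg_cst|exact: norm_continuous].
Qed.

Lemma measurable_tent : measurable_fun setT tent.
Proof. by apply: continuous_measurable_fun; exact: continuous_tent. Qed.

Lemma integrable_ball_indic (x r : R) : 0 <= r ->
  mu.-integrable setT (EFin \o (\1_(ball x r) : R -> R)).
Proof.
move=> r0; apply/integrableP; split.
  by apply/measurable_EFinP; apply: measurable_indic; exact: measurable_ball.
under eq_integral do rewrite /= ger0_norm//.
rewrite integral_indic//; last exact: measurable_ball.
by rewrite setIT (_ : _ (ball x r) = (r *+ 2)%:E) ?ltry//; exact: lebesgue_measure_ball.
Qed.

Lemma integrable_tent : mu.-integrable setT (EFin \o tent).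
Proof.
apply: (@integrable_le _ _ (\1_(ball (0:R) 1) : R -> R)).
- exact: measurable_tent.
- move=> y; rewrite ger0_norm ?tent_ge0// indicE.
  have [y1|y1] := ltP `|y| 1.
    by rewrite mem_set ?tent_le1// /ball/= sub0r normrN.
  by rewrite tent_eq0// ler0n.
- exact: integrable_ball_indic.
Qed.

(** On the ball of radius [1/2] the tent is at least [1/2]. *)
Lemma tent_mass_gt0 : 0 < \int[mu]_y tent y.
Proof.
have h0 : 0 <= 2^-1 :> R by rewrite invr_ge0.
apply: (@lt_le_trans _ _ (\int[mu]_y (2^-1 * (\1_(ball (0:R) 2^-1) : R -> R) y))).
  rewrite RintegralZl//; last exact: integrable_ball_indic.
  rewrite mulr_gt0 ?invr_gt0// /Rintegral integral_indic//; last exact: measurable_ball.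
  rewrite setIT (_ : _ (ball (0 : R) 2^-1) = (2^-1 *+ 2)%:E)//=; last exact: lebesgue_measure_ball.
apply: le_Rintegral => //.
- exact/integrable_scale/integrable_ball_indic.
- exact: integrable_tent.
move=> y _; rewrite indicE; have [yh|yh] := boolP (y \in (ball (0 : R) 2^-1 : set R)); last first.
  by rewrite mulr0 tent_ge0.
move: yh; rewrite inE /ball/= sub0r normrN mulr1 => yh.
rewrite /tent le_max; apply/orP; right; lra.
Qed.

Definition tent_kernel (e y : R) : R := ((\int[mu]_y tent y) * e)^-1 * tent (e^-1 * y).

Section Kernel.
Variable e : R.
Hypothesis e0 : 0 < e.
Let c := \int[mu]_y tent y.
Let c0 : 0 < c := tent_mass_gt0.

Lemma tent_kernel_ge0 y : 0 <= tent_kernel e y.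
Proof. by rewrite mulr_ge0 ?tent_ge0// invr_ge0 mulr_ge0// ltW. Qed.

Lemma tent_kernel_le y : tent_kernel e y <= (c * e)^-1.
Proof. by rewrite ler_piMr ?tent_le1// invr_ge0 mulr_ge0// ltW. Qed.

Lemma tent_kernel_eq0 y : e <= `|y| -> tent_kernel e y = 0.
Proof.
move=> ey; rewrite /tent_kernel tent_eq0 ?mulr0// normrM ger0_norm ?invr_ge0 ?(ltW e0)//.
by rewrite mulrC ler_pdivlMr// mul1r.
Qed.

Lemma tent_kernel_lipschitz y z :
  `|tent_kernel e y - tent_kernel e z| <= ((c * e)^-1 * e^-1) * `|y - z|.
Proof.
rewrite -mulrBr normrM ger0_norm; last by rewrite invr_ge0 mulr_ge0// ltW.
rewrite -mulrA ler_wpM2l//; first by rewrite invr_ge0 mulr_ge0// ltW.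
apply: (le_trans (tent_lipschitz _ _)).
by rewrite -mulrBr normrM ger0_norm// invr_ge0 ltW.
Qed.

Lemma measurable_tent_kernel : measurable_fun setT (tent_kernel e).
Proof.
by apply: measurable_funM => //; apply: (measurableT_comp measurable_tent); exact: measurable_funM.
Qed.

Let e1 : e^-1 != 0. Proof. by rewrite invr_eq0 gt_eqF. Qed.

Lemma integrable_tent_kernel : mu.-integrable setT (EFin \o tent_kernel e).
Proof.
have := integrable_scale (c * e)^-1 (integrable_affine 0 e1 integrable_tent).
congr (_.-integrable _ _); apply/funext => y /=; by rewrite addr0.
Qed.

Lemma Rintegral_tent_kernel : \int[mu]_y tent_kernel e y = 1.
Proof.
have ia := integrable_affine 0 e1 integrable_tent.
transitivity (\int[mu]_y ((c * e)^-1 * tent (e^-1 * y + 0))).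
  by apply: eq_Rintegral => y _; rewrite addr0.
rewrite RintegralZl// (Rintegral_affine 0 e1 integrable_tent) -/c.
rewrite ger0_norm ?invr_ge0 ?(ltW e0)// invrK.
by field; rewrite !gt_eqF.
Qed.

End Kernel.

(** The kernel at scale [e] is bounded by [1 / (c e)] and supported in the ball
of radius [e], so the error is at most [2 / c] times the average of [|u - u x|]
over that ball. *)
Lemma tent_kernel_cvg (u : R -> R) (x : R) : mu.-integrable setT (EFin \o u) ->
  lebesgue_pt u x ->
  \int[mu]_y (u y * tent_kernel n.+1%:R^-1 (x - y)) @[n --> \oo] --> u x.
Proof.
move=> iu ux; set c := \int[mu]_y tent y; have c0 : 0 < c := tent_mass_gt0.
have mu_ : measurable_fun setT u by apply/measurable_EFinP; case/integrableP: iu.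
have dn : davg u x n.+1%:R^-1 @[n --> \oo] --> 0%E.
  apply: ((cvge_at_rightP _ _ _).1 ux); split; last exact: cvg_harmonic.
  by move=> n; rewrite invr_gt0 ltr0n.
have bnd n : (`|\int[mu]_y (u y * tent_kernel n.+1%:R^-1 (x - y)) - u x|%:E <=
   (2 / c)%:E * davg u x n.+1%:R^-1)%E.
  set e : R := n.+1%:R^-1; have e0 : 0 < e by rewrite invr_gt0 ltr0n.
  have ik : mu.-integrable setT (EFin \o (fun y => tent_kernel e (x - y))).
    have := integrable_affine x (_ : -1 != 0) (integrable_tent_kernel e0).
    rewrite oppr_eq0 oner_eq0 => /(_ isT); congr (_.-integrable _ _).
    by apply/funext => y /=; rewrite mulN1r addrC.
  have mk : measurable_fun setT (fun y : R => tent_kernel e (x - y)).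
    by apply/measurable_EFinP; case/integrableP: ik.
  have iuk : mu.-integrable setT (EFin \o (fun y => u y * tent_kernel e (x - y))).
    apply: (@integrable_le _ _ (fun y => (c * e)^-1 * `|u y|)).
    - exact: measurable_funM.
    - move=> y; rewrite normrM mulrC ler_wpM2r// ger0_norm ?tent_kernel_ge0//.
      exact: tent_kernel_le.
    - exact/integrable_scale/integrable_normr.
  have -> : u x = \int[mu]_y (u x * tent_kernel e (x - y)).
    rewrite RintegralZl// (Rintegral_reflect x (measurable_tent_kernel e)).
    by rewrite Rintegral_tent_kernel// mulr1.
  rewrite -RintegralB//; last exact: integrable_scale.
  apply: (le_trans (fine_le_abse _)).
  have mw : measurable_fun setT (fun y : R => u y * tent_kernel e (x - y) - u x * tent_kernel e (x - y)).
    by apply: measurable_funB; exact: measurable_funM.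
  apply: (le_trans (le_abse_integral mu measurableT _)); first exact/measurable_EFinP.
  rewrite /davg /iavg lebesgue_measure_ball ?(ltW e0)//.
  have mB : measurable (ball x e) by exact: measurable_ball.
  have mc : measurable_fun setT (fun y => u y - u x) by exact: measurable_funB.
  rewrite inver ifF; last by rewrite mulrn_eq0/= gt_eqF.
  rewrite muleA -EFinM.
  have mcE : measurable_fun (ball x e) (fun y : R => `|((center (u x) \o u) y)%:E|%E).
    by apply: measurable_funTS; exact: (measurable_abseE mc).
  rewrite -ge0_integralZl//; last first.
    by rewrite lee_fin mulr_ge0 ?invr_ge0 ?mulrn_wge0 ?divr_ge0 ?(ltW e0) ?(ltW c0).
  have mr : measurable_fun (ball x e)
      (fun y : R => ((2 / c / (e *+ 2))%:E * `|((center (u x) \o u) y)%:E|)%E).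
    exact: measurable_funeM.
  rewrite [leRHS]integral_mkcond.
  apply: ge0_le_integral => //.
  - exact: (measurable_abseE mw).
  - exact: ((measurable_restrictT _ mB).1 mr).
  move=> y _; rewrite /restrict; case: ifPn => yB; last first.
    rewrite lee_fin tent_kernel_eq0// ?mulr0 ?subrr ?normr0//.
    by move: yB; rewrite notin_setE /ball/= => /negP; rewrite -leNgt.
  rewrite /= -EFinM lee_fin -mulrBl normrM mulrC ler_wpM2r//.
  rewrite ger0_norm ?tent_kernel_ge0//; apply: (le_trans (tent_kernel_le e0 _)).
  rewrite le_eqVlt; apply/orP; left; apply/eqP; rewrite -/c.
  by field; rewrite !gt_eqF.
have c2 : ((2 / c)%:E * davg u x n.+1%:R^-1)%E @[n --> \oo] --> 0%E.
  by rewrite -[X in _ --> X](mule0 (2 / c)%:E); apply: cvgeZl.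
have h : `|\int[mu]_y (u y * tent_kernel n.+1%:R^-1 (x - y)) - u x|%:E @[n --> \oo] --> 0%E.
  apply: (@squeeze_cvge _ _ _ _ (cst 0%E) _ (fun n => (2 / c)%:E * davg u x n.+1%:R^-1)%E) => //.
    by apply: nearW => n; rewrite bnd andbT lee_fin.
  exact: cvg_cst.
have {}h : `|\int[mu]_y (u y * tent_kernel n.+1%:R^-1 (x - y)) - u x| @[n --> \oo] --> (0 : R).
  by move/fine_cvg : h.
apply/cvgrPdist_lt => e e0; move/cvgrPdist_lt : h => /(_ e e0).
by apply: filterS => n; rewrite sub0r normrN normr_id distrC.
Qed.

End Tent.

(** * Plancherel's formula on the intersection of L1 and L2 *)

Section PlancherelFull.
Context {R : realType}.
Local Notation mu := (@lebesgue_measure R).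
Implicit Types (f g : R -> R[i]).

Let ck (n : nat) (y : R) : R[i] := (tent_kernel n.+1%:R^-1 y)%:C.

Let en0 n : 0 < n.+1%:R^-1 :> R. Proof. by rewrite invr_gt0 ltr0n. Qed.

Let cL1_ck n : cLp 1%:E (ck n).
Proof.
apply: (@cL1_dom _ _ (tent_kernel n.+1%:R^-1)).
- by apply: cmeasurable_real; apply: measurable_tent_kernel.
- exact: integrable_tent_kernel.
- by move=> x; rewrite normc_real ger0_norm// tent_kernel_ge0.
Qed.

Let cL2_ck n : cLp 2%:E (ck n).
Proof.
apply: (cL2_bounded (cL1_ck n)) => x.
by rewrite normc_real ger0_norm ?tent_kernel_ge0//; exact: tent_kernel_le.
Qed.

Let approx f n := convolution f (ck n).

Let approx_lipschitz f n : cLp 1%:E f -> cLp 2%:E f ->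
  exists L, forall x y, normc (approx f n x - approx f n y) <= L * `|x - y|.
Proof.
move=> f1 f2; pose K : R := ((\int[mu]_y tent y) * n.+1%:R^-1)^-1 * (n.+1%:R^-1)^-1.
exists (K * \int[mu]_z normc (f z)) => x y.
rewrite -cintB; [|exact: conv_section..].
have i : cLp 1%:E (fun z => f z * ck n (x - z) - f z * ck n (y - z)).
  by apply: cL1B; exact: conv_section.
apply: (le_trans (normc_cint i)).
rewrite mulrAC -RintegralZl//; last exact: cL1_normc.
apply: le_Rintegral => //; [exact: cL1_normc|exact/integrable_scale/cL1_normc|].
move=> z _; rewrite -mulrBr normcM mulrC ler_wpM2r ?normc_ge0//.
rewrite -rmorphB normc_real; apply: (le_trans (tent_kernel_lipschitz (en0 n) _ _)).
by rewrite opprB addrA subrK.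
Qed.

Lemma lipschitz_continuous (F : R -> R) (L : R) :
  (forall x y, `|F x - F y| <= L * `|x - y|) -> continuous F.
Proof.
move=> FL x; apply/cvgrPdist_le => e e0.
have L1 : 0 < `|L| + 1 by rewrite ltr_wpDl.
exists (e / (`|L| + 1)) => /=; first by rewrite divr_gt0.
move=> y /= xy; apply: (le_trans (FL _ _)).
apply: (@le_trans _ _ ((`|L| + 1) * `|x - y|)).
  by rewrite ler_wpM2r// (le_trans (ler_norm _))// lerDl.
by rewrite mulrC -ler_pdivlMr// ltW.
Qed.

Let approx_continuous f n : cLp 1%:E f -> cLp 2%:E f ->
  continuous (fun x => complex.Re (approx f n x)) /\
  continuous (fun x => complex.Im (approx f n x)).
Proof.
move=> f1 f2; have [L HL] := approx_lipschitz n f1 f2.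
split; apply: (@lipschitz_continuous _ L) => x y; apply: le_trans (HL x y).
  by rewrite -ReB; exact: Re_le_normc.
by rewrite -ImB; exact: Im_le_normc.
Qed.

Let approx_energy f n : cLp 1%:E f -> cLp 2%:E f ->
  (energy (approx f n) <= ((2 * pi)^-1)%:E * energy (fourier f))%E.
Proof.
move=> f1 f2; have [cR cI] := approx_continuous n f1 f2.
have pi0 : 0 < 2 * pi :> R by rewrite mulr_gt0// pi_gt0.
have F1 : cLp 1%:E (approx f n) by exact: cL1_conv.
have := plancherel_continuous F1 cR cI (fun x => conv_bounded x f2 (cL2_ck n)).
move=> h; have -> : energy (approx f n) = (((2 * pi)^-1)%:E * energy (fourier (approx f n)))%E.
  by rewrite h muleA -EFinM mulVf ?mul1e// gt_eqF.
apply: lee_wpmul2l; first by rewrite lee_fin invr_ge0 ltW.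
apply: ge0_le_integral => //.
- by move=> w _; rewrite lee_fin sqr_ge0.
- by apply: measurable_normc2; apply: cmeasurable_fourier; case: F1.
- by apply: measurable_normc2; apply: cmeasurable_fourier; case: f1.
move=> w _; rewrite lee_fin fourier_conv// normcM lerXn2r ?nnegrE ?mulr_ge0 ?normc_ge0//.
rewrite ler_piMr ?normc_ge0//; apply: (le_trans (fourier_bound w (cL1_ck n))).
rewrite -(Rintegral_tent_kernel (en0 n)) le_eqVlt; apply/orP; left; apply/eqP.
by apply: eq_Rintegral => x _; rewrite normc_real ger0_norm// tent_kernel_ge0.
Qed.

(** The regularizations [f * ck n] are continuous and bounded, so they satisfy
the equality; their transforms are smaller than that of [f] in modulus, since
the kernel has mass one; and they converge to [f] at Lebesgue points, so Fatou's
lemma passes the inequality to [f]. *)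
Lemma plancherel_ge f : cLp 1%:E f -> cLp 2%:E f ->
  (energy f <= ((2 * pi)^-1)%:E * energy (fourier f))%E.
Proof.
move=> f1 f2; have iR := cL1_Re f1; have iI := cL1_Im f1.
have mA n : cmeasurable (approx f n).
  by apply: cmeasurable_conv; [case: f1|case: (cL1_ck n)].
apply: (@fatou_bound _ (fun n x => normc (approx f n x) ^+ 2)).
- by move=> n; apply: measurable_funX; exact: cmeasurable_normc.
- by move=> n x; exact: sqr_ge0.
- by apply: measurable_funX; apply: cmeasurable_normc; case: f1.
- by move=> x; exact: sqr_ge0.
- have lR := lebesgue_differentiation (open_integrable_locally openT iR).
  have lI := lebesgue_differentiation (open_integrable_locally openT iI).
  apply: (@filterS2 _ _ (ae_filter_ringOfSetsType mu)) lR lI => x xR xI.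
  have hR := tent_kernel_cvg iR xR; have hI := tent_kernel_cvg iI xI.
  rewrite normc2E; under eq_cvg do rewrite normc2E.
  apply: cvgD.
    apply: (@cvg_continuous_comp _ (fun z => z ^+ 2)); first exact: exprn_continuous.
    under eq_cvg.
      move=> n; rewrite /approx /convolution /cint /=.
      under eq_Rintegral do rewrite ReM /= mulr0 subr0.
      over.
    exact: hR.
  apply: (@cvg_continuous_comp _ (fun z => z ^+ 2)); first exact: exprn_continuous.
  under eq_cvg.
    move=> n; rewrite /approx /convolution /cint /=.
    under eq_Rintegral do rewrite ImM /= mulr0 add0r.
    over.
  exact: hI.
- by move=> n; exact: approx_energy.
Qed.

Theorem plancherel f : cLp 1%:E f -> cLp 2%:E f ->
  energy (fourier f) = ((2 * pi)%:E * energy f)%E.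
Proof.
move=> f1 f2; have pi0 : 0 < 2 * pi :> R by rewrite mulr_gt0// pi_gt0.
apply/eqP; rewrite eq_le plancherel_le//=.
rewrite -(@lee_pmul2l _ ((2 * pi)^-1)%:E) ?lte_fin ?invr_gt0//.
by rewrite muleA -EFinM mulVf ?gt_eqF// mul1e plancherel_ge.
Qed.

End PlancherelFull.

(** * The L2 norm *)

Section L2Tools.
Context {R : realType}.
Local Notation mu := (@lebesgue_measure R).
Implicit Types (f g : R -> R[i]).

Lemma cL2D f g : cLp 2%:E f -> cLp 2%:E g -> cLp 2%:E (f \+ g).
Proof.
move=> f2 g2; have gN : cLp 2%:E (fun x => - g x).
  have := cL2B cL2_0 g2; congr (cLp _ _).
  by apply/funext => x /=; rewrite sub0r.
have := cL2B f2 gN; congr (cLp _ _).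
by apply/funext => x /=; rewrite opprK.
Qed.

Lemma l2norm_sub0 f : l2norm (f \- (fun=> 0)) = l2norm f.
Proof. by apply: eq_l2norm => x /=; rewrite subr0. Qed.

Lemma l2normC f g : l2norm (f \- g) = l2norm (g \- f).
Proof. by apply: eq_l2norm => x /=; rewrite -normcN opprB. Qed.

Lemma l2norm_le_dist f g : cLp 2%:E f -> cLp 2%:E g ->
  l2norm f <= l2norm (f \- g) + l2norm g.
Proof.
move=> f2 g2; rewrite -(l2norm_sub0 f) -(l2norm_sub0 g).
exact: (l2norm_triangle f2 g2 cL2_0).
Qed.

Lemma l2norm_dist f g : cLp 2%:E f -> cLp 2%:E g ->
  `|l2norm f - l2norm g| <= l2norm (f \- g).
Proof.
move=> f2 g2; rewrite ler_norml; apply/andP; split.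
  by rewrite lerNl opprB lerBlDr l2normC; exact: l2norm_le_dist.
by rewrite lerBlDr; exact: l2norm_le_dist.
Qed.

Lemma le_l2norm f g : cmeasurable f -> cLp 2%:E g ->
  (forall x, normc (f x) <= normc (g x)) -> cLp 2%:E f /\ l2norm f <= l2norm g.
Proof.
move=> mf g2 fg.
have e : (energy f <= energy g)%E.
  apply: ge0_le_integral => //.
  - by move=> x _; rewrite lee_fin sqr_ge0.
  - exact: measurable_normc2.
  - by apply: measurable_normc2; case: g2.
  - by move=> x _; rewrite lee_fin lerXn2r ?nnegrE ?normc_ge0.
have f2 : cLp 2%:E f.
  by apply/cL2P; split=> //; apply: le_lt_trans e _; exact: ((cL2P g).1 g2).2.
split=> //; move: e; rewrite !energyE// lee_fin.
by rewrite ler_pXn2r// ?nnegrE ?l2norm_ge0.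
Qed.

Lemma cL2Z (c : R[i]) f : cLp 2%:E f -> cLp 2%:E (fun x => c * f x).
Proof.
move=> f2; have mf : cmeasurable (fun x => c * f x) by apply: cmeasurableZ; case: f2.
apply/cL2P; split=> //; rewrite /energy.
have [_ fe] := (cL2P f).1 f2.
rewrite (_ : (\int[mu]_x _)%E = ((normc c ^+ 2)%:E * energy f)%E).
  by rewrite lte_mul_pinfty// lee_fin sqr_ge0.
rewrite -ge0_integralZl//; last 3 first.
- by apply: measurable_normc2; case: f2.
- by move=> x _; rewrite lee_fin sqr_ge0.
- by rewrite lee_fin sqr_ge0.
by apply: eq_integral => x _; rewrite normcM exprMn EFinM.
Qed.

Lemma cL2_mul_bounded f (k : R -> R[i]) (N : R) : cLp 2%:E f -> cmeasurable k ->
  (forall x, normc (k x) <= N) ->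
  cLp 2%:E (f \* k) /\ l2norm (f \* k) <= N * l2norm f.
Proof.
move=> f2 mk kN; have N0 : 0 <= N by apply: le_trans (kN 0); exact: normc_ge0.
have NE : normc (N%:C : R[i]) = N by rewrite normc_real ger0_norm.
rewrite -[X in X * _]NE -l2normZ//; apply: le_l2norm; last 2 first.
- exact: cL2Z.
- by move=> x; rewrite !normcM NE mulrC ler_wpM2r ?normc_ge0.
by apply: cmeasurableM => //; case: f2.
Qed.

Lemma l2norm_cvg_cnorm (h_ : nat -> R -> R[i]) : (forall n, cLp 2%:E (h_ n)) ->
  (cnorm 2%:E (h_ n) @[n --> \oo] --> 0%E) <-> (l2norm (h_ n) @[n --> \oo] --> (0 : R)).
Proof.
move=> h2; split.
  by move=> /fine_cvg; exact: cvg_trans.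
move=> h; under eq_cvg do rewrite l2normE//.
by apply: cvg_EFin => //; exact: nearW.
Qed.

Lemma l2norm_cvg (f_ : nat -> R -> R[i]) f : (forall n, cLp 2%:E (f_ n)) -> cLp 2%:E f ->
  l2norm (f_ n \- f) @[n --> \oo] --> (0 : R) ->
  l2norm (f_ n) @[n --> \oo] --> l2norm f.
Proof.
move=> f2 g2 h; apply/cvgrPdist_le => e e0; move/cvgrPdist_le : h => /(_ e e0).
apply: filterS => n; rewrite sub0r normrN ger0_norm ?l2norm_ge0// => h.
by rewrite distrC; apply: le_trans h; exact: l2norm_dist.
Qed.

Lemma poweR_half_sqr (x : \bar R) : (0 <= x)%E -> ((x `^ 2^-1) ^+ 2 = x)%E.
Proof.
case: x => [r| |] //; last by rewrite poweRyr ?invr_eq0// expe2 mulyy.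
by rewrite lee_fin => r0; rewrite poweR_EFin powR12_sqrt// -EFin_expe sqr_sqrtr.
Qed.

(** With both integrals on the right allowed to be infinite, as they may be in
[young_energy], where the inner integral diverges at some points. *)
Lemma cauchy_schwarz_ereal (a b : R -> R) : measurable_fun setT a -> measurable_fun setT b ->
  (forall x, 0 <= a x) -> (forall x, 0 <= b x) ->
  ((\int[mu]_x (a x * b x)%:E) ^+ 2 <=
   (\int[mu]_x (a x ^+ 2)%:E) * \int[mu]_x (b x ^+ 2)%:E)%E.
Proof.
move=> ma mb a0 b0.
have := @hoelder _ _ _ mu a b 2 2 ma mb ltac:(by []) ltac:(by []).
rewrite -[_^-1]mul1r -splitr => /(_ erefl).
have N2 (c : R -> R) : (forall x, 0 <= c x) ->
    ('N[mu]_2%:E[EFin \o c] ^+ 2 = \int[mu]_x (c x ^+ 2)%:E)%E.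
  move=> c0; have i0 : (0 <= \int[mu]_x (c x ^+ 2)%:E)%E.
    by apply: integral_ge0 => x _; rewrite lee_fin sqr_ge0.
  have -> : 'N[mu]_2%:E[EFin \o c]%E = ((\int[mu]_x (c x ^+ 2)%:E) `^ 2^-1)%E.
    rewrite unlock /=; congr (_ `^ _)%E.
    by apply: eq_integral => x _; rewrite /= powR_mulrn// ger0_norm.
  exact: poweR_half_sqr.
rewrite Lnorm1 -(N2 a)// -(N2 b)// => h.
have ab0 : (0 <= \int[mu]_x (a x * b x)%:E)%E.
  by apply: integral_ge0 => x _; rewrite lee_fin mulr_ge0.
have E : (\int[mu]_x `|(EFin \o (a \* b)%R) x| = \int[mu]_x (a x * b x)%:E)%E.
  by apply: eq_integral => x _; rewrite /= ger0_norm// mulr_ge0.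
rewrite E in h; rewrite !expe2 [leRHS]muleACA.
by apply: lee_pmul.
Qed.

End L2Tools.

(** * Young's inequality *)

Section Young.
Context {R : realType}.
Local Notation mu := (@lebesgue_measure R).
Implicit Types (f g v : R -> R[i]).

(** Cauchy-Schwarz for the measure [|v (x - y)| dy], that is with the factor
[|v|] split into two square roots, then Tonelli. *)
Lemma young_energy f v : cLp 2%:E f -> cLp 1%:E v -> cLp 2%:E v ->
  (energy (convolution f v) <= ((\int[mu]_x normc (v x)) ^+ 2)%:E * energy f)%E.
Proof.
move=> f2 v1 v2; set N := \int[mu]_x normc (v x).
have [mf mv] := (f2.1, v2.1).
have mnf := cmeasurable_normc mf; have mnv := cmeasurable_normc mv.
have msq : measurable_fun setT (@Num.sqrt R).
  by apply: continuous_measurable_fun; exact: sqrt_continuous.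
have NE : (\int[mu]_x (normc (v x))%:E = N%:E)%E.
  by rewrite /N /Rintegral fineK// integrable_fin_num// cL1_normc.
have N0 : 0 <= N by rewrite Rintegral_ge0// => x _; exact: normc_ge0.
(* The kernel left after Cauchy-Schwarz in the inner integral. *)
pose k (z : R * R) := normc (f z.2) ^+ 2 * normc (v (z.1 - z.2)).
have mk : measurable_fun setT k.
  apply: measurable_funM.
    by apply: measurable_funX; exact: (measurableT_comp mnf measurable_snd).
  by apply: (measurableT_comp mnv); exact: measurable_funB.
have k0 z : 0 <= k z by rewrite mulr_ge0 ?sqr_ge0 ?normc_ge0.
have mvx x : measurable_fun setT (fun y : R => normc (v (x - y))).
  by apply: (measurableT_comp mnv); exact: measurable_funB.
have pt x : ((normc (convolution f v x) ^+ 2)%:E <= N%:E * \int[mu]_y (k (x, y))%:E)%E.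
  have i1 := conv_section x f2 v2.
  have h1 : ((normc (convolution f v x))%:E <= \int[mu]_y (normc (f y * v (x - y)))%:E)%E.
    have := normc_cint i1; rewrite -lee_fin /Rintegral fineK//.
    by apply: integrable_fin_num => //; exact: cL1_normc.
  have mvs : measurable_fun setT (fun y : R => Num.sqrt (normc (v (x - y)))).
    exact: (measurableT_comp msq (mvx x)).
  have h2 := @cauchy_schwarz_ereal _ (fun y => normc (f y) * Num.sqrt (normc (v (x - y))))
    (fun y => Num.sqrt (normc (v (x - y)))) (measurable_funM mnf mvs) mvs
    (fun y => mulr_ge0 (normc_ge0 _) (sqrtr_ge0 _)) (fun y => sqrtr_ge0 _).
  rewrite EFin_expe; apply: (@le_trans _ _ ((\int[mu]_y (normc (f y * v (x - y)))%:E) ^+ 2)%E).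
    rewrite lee_sqr//; first by rewrite lee_fin normc_ge0.
    by apply: integral_ge0 => y _; rewrite lee_fin normc_ge0.
  rewrite (_ : (\int[mu]_y (normc (f y * v (x - y)))%:E)%E =
     (\int[mu]_y (normc (f y) * Num.sqrt (normc (v (x - y))) *
        Num.sqrt (normc (v (x - y))))%:E)%E); last first.
    apply: eq_integral => y _; congr EFin.
    by rewrite normcM -mulrA -expr2 sqr_sqrtr// normc_ge0.
  apply: (le_trans h2); rewrite muleC le_eqVlt; apply/orP; left; apply/eqP.
  congr (_ * _)%E.
    rewrite -NE -(integral_reflect x (f := fun y => (normc (v y))%:E)); last exact/measurable_EFinP.
    by apply: eq_integral => y _; rewrite sqr_sqrtr// normc_ge0.
  by apply: eq_integral => y _; rewrite exprMn sqr_sqrtr ?normc_ge0.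
have mK := measurable_fubini_EFin mk k0.
apply: (@le_trans _ _ (\int[mu]_x (N%:E * \int[mu]_y (k (x, y))%:E))%E).
  apply: ge0_le_integral => //.
  - by move=> x _; rewrite lee_fin sqr_ge0.
  - by apply: measurable_normc2; exact: cmeasurable_conv.
  - exact: measurable_funeM.
have K0 x : (0 <= \int[mu]_y (k (x, y))%:E)%E.
  by apply: integral_ge0 => y _; rewrite lee_fin.
rewrite ge0_integralZl//.
rewrite (@fubini_tonelli _ _ _ _ _ mu mu (fun z => (k z)%:E)); last 2 first.
- exact/measurable_EFinP.
- by move=> z; rewrite lee_fin.
have E y : (\int[mu]_x (k (x, y))%:E = N%:E * (normc (f y) ^+ 2)%:E)%E.
  rewrite muleC -NE -(integral_translate (- y) (f := fun x => (normc (v x))%:E)); last exact/measurable_EFinP.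
  rewrite -ge0_integralZl//.
  - by apply/measurable_EFinP; apply: (measurableT_comp mnv); exact: measurable_funD.
  - by move=> x _; rewrite lee_fin normc_ge0.
  - by rewrite lee_fin sqr_ge0.
under eq_integral do rewrite E.
rewrite ge0_integralZl//; last 2 first.
- exact: measurable_normc2.
- by move=> x _; rewrite lee_fin sqr_ge0.
by rewrite muleA -EFinM -expr2.
Qed.

Lemma young f v : cLp 2%:E f -> cLp 1%:E v -> cLp 2%:E v ->
  cLp 2%:E (convolution f v) /\
  l2norm (convolution f v) <= (\int[mu]_x normc (v x)) * l2norm f.
Proof.
move=> f2 v1 v2; have e := young_energy f2 v1 v2; rewrite (energyE f2) -EFinM in e.
have N0 : 0 <= \int[mu]_x normc (v x) by rewrite Rintegral_ge0// => x _; exact: normc_ge0.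
have c2 : cLp 2%:E (convolution f v).
  apply/cL2P; split; last by apply: le_lt_trans e _; rewrite ltry.
  by apply: cmeasurable_conv; [case: f2|case: v2].
split=> //; move: e; rewrite energyE// lee_fin -exprMn.
by rewrite ler_pXn2r// ?nnegrE ?mulr_ge0 ?l2norm_ge0.
Qed.

End Young.

(** * Fourier transform on L2 *)

Section FourierL2.
Context {R : realType}.
Local Notation mu := (@lebesgue_measure R).
Implicit Types (f g v : R -> R[i]).

Lemma cL2_fourier f : cLp 1%:E f -> cLp 2%:E f -> cLp 2%:E (fourier f).
Proof.
move=> f1 f2; apply/cL2P; split; first by apply: cmeasurable_fourier; case: f1.
by rewrite plancherel// energyE// -EFinM ltry.
Qed.

Lemma l2norm_fourier f : cLp 1%:E f -> cLp 2%:E f ->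
  l2norm (fourier f) = Num.sqrt (2 * pi) * l2norm f.
Proof.
move=> f1 f2; have := plancherel f1 f2.
rewrite !energyE//; last exact: cL2_fourier.
have pi0 : 0 <= 2 * pi :> R by rewrite mulr_ge0// pi_ge0.
rewrite -EFinM => -[] h; apply/eqP; rewrite -(@eqrXn2 _ 2)// ?mulr_ge0 ?l2norm_ge0 ?sqrtr_ge0//.
by rewrite h exprMn sqr_sqrtr.
Qed.

(** The approximating sequences have finite norms, so convergence can be
stated with the real-valued norm. *)
Lemma is_fourierL2P f g : cLp 2%:E f -> is_fourierL2 f g <->
  cLp 2%:E g /\ exists u : nat -> R -> R[i],
    [/\ forall n, cLp 1%:E (u n) /\ cLp 2%:E (u n),
        l2norm (u n \- f) @[n --> \oo] --> (0 : R)
      & l2norm (fourier (u n) \- g) @[n --> \oo] --> (0 : R)].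
Proof.
move=> f2; split=> -[g2 [u [u12 uf ug]]]; split=> //; exists u; split=> //.
- by apply/l2norm_cvg_cnorm => // n; apply: cL2B => //; case: (u12 n).
- apply/l2norm_cvg_cnorm => // n; apply: cL2B => //.
  by apply: cL2_fourier; case: (u12 n).
- by apply/l2norm_cvg_cnorm => // n; apply: cL2B => //; case: (u12 n).
- apply/l2norm_cvg_cnorm => // n; apply: cL2B => //.
  by apply: cL2_fourier; case: (u12 n).
Qed.

Lemma plancherelL2 f g : cLp 2%:E f -> is_fourierL2 f g ->
  l2norm g = Num.sqrt (2 * pi) * l2norm f.
Proof.
move=> f2 /(is_fourierL2P _ f2)[g2 [u [u12 uf ug]]].
have hf := l2norm_cvg (fun n => (u12 n).2) f2 uf.
have hg := l2norm_cvg (fun n => cL2_fourier (u12 n).1 (u12 n).2) g2 ug.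
apply: (cvg_unique (@Rhausdorff R) hg).
rewrite (_ : (fun n => _) = (fun n => Num.sqrt (2 * pi) * l2norm (u n))).
  by apply: cvgM => //; exact: cvg_cst.
by apply/funext => n; rewrite l2norm_fourier//; case: (u12 n).
Qed.

Lemma is_fourierL2B f g f' g' : cLp 2%:E f -> cLp 2%:E f' ->
  is_fourierL2 f g -> is_fourierL2 f' g' -> is_fourierL2 (f \- f') (g \- g').
Proof.
move=> f2 f2' /(is_fourierL2P _ f2)[g2 [u [u12 uf ug]]].
move=> /(is_fourierL2P _ f2')[g2' [u' [u12' uf' ug']]].
apply/is_fourierL2P; first exact: cL2B.
split; first exact: cL2B.
have F n : cLp 2%:E (fourier (u n)) by apply: cL2_fourier; case: (u12 n).
have F' n : cLp 2%:E (fourier (u' n)) by apply: cL2_fourier; case: (u12' n).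
have sq (a_ b_ : nat -> R -> R[i]) (a b : R -> R[i]) :
    (forall n, cLp 2%:E (a_ n)) -> (forall n, cLp 2%:E (b_ n)) -> cLp 2%:E a -> cLp 2%:E b ->
    l2norm (a_ n \- a) @[n --> \oo] --> (0 : R) ->
    l2norm (b_ n \- b) @[n --> \oo] --> (0 : R) ->
    l2norm ((a_ n \- b_ n) \- (a \- b)) @[n --> \oo] --> (0 : R).
  move=> a_2 b_2 a2 b2 ha hb.
  apply: (@squeeze_cvgr _ _ _ _ (cst 0) (fun n => l2norm (a_ n \- a) + l2norm (b_ n \- b))).
  - apply: nearW => n; rewrite l2norm_ge0/=.
    have h := l2norm_triangle (cL2B (a_2 n) a2) cL2_0 (cL2B (b_2 n) b2).
    rewrite l2norm_sub0 (l2normC (fun=> 0)) l2norm_sub0 in h.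
    rewrite (_ : l2norm _ = l2norm ((a_ n \- a) \- (b_ n \- b)))//.
    by apply: eq_l2norm => x /=; congr normc; ring.
  - exact: cvg_cst.
  - by rewrite -[X in _ --> X](addr0 0); exact: cvgD.
exists (fun n => u n \- u' n); split.
- by move=> n; case: (u12 n) (u12' n) => ? ? [? ?]; split; [exact: cL1B|exact: cL2B].
- by apply: sq => // n; [case: (u12 n)|case: (u12' n)].
- rewrite (_ : (fun n => _) = (fun n => l2norm ((fourier (u n) \- fourier (u' n)) \- (g \- g')))).
    exact: sq.
  apply/funext => n; apply: eq_l2norm => w /=.
  by rewrite fourierB//; [case: (u12 n)|case: (u12' n)].
Qed.

(** The convolution theorem passes to the limit because convolution by [v] is
bounded on [L^2] by Young's inequality and multiplication by its bounded
transform is bounded as well. *)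
Lemma is_fourierL2_conv f g v : cLp 2%:E f -> cLp 1%:E v -> cLp 2%:E v ->
  is_fourierL2 f g -> is_fourierL2 (convolution f v) (g \* fourier v).
Proof.
move=> f2 v1 v2 /(is_fourierL2P _ f2)[g2 [u [u12 uf ug]]].
set N := \int[mu]_x normc (v x).
have vN w : normc (fourier v w) <= N by exact: fourier_bound.
have mF : cmeasurable (fourier v) by apply: cmeasurable_fourier; case: v1.
have F n : cLp 2%:E (fourier (u n)) by apply: cL2_fourier; case: (u12 n).
have [c2 _] := young f2 v1 v2.
apply/is_fourierL2P => //; split; first by have [] := cL2_mul_bounded g2 mF vN.
have N0c : (N * x @[x --> (0 : R)] --> (0 : R)).
  by rewrite -[X in _ --> X](mulr0 N); apply: cvgM; [exact: cvg_cst|exact: cvg_id].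
have sq (a_ b_ : nat -> R) : (forall n, 0 <= a_ n <= N * b_ n) ->
    b_ n @[n --> \oo] --> (0 : R) -> a_ n @[n --> \oo] --> (0 : R).
  move=> ab b0; apply: (@squeeze_cvgr _ _ _ _ (cst 0) (fun n => N * b_ n)).
  - exact: nearW.
  - exact: cvg_cst.
  - by rewrite -[X in _ --> X](mulr0 N); apply: cvgM => //; exact: cvg_cst.
exists (fun n => convolution (u n) v); split.
- by move=> n; case: (u12 n) => ? ?; split; [exact: cL1_conv|exact: cL2_conv].
- apply: sq uf => n; rewrite l2norm_ge0/=.
  have uf2 := cL2B (u12 n).2 f2.
  rewrite (_ : l2norm _ = l2norm (convolution (u n \- f) v)); first by case: (young uf2 v1 v2).
  by apply: eq_l2norm => x; rewrite (convB x (u12 n).2 f2 v2).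
- apply: sq ug => n; rewrite l2norm_ge0/=.
  rewrite (_ : l2norm _ = l2norm ((fourier (u n) \- g) \* fourier v)).
    by have [] := cL2_mul_bounded (cL2B (F n) g2) mF vN.
  apply: eq_l2norm => w /=; rewrite fourier_conv//; [|by case: (u12 n)|by case: (u12 n)].
  by rewrite mulrBl.
Qed.

End FourierL2.

(** * Completeness of L2 *)

Section Completeness.
Context {R : realType}.
Local Notation mu := (@lebesgue_measure R).
Implicit Types (f g : R -> R[i]).

Lemma geometric_cvg (z : nat -> R) (C : R) :
  (forall k, `|z k.+1 - z k| <= C * 2^-1 ^+ k) -> cvgn z.
Proof.
move=> zC.
have C0 : 0 <= C by have := zC 0%N; rewrite expr0 mulr1; apply: le_trans.
pose d k := z k.+1 - z k.
have cd : cvgn (series d).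
  apply: normed_cvg; apply: (@series_le_cvg _ _ (fun k => C * 2^-1 ^+ k)).
  - by move=> n; exact: normr_ge0.
  - by move=> n; rewrite mulr_ge0// exprn_ge0.
  - by move=> n; exact: zC.
  - apply: (is_cvg_geometric_series (a := C) (z := 2^-1)).
    by rewrite ger0_norm// invf_lt1// ltr1n.
have -> : z = (fun n => z 0%N + series d n).
  apply/funext => n; rewrite /series /= telescope_sumr// addrC subrK//.
by apply: is_cvgD => //; exact: is_cvg_cst.
Qed.

(** The rate [8^-1] leaves room, in [ae_cvg_subsequence], for a weight
[4^k] which makes the pointwise increments at most a constant times [2^-k]. *)
Lemma fast_subsequence (f_ : nat -> R -> R[i]) :
  (forall e, 0 < e -> exists N, forall n m, (N <= n)%N -> (N <= m)%N ->
     l2norm (f_ n \- f_ m) <= e) ->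
  exists s : nat -> nat, (forall k, (k <= s k)%N) /\
    forall k, l2norm (f_ (s k.+1) \- f_ (s k)) ^+ 2 <= 8^-1 ^+ k.
Proof.
move=> fC.
have /choice[Nk HN] : forall k, exists N, forall n m, (N <= n)%N -> (N <= m)%N ->
     l2norm (f_ n \- f_ m) <= 8^-1 ^+ k.
  by move=> k; apply: fC; rewrite exprn_gt0.
(* Past all the thresholds of index at most [k], so that consecutive terms [s k]
   and [s k.+1] are both past the threshold [Nk k]. *)
pose s k := (k + \max_(i < k.+1) Nk i)%N.
have sN k i : (i <= k)%N -> (Nk i <= s k)%N.
  move=> ik; apply: leq_trans (leq_addl _ _).
  exact: (@leq_bigmax_cond _ predT (fun i : 'I_k.+1 => Nk i) (Ordinal (ik : (i < k.+1)%N))).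
exists s; split; first by move=> k; exact: leq_addr.
move=> k; have h : l2norm (f_ (s k.+1) \- f_ (s k)) <= 8^-1 ^+ k.
  by apply: HN; apply: sN => //.
apply: le_trans (_ : 8^-1 ^+ k * 8^-1 ^+ k <= _).
  by rewrite expr2; apply: ler_pM => //; exact: l2norm_ge0.
rewrite ler_piMr ?exprn_ge0// exprn_ile1// invf_le1// ler1n//.
Qed.

(** The weighted sum [sum_k 4^k |f_(k+1) - f_k|^2] has a finite integral, so
it is finite almost everywhere; where it is finite, the increments are
dominated by a geometric series. *)
Lemma ae_cvg_subsequence (f_ : nat -> R -> R[i]) :
  (forall n, cLp 2%:E (f_ n)) ->
  (forall k, l2norm (f_ k.+1 \- f_ k) ^+ 2 <= 8^-1 ^+ k) ->
  exists2 f, cmeasurable f & {ae mu, forall x,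
    (fun k => complex.Re (f_ k x)) @ \oo --> complex.Re (f x) /\
    (fun k => complex.Im (f_ k x)) @ \oo --> complex.Im (f x)}.
Proof.
move=> f2 fs.
pose d k x : R := 4 ^+ k * normc (f_ k.+1 x - f_ k x) ^+ 2.
have d0 k x : 0 <= d k x by rewrite mulr_ge0 ?sqr_ge0 ?exprn_ge0.
have md k : measurable_fun setT (d k).
  apply: measurable_funM => //; apply: measurable_funX; apply: cmeasurable_normc.
  by apply: cmeasurableB; [case: (f2 k.+1)|case: (f2 k)].
have mdE k : measurable_fun setT (EFin \o d k) by exact/measurable_EFinP.
pose G x := (\sum_(0 <= k <oo) (d k x)%:E)%E.
have mG : measurable_fun setT G.
  by apply: (@ge0_emeasurable_sum _ _ _ setT (fun k => EFin \o d k) predT) => // k x _ _; rewrite lee_fin.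
have id k : (\int[mu]_x (d k x)%:E <= (2^-1 ^+ k)%:E)%E.
  have e2 := cL2B (f2 k.+1) (f2 k).
  rewrite (_ : (\int[mu]_x _)%E = ((4 ^+ k)%:E * energy (f_ k.+1 \- f_ k)%R)%E); last first.
    rewrite -ge0_integralZl//; last 2 first.
    - by apply: measurable_normc2; case: e2.
    - by move=> x _; rewrite lee_fin sqr_ge0.
  rewrite energyE// -EFinM lee_fin.
  apply: (@le_trans _ _ (4 ^+ k * 8^-1 ^+ k)); first by rewrite ler_wpM2l ?exprn_ge0.
  by rewrite -exprMn (_ : 4 * 8^-1 = 2^-1 :> R)//; lra.
have iG : (\int[mu]_x G x < +oo)%E.
  rewrite /G integral_nneseries//; last by move=> k x _; rewrite lee_fin.
  apply: (@le_lt_trans _ _ (\sum_(0 <= k <oo) (2^-1 ^+ k)%:E)%E).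
    apply: lee_nneseries => k.
      by move=> _ _; apply: integral_ge0 => x _; rewrite lee_fin.
    by move=> _; exact: id.
  have c : series (fun k => 2^-1 ^+ k : R) @ \oo --> (1 * (1 - 2^-1)^-1 : R).
    have := @cvg_geometric_series R 1 2^-1; rewrite ger0_norm// => h.
    have {h} := h _; rewrite invf_lt1// ltr1n => /(_ isT).
    apply: cvg_trans; apply: near_eq_cvg; apply: nearW => n.
    by apply: eq_bigr => i _; rewrite /geometric /= mul1r.
  rewrite (_ : (\sum_(0 <= k <oo) (2^-1 ^+ k)%:E)%E = (1 * (1 - 2^-1)^-1)%:E) ?ltry//.
  apply/cvg_lim => //; under eq_cvg do rewrite sumEFin.
  by apply: cvg_EFin; [exact: nearW|exact: c].
pose A := [set x | (G x < +oo)%E].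
have mA : measurable A.
  by have := emeasurable_fun_infty_o measurableT mG +oo%E; rewrite setTI.
have G0 x : (0 <= G x)%E by apply: nneseries_ge0 => k _ _; rewrite lee_fin.
have aeA : {ae mu, forall x, A x}.
  have iG' : mu.-integrable setT G.
    apply/integrableP; split=> //.
    by under eq_integral do rewrite gee0_abs//.
  have := integrable_ae measurableT iG'.
  apply: (@filterS _ _ (ae_filter_ringOfSetsType mu)) => x /(_ I).
  by rewrite ge0_fin_numE.
have cA x : A x -> exists C, forall k, normc (f_ k.+1 x - f_ k x) <= C * 2^-1 ^+ k.
  move=> Ax; exists (Num.sqrt (fine (G x))) => k.
  have dG : d k x <= fine (G x).
    rewrite -lee_fin fineK ?ge0_fin_numE//.
    rewrite /G (@nneseriesD1 _ (fun k => (d k x)%:E) k)//; last by move=> i; rewrite lee_fin.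
    by rewrite leeDl// nneseries_ge0// => i _ _; rewrite lee_fin.
  rewrite -(@ler_pXn2r _ 2)// ?nnegrE ?normc_ge0 ?mulr_ge0 ?sqrtr_ge0 ?exprn_ge0//.
  rewrite exprMn sqr_sqrtr ?fine_ge0// -exprM mulnC exprM.
  rewrite (_ : 2^-1 ^+ 2 = 4^-1 :> R); last by lra.
  by rewrite exprVn ler_pdivlMr ?exprn_gt0// mulrC.
(* Off [A] the sequence is replaced by [0], so that it converges everywhere and
   its limit is measurable. *)
pose F (c : R[i] -> R) k x : R := if x \in A then c (f_ k x) else 0.
have cvgF (c : R[i] -> R) : (forall z w, `|c z - c w| <= normc (z - w)) ->
    forall x, cvgn (fun k => F c k x).
  move=> cl x; rewrite /F; have [xA|xA] := boolP (x \in A); last exact: is_cvg_cst.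
  have [C HC] := cA x (set_mem xA); apply: (@geometric_cvg _ C) => k.
  exact: le_trans (cl _ _) (HC k).
have mF (c : R[i] -> R) k : measurable_fun setT (fun x => c (f_ k x)) ->
    measurable_fun setT (F c k).
  move=> mc; apply: measurable_fun_ifT => //.
  by apply: (measurable_fun_bool true); rewrite setTI (_ : _ @^-1` _ = A)//;
     apply/seteqP; split => x; [exact: set_mem|exact: mem_set].
have clR (z w : R[i]) : `|complex.Re z - complex.Re w| <= normc (z - w).
  by rewrite -ReB; exact: Re_le_normc.
have clI (z w : R[i]) : `|complex.Im z - complex.Im w| <= normc (z - w).
  by rewrite -ImB; exact: Im_le_normc.
pose Rl x := limn (fun k => F (@complex.Re R) k x); pose Il x := limn (fun k => F (@complex.Im R) k x).
exists (fun x => Rl x +i* Il x).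
  split => /=.
    apply: (measurable_fun_cvg (h := F (@complex.Re R))).
      by move=> k; apply: mF; case: (f2 k) => -[].
    by move=> x _; exact: (cvgF _ clR).
  apply: (measurable_fun_cvg (h := F (@complex.Im R))).
    by move=> k; apply: mF; case: (f2 k) => -[].
  by move=> x _; exact: (cvgF _ clI).
apply: (@filterS _ _ (ae_filter_ringOfSetsType mu)) aeA => x Ax.
have xA : x \in A by exact: mem_set.
have := cvgF _ clR x; have := cvgF _ clI x.
rewrite /Rl /Il /F xA => hI hR /=; split; [exact: hR|exact: hI].
Qed.

Lemma fatou_l2norm (f_ : nat -> R -> R[i]) f (K : R) : (forall n, cLp 2%:E (f_ n)) ->
  cmeasurable f -> 0 <= K ->
  {ae mu, forall x,
    (fun k => complex.Re (f_ k x)) @ \oo --> complex.Re (f x) /\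
    (fun k => complex.Im (f_ k x)) @ \oo --> complex.Im (f x)} ->
  (forall n, l2norm (f_ n) <= K) -> cLp 2%:E f /\ l2norm f <= K.
Proof.
move=> f2 mf K0 ff fK.
have e : (energy f <= (K ^+ 2)%:E)%E.
  apply: (@fatou_bound _ (fun n x => normc (f_ n x) ^+ 2)).
  - by move=> n; apply: measurable_funX; apply: cmeasurable_normc; case: (f2 n).
  - by move=> n x; exact: sqr_ge0.
  - by apply: measurable_funX; exact: cmeasurable_normc.
  - by move=> x; exact: sqr_ge0.
  - apply: (@filterS _ _ (ae_filter_ringOfSetsType mu)) ff => x [hR hI].
    rewrite normc2E; under eq_cvg do rewrite normc2E.
    apply: cvgD.
      by apply: (@cvg_continuous_comp _ (fun z => z ^+ 2)); [exact: exprn_continuous|exact: hR].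
    by apply: (@cvg_continuous_comp _ (fun z => z ^+ 2)); [exact: exprn_continuous|exact: hI].
  - move=> n; rewrite -/(energy _) energyE// lee_fin.
    by rewrite lerXn2r ?nnegrE ?l2norm_ge0.
have h : cLp 2%:E f by apply/cL2P; split=> //; apply: le_lt_trans e _; rewrite ltry.
split=> //; move: e; rewrite energyE// lee_fin.
by rewrite ler_pXn2r// ?nnegrE ?l2norm_ge0.
Qed.

(** Fatou's lemma applied to [f_n - f_(s k)] as [k] grows bounds the distance
from [f_n] to the almost everywhere limit. *)
Theorem cL2_complete (f_ : nat -> R -> R[i]) : (forall n, cLp 2%:E (f_ n)) ->
  (forall e, 0 < e -> exists N, forall n m, (N <= n)%N -> (N <= m)%N ->
     l2norm (f_ n \- f_ m) <= e) ->
  exists2 f, cLp 2%:E f & l2norm (f_ n \- f) @[n --> \oo] --> (0 : R).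
Proof.
move=> f2 fC; have [s [sk sf]] := fast_subsequence fC.
have [f mf ff] := ae_cvg_subsequence (fun k => f2 (s k)) sf.
have key e : 0 < e -> exists N, forall n, (N <= n)%N ->
    cLp 2%:E (f_ n \- f) /\ l2norm (f_ n \- f) <= e.
  move=> e0; have [N HN] := fC e e0; exists N => n Nn.
  apply: (@fatou_l2norm (fun k => f_ n \- f_ (s (k + N)%N))).
  - by move=> k; exact: cL2B.
  - by apply: cmeasurableB => //; case: (f2 n).
  - exact: ltW.
  - apply: (@filterS _ _ (ae_filter_ringOfSetsType mu)) ff => x [hR hI]; split.
      rewrite ReB; under eq_cvg do rewrite ReB.
      apply: cvgB; first exact: cvg_cst.
      by rewrite (cvg_shiftn N (fun k => complex.Re (f_ (s k) x))).
    rewrite ImB; under eq_cvg do rewrite ImB.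
    apply: cvgB; first exact: cvg_cst.
    by rewrite (cvg_shiftn N (fun k => complex.Im (f_ (s k) x))).
  - move=> k; apply: HN => //; apply: leq_trans (sk _); exact: leq_addl.
have fL : cLp 2%:E f.
  have [N /(_ N (leqnn N))[h _]] := key 1 ltr01.
  have := cL2B (f2 N) h; congr (cLp _ _); apply/funext => x /=; by rewrite opprB addrC subrK.
exists f => //; apply/cvgrPdist_le => e e0; have [N HN] := key e e0.
exists N => // n /= Nn; rewrite sub0r normrN ger0_norm ?l2norm_ge0//.
by case: (HN n Nn).
Qed.

End Completeness.

(** * Continuity of translations *)

Section Translation.
Context {R : realType}.
Local Notation mu := (@lebesgue_measure R).
Implicit Types (v : R -> R[i]).

Lemma l2norm_sqrt v : cLp 2%:E v -> l2norm v = Num.sqrt (\int[mu]_x (normc (v x) ^+ 2)).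
Proof.
move=> v2; rewrite /Rintegral -/(energy v) energyE//=.
by rewrite sqrtr_sqr ger0_norm// l2norm_ge0.
Qed.

Lemma l2norm_dct (h_ : nat -> R -> R[i]) (g : R -> R) :
  (forall n, cLp 2%:E (h_ n)) -> (forall x, normc (h_ n x) @[n --> \oo] --> (0 : R)) ->
  mu.-integrable setT (EFin \o g) -> (forall n x, normc (h_ n x) ^+ 2 <= g x) ->
  l2norm (h_ n) @[n --> \oo] --> (0 : R).
Proof.
move=> h2 h0 ig hg.
have c : \int[mu]_x (normc (h_ n x) ^+ 2) @[n --> \oo] --> \int[mu]_x (cst 0 x : R).
  apply: (Rintegral_dct (g := g)) => //.
  - by move=> n; apply: measurable_funX; apply: cmeasurable_normc; case: (h2 n).
  - move=> x; rewrite /cst /= -[X in _ --> X](expr0n R 2).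
    by apply: (@cvg_continuous_comp _ (fun z => z ^+ 2)) => //; exact: exprn_continuous.
  - by move=> n x; rewrite ger0_norm ?sqr_ge0.
have I0 : \int[mu]_x (cst 0 x : R) = 0 by rewrite /Rintegral integral0.
rewrite I0 in c.
rewrite (_ : (fun n => l2norm (h_ n)) =
    (fun n => Num.sqrt (\int[mu]_x (normc (h_ n x) ^+ 2)))); last first.
  by apply/funext => n; rewrite l2norm_sqrt.
rewrite -[X in _ --> X](@sqrtr0 R).
by apply: cvg_continuous_comp c; exact: sqrt_continuous.
Qed.

Lemma normc_expiB1 (t : R) : normc (expi t - 1 : R[i]) <= 2.
Proof.
apply: le_trans (le_normcD _ _) _.
by rewrite normcN normc_expi normc1 -(natrD R 1 1).
Qed.

(** On the Fourier side translation by [d] multiplies by [expi (- (w d))], so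
Plancherel's formula turns the claim into dominated convergence for
[|expi (- (w d)) - 1| |v^ w|]. *)
Lemma translate_cvg_seq v (d : nat -> R) : cLp 1%:E v -> cLp 2%:E v ->
  d n @[n --> \oo] --> (0 : R) ->
  l2norm ((fun x => v (x - d n)) \- v) @[n --> \oo] --> (0 : R).
Proof.
move=> v1 v2 d0.
have t1 n : cLp 1%:E (fun x => v (x - d n)) by exact: cL1_shift.
have t2 n : cLp 2%:E (fun x => v (x - d n)).
  have := cL2_affine (- d n) (_ : 1 != 0) v2; rewrite oner_eq0 => /(_ isT).
  by congr (cLp _ _); apply/funext => x; rewrite mul1r.
have pi0 : 0 < Num.sqrt (2 * pi) :> R by rewrite sqrtr_gt0 mulr_gt0// pi_gt0.
pose h n (w : R) : R[i] := (expi (- (w * d n)) - 1) * fourier v w.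
have F2 := cL2_fourier v1 v2.
have hE n : h n = fourier ((fun x => v (x - d n)) \- v).
  apply/funext => w; rewrite fourierB// fourier_translate//.
  by rewrite /h mulrBl mul1r.
have h2 n : cLp 2%:E (h n).
  by rewrite hE; apply: cL2_fourier; [exact: cL1B|exact: cL2B].
have E n : l2norm ((fun x => v (x - d n)) \- v) = (Num.sqrt (2 * pi))^-1 * l2norm (h n).
  rewrite hE l2norm_fourier; [|exact: cL1B|exact: cL2B].
  by rewrite mulrA mulVf ?mul1r// gt_eqF.
rewrite (_ : (fun n => _) = (fun n => (Num.sqrt (2 * pi))^-1 * l2norm (h n))); last first.
  by apply/funext => n; exact: E.
rewrite -[X in _ --> X](mulr0 (Num.sqrt (2 * pi))^-1).
apply: cvgM; first exact: cvg_cst.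
apply: (l2norm_dct (g := fun w => 2 ^+ 2 * normc (fourier v w) ^+ 2)) => //.
- move=> w; rewrite (_ : (fun n => _) =
      (fun n => normc (expi (- (w * d n)) - 1 : R[i]) * normc (fourier v w))); last first.
    by apply/funext => n; rewrite /h normcM.
  rewrite -[X in _ --> X](mul0r (normc (fourier v w))); apply: cvgMl.
  have cd : - (w * d n) @[n --> \oo] --> (0 : R).
    by rewrite -oppr0 -[X in _ --> - X](mulr0 w); apply: cvgN; apply: cvgM => //; exact: cvg_cst.
  apply: (@squeeze_cvgr _ _ _ _ (cst 0)
    (fun n => `|cos (- (w * d n)) - 1| + `|sin (- (w * d n))|)).
  + apply: nearW => n; apply/andP; split; first exact: normc_ge0.
    by have := normc_le (expi (- (w * d n)) - 1 : R[i]); rewrite /= subr0.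
  + exact: cvg_cst.
  + rewrite -[X in _ --> X](addr0 0); apply: cvgD.
      rewrite -[X in _ --> X](normr0 R); apply: cvg_norm.
      rewrite -[X in _ --> X](subrr 1); apply: cvgB; last exact: cvg_cst.
      by rewrite -[X in _ --> X](@cos0 R); apply: cvg_continuous_comp cd; exact: continuous_cos.
    rewrite -[X in _ --> X](normr0 R); apply: cvg_norm.
    by rewrite -[X in _ --> X](@sin0 R); apply: cvg_continuous_comp cd; exact: continuous_sin.
- exact/integrable_scale/(cL2_integrable F2).
- move=> n w; rewrite /h normcM exprMn ler_wpM2r ?sqr_ge0//.
  by rewrite lerXn2r ?nnegrE ?normc_ge0// normc_expiB1.
Qed.

Lemma translate_small v (e : R) : cLp 1%:E v -> cLp 2%:E v -> 0 < e ->
  exists2 r : R, 0 < r & forall d, `|d| < r -> l2norm ((fun x => v (x - d)) \- v) <= e.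
Proof.
move=> v1 v2 e0; apply: contrapT => H.
have /choice[d Hd] : forall n, exists d : R, `|d| < n.+1%:R^-1 /\
    e < l2norm ((fun x => v (x - d)) \- v).
  move=> n; apply: contrapT => /forallNP Hn; apply: H.
  exists n.+1%:R^-1; first by rewrite invr_gt0 ltr0n.
  by move=> d dn; rewrite leNgt; apply/negP => ed; apply: (Hn d).
have d0 : d n @[n --> \oo] --> (0 : R).
  apply: (@squeeze_cvgr _ _ _ _ (fun n => - n.+1%:R^-1) (fun n => n.+1%:R^-1)).
  - by apply: nearW => n; rewrite -ler_norml ltW//; case: (Hd n).
  - by rewrite -oppr0; apply: cvgN; exact: cvg_harmonic.
  - exact: cvg_harmonic.
have /cvgrPdist_lt/(_ e e0)[N _ HN] := translate_cvg_seq v1 v2 d0.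
have := HN N (leqnn N); rewrite /= sub0r normrN ger0_norm ?l2norm_ge0// => h.
by have [_] := Hd N; rewrite ltNge (ltW h).
Qed.

(** Cauchy-Schwarz, with the translation modulus of [v]: the same radius [r]
serves every [f] of a bounded set. *)
Lemma conv_equicontinuous v (e : R) : cLp 1%:E v -> cLp 2%:E v -> 0 < e ->
  exists2 r : R, 0 < r & forall f x y, cLp 2%:E f -> `|x - y| < r ->
    normc (convolution f v x - convolution f v y) <= e * l2norm f.
Proof.
move=> v1 v2 e0; have [r r0 Hr] := translate_small v1 v2 e0.
exists r => // f x y f2 xy.
rewrite -cintB; [|exact: conv_section..].
have k2 : cLp 2%:E ((fun z => v (x - z)) \- (fun z => v (y - z))).
  by apply: cL2B; exact: cL2_reflect.
rewrite (eq_cint (g := f \* ((fun z => v (x - z)) \- (fun z => v (y - z))))); last first.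
  by move=> z /=; rewrite mulrBr.
apply: (le_trans (cauchy_schwarz f2 k2)); rewrite mulrC ler_wpM2r ?l2norm_ge0//.
apply: le_trans (Hr (y - x) _); last by rewrite distrC.
have t2 : cLp 2%:E (fun z => v (z - (y - x))).
  have := cL2_affine (- (y - x)) (_ : 1 != 0) v2; rewrite oner_eq0 => /(_ isT).
  by congr (cLp _ _); apply/funext => z; rewrite mul1r.
(* The reflection [z |-> y - z] turns the translate of [v] into [v (x - z)]. *)
rewrite -(l2norm_reflect y (cL2B t2 v2).1) le_eqVlt; apply/orP; left; apply/eqP.
apply: eq_l2norm => z /=; congr (normc (v _ - _)); ring.
Qed.

End Translation.

(** * Frame inequalities *)

Section Frame.
Context {R : realType}.
Local Notation mu := (@lebesgue_measure R).

(** Enumerates the integers, so that sums of families indexed by [int] become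
series, for which monotone convergence and tail estimates are available. *)
Definition int_of_index (n : nat) : int := if odd n then Negz n./2 else Posz n./2.

Lemma int_of_index_bij : set_bij [set: nat] [set: int] int_of_index.
Proof.
split => //.
- move=> m n _ _; rewrite /int_of_index.
  case: ifP => om; case: ifP => on // -[h];
    by rewrite -[m]odd_double_half -[n]odd_double_half om on h.
- move=> [k|k] _.
    by exists k.*2 => //; rewrite /int_of_index odd_double doubleK.
  by exists k.*2.+1 => //; rewrite /int_of_index /= odd_double/= uphalf_double.
Qed.

Lemma esum_int (a : int -> \bar R) : (forall j, (0 <= a j)%E) ->
  \esum_(j in [set: int]) a j = (\sum_(0 <= n <oo) a (int_of_index n))%E.
Proof.
move=> a0; rewrite (reindex_esum _ _ _ _ int_of_index_bij) nneseries_esumT//.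
Qed.

(** Plancherel's formula gives
[|f * psi_j|^2 = (2 pi)^-1 int |g|^2 |psi_j^|^2]; after summing over [j] under the
integral, the Littlewood-Paley bounds apply where [w > 0], and [g] vanishes where
[w < 0]. *)
Lemma frame_bounds (psi_ : int -> R -> R[i]) (A B : R) (f g : R -> R[i]) :
  (forall j, cLp 1%:E (psi_ j) /\ cLp 2%:E (psi_ j)) -> 0 < A -> 0 < B ->
  {ae mu, forall w, 0 < w ->
     (A%:E <= \esum_(j in [set: int]) (normc (fourier (psi_ j) w) ^+ 2)%:E <= B%:E)%E} ->
  cLp 2%:E f -> is_fourierL2 f g -> {ae mu, forall w, w < 0 -> g w = 0} ->
  ((A * l2norm f ^+ 2)%:E <=
   \esum_(j in [set: int]) (l2norm (convolution f (psi_ j)) ^+ 2)%:E <=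
   (B * l2norm f ^+ 2)%:E)%E.
Proof.
move=> psi12 A0 B0 lp f2 fg gneg.
have g2 : cLp 2%:E g by case: fg.
have pi0 : 0 < 2 * pi :> R by rewrite mulr_gt0// pi_gt0.
pose Phi j w : R := normc (fourier (psi_ j) w) ^+ 2.
pose h j w : R := normc (g w) ^+ 2 * Phi j w.
have h0 j w : 0 <= h j w by rewrite mulr_ge0 ?sqr_ge0.
have mh j : measurable_fun setT (fun w => (h j w)%:E).
  apply/measurable_EFinP; apply: measurable_funM.
    by apply: measurable_funX; apply: cmeasurable_normc; case: g2.
  apply: measurable_funX; apply: cmeasurable_normc; apply: cmeasurable_fourier.
  by case: (psi12 j) => -[].
have E j : ((l2norm (convolution f (psi_ j)) ^+ 2)%:E =
    (2 * pi)^-1%:E * \int[mu]_w (h j w)%:E)%E.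
  have [p1 p2] := psi12 j.
  have [c2 _] := young f2 p1 p2.
  have cg := is_fourierL2_conv f2 p1 p2 fg.
  have gp2 : cLp 2%:E (g \* fourier (psi_ j)) by case: cg.
  have -> : (\int[mu]_w (h j w)%:E = energy (g \* fourier (psi_ j))%R)%E.
    by apply: eq_integral => w _; rewrite /h /Phi /= normcM exprMn.
  rewrite energyE// (plancherelL2 c2 cg) -EFinM; congr EFin.
  by rewrite exprMn sqr_sqrtr ?(ltW pi0)// mulrA mulVf ?mul1r// gt_eqF.
have h0E j w : (0 <= (h j w)%:E)%E by rewrite lee_fin.
rewrite esum_int; last by move=> j; rewrite lee_fin sqr_ge0.
under eq_eseriesr do rewrite E.
rewrite nneseriesZl; last by move=> n _; apply: integral_ge0.
rewrite -integral_nneseries//; last by move=> n; exact: (mh (int_of_index n)).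
pose S w := (\sum_(0 <= n <oo) (h (int_of_index n) w)%:E)%E.
rewrite (_ : (\int[_]_x _)%E = (\int[mu]_w S w)%E)//.
have S0 w : (0 <= S w)%E by apply: nneseries_ge0 => n _ _.
have mS : measurable_fun setT S.
  apply: (@ge0_emeasurable_sum _ _ _ setT (fun n w => (h (int_of_index n) w)%:E) predT) => //.
have SE w : S w = ((normc (g w) ^+ 2)%:E * \esum_(j in [set: int]) (Phi j w)%:E)%E.
  rewrite esum_int; last by move=> j; rewrite lee_fin sqr_ge0.
  rewrite -nneseriesZl; last by move=> n _; rewrite lee_fin sqr_ge0.
  by apply: eq_eseriesr => n _; rewrite -EFinM.
have bnd : {ae mu, forall w, [set: R] w ->
    ((A * normc (g w) ^+ 2)%:E <= S w)%E /\ (S w <= (B * normc (g w) ^+ 2)%:E)%E}.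
  have n0 : {ae mu, forall w : R, w != 0}.
    exists [set 0]; split => //; first exact: lebesgue_measure_set1.
    by move=> w /= /negP; rewrite negbK => /eqP.
  apply: (@filterS3 _ _ (ae_filter_ringOfSetsType mu)) lp gneg n0 => w lw gw w0 _.
  rewrite SE; have [wneg|wpos|w00] := ltgtP w 0; last by rewrite w00 eqxx in w0.
    by rewrite gw// normc0 expr0n/= !mulr0 mul0e.
  have /andP[l1 l2] := lw wpos.
  have gE0 : (0 <= (normc (g w) ^+ 2)%:E)%E by rewrite lee_fin sqr_ge0.
  split; first by rewrite [A * _]mulrC EFinM; exact: lee_wpmul2l.
  by rewrite [B * _]mulrC [leRHS]EFinM; exact: lee_wpmul2l.
have mg : measurable_fun setT (fun w => (normc (g w) ^+ 2)%:E).
  by apply: measurable_normc2; case: g2.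
have Ig (C : R) : 0 < C ->
   (\int[mu]_w (C * normc (g w) ^+ 2)%:E = (C * (2 * pi * l2norm f ^+ 2))%:E)%E.
  move=> C0; rewrite EFinM.
  under eq_integral do rewrite EFinM.
  rewrite ge0_integralZl//; last 2 first.
  - by move=> w _; rewrite lee_fin sqr_ge0.
  - by rewrite lee_fin ltW.
  congr (_ * _)%E; rewrite -/(energy g) energyE// (plancherelL2 f2 fg).
  by rewrite exprMn sqr_sqrtr ?(ltW pi0).
have mC (C : R) : measurable_fun setT (fun w => (C * normc (g w) ^+ 2)%:E).
  by apply/measurable_EFinP; apply: measurable_funM => //; apply/measurable_EFinP.
have pinv0 : (0 <= (2 * pi)^-1%:E :> \bar R)%E by rewrite lee_fin invr_ge0 ltW.
have norm C : (2 * pi)^-1 * (C * (2 * pi * l2norm f ^+ 2)) = C * l2norm f ^+ 2.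
  by rewrite mulrCA mulKf ?gt_eqF.
apply/andP; split.
- rewrite -norm EFinM; apply: lee_wpmul2l => //; rewrite -Ig//.
  apply: ae_ge0_le_integral => //.
  + by move=> w _; rewrite lee_fin mulr_ge0 ?sqr_ge0// ltW.
  + exact: (mC A).
  + by apply: (@filterS _ _ (ae_filter_ringOfSetsType mu)) bnd => w /[apply] -[].
- rewrite -norm EFinM; apply: lee_wpmul2l => //; rewrite -Ig//.
  apply: ae_ge0_le_integral => //.
  + by move=> w _; rewrite lee_fin mulr_ge0 ?sqr_ge0// ltW.
  + exact: (mC B).
  + by apply: (@filterS _ _ (ae_filter_ringOfSetsType mu)) bnd => w /[apply] -[].
Qed.

Lemma L2plusB (f f' : R -> R[i]) : L2plus f -> L2plus f' -> L2plus (f \- f').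
Proof.
move=> [f2 [g fg gn]] [f2' [g' fg' gn']]; split; first exact: cL2B.
exists (g \- g'); first exact: is_fourierL2B.
apply: (@filterS2 _ _ (ae_filter_ringOfSetsType mu)) gn gn' => w h h' w0 /=.
by rewrite h// h'// subrr.
Qed.

Lemma L2plus_frame (psi_ : int -> R -> R[i]) (A B : R) (f : R -> R[i]) :
  (forall j, cLp 1%:E (psi_ j) /\ cLp 2%:E (psi_ j)) -> 0 < A -> 0 < B ->
  {ae mu, forall w, 0 < w ->
     (A%:E <= \esum_(j in [set: int]) (normc (fourier (psi_ j) w) ^+ 2)%:E <= B%:E)%E} ->
  L2plus f ->
  ((A * l2norm f ^+ 2)%:E <=
   \esum_(j in [set: int]) (l2norm (convolution f (psi_ j)) ^+ 2)%:E <=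
   (B * l2norm f ^+ 2)%:E)%E.
Proof.
by move=> psi12 A0 B0 lp [f2 [g fg gn]]; exact: frame_bounds gn.
Qed.

End Frame.

(** * Closedness of the space of analytic signals *)

Section Closedness.
Context {R : realType}.
Local Notation mu := (@lebesgue_measure R).
Implicit Types (f g : R -> R[i]).

(** Used with [g_ n] the Fourier transform of [f_ n]. *)
Lemma l2norm_isometry_cauchy (f_ g_ : nat -> R -> R[i]) f (C : R) : 0 <= C ->
  (forall n, cLp 2%:E (f_ n)) -> cLp 2%:E f ->
  l2norm (f_ n \- f) @[n --> \oo] --> (0 : R) ->
  (forall n m, l2norm (g_ n \- g_ m) <= C * l2norm (f_ n \- f_ m)) ->
  forall e, 0 < e -> exists N, forall n m, (N <= n)%N -> (N <= m)%N ->
     l2norm (g_ n \- g_ m) <= e.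
Proof.
move=> C0 f2 fL ff gf e e0.
have C1 : 0 < C + 1 by rewrite ltr_wpDl.
have e2 : 0 < e / (C + 1) / 2 by rewrite !divr_gt0.
move/cvgrPdist_le : ff => /(_ _ e2)[N _ HN]; exists N => n m Nn Nm.
apply: (le_trans (gf n m)).
have {}HN k : (N <= k)%N -> l2norm (f_ k \- f) <= e / (C + 1) / 2.
  by move=> Nk; have := HN k Nk; rewrite /= sub0r normrN ger0_norm ?l2norm_ge0.
have h : l2norm (f_ n \- f_ m) <= e / (C + 1).
  apply: (le_trans (l2norm_triangle (f2 n) fL (f2 m))).
  by rewrite [leRHS]splitr; apply: lerD; [exact: HN|rewrite l2normC; exact: HN].
apply: (@le_trans _ _ ((C + 1) * (e / (C + 1)))).
  by apply: ler_pM => //; [exact: l2norm_ge0|rewrite lerDl].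
by rewrite mulrCA mulfV ?mulr1// gt_eqF.
Qed.

Lemma l2norm_diagonal (f_ u_ : nat -> R -> R[i]) f :
  (forall n, cLp 2%:E (f_ n)) -> (forall n, cLp 2%:E (u_ n)) -> cLp 2%:E f ->
  l2norm (f_ n \- f) @[n --> \oo] --> (0 : R) ->
  (forall n, l2norm (u_ n \- f_ n) <= n.+1%:R^-1) ->
  l2norm (u_ n \- f) @[n --> \oo] --> (0 : R).
Proof.
move=> f2 u2 fL ff uf.
apply: (@squeeze_cvgr _ _ _ _ (cst 0) (fun n => n.+1%:R^-1 + l2norm (f_ n \- f))).
- apply: nearW => n; rewrite l2norm_ge0/=.
  by apply: (le_trans (l2norm_triangle (u2 n) (f2 n) fL)); rewrite lerD2r.
- exact: cvg_cst.
- by rewrite -[X in _ --> X](addr0 0); apply: cvgD => //; exact: cvg_harmonic.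
Qed.

(** Transforms of the [f_ n] vanish for negative frequencies only almost
everywhere, and so does their limit; multiplying by this indicator gives a
version that vanishes everywhere there. *)
Let posind (w : R) : R[i] := if w < 0 then 0 else 1.

Let cmeasurable_posind : cmeasurable posind.
Proof.
have m0 : measurable_fun setT (fun w : R => w < 0).
  by apply: measurable_fun_ltr.
split.
  rewrite (_ : (fun x => _) = (fun w : R => if w < 0 then 0 else 1)).
    by apply: measurable_fun_ifT => //; exact: measurable_cst.
  by apply/funext => w; rewrite /posind; case: ifP.
rewrite (_ : (fun x => _) = (cst 0)); first exact: measurable_cst.
by apply/funext => w; rewrite /posind; case: ifP.
Qed.

(** The transforms of the [f_ n] form a Cauchy sequence by Plancherel's
formula; their limit vanishes for negative frequencies, and it is the transform
of [f] by a diagonal choice of approximants. *)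
Lemma L2plus_closed (f_ : nat -> R -> R[i]) f : (forall n, L2plus (f_ n)) -> cLp 2%:E f ->
  l2norm (f_ n \- f) @[n --> \oo] --> (0 : R) -> L2plus f.
Proof.
move=> fp fL ff.
have f2 n : cLp 2%:E (f_ n) by case: (fp n).
have /choice[g Hg] : forall n, exists g,
    is_fourierL2 (f_ n) g /\ {ae mu, forall w, w < 0 -> g w = 0}.
  by move=> n; case: (fp n) => _ [g ? ?]; exists g.
have g2 n : cLp 2%:E (g n) by case: (Hg n) => -[].
have s0 : 0 <= Num.sqrt (2 * pi) :> R by exact: sqrtr_ge0.
have gf n m : l2norm (g n \- g m) <= Num.sqrt (2 * pi) * l2norm (f_ n \- f_ m).
  rewrite le_eqVlt; apply/orP; left; apply/eqP; apply: plancherelL2; first exact: cL2B.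
  by apply: is_fourierL2B => //; [case: (Hg n)|case: (Hg m)].
have [g0 g02 gg0] := cL2_complete g2 (l2norm_isometry_cauchy s0 f2 fL ff gf).
have pos1 w : normc (posind w) <= 1.
  by rewrite /posind; case: ifP; rewrite ?normc0 ?normc1.
have [g'2 _] := cL2_mul_bounded g02 cmeasurable_posind pos1.
have gg' : l2norm (g n \- (g0 \* posind)) @[n --> \oo] --> (0 : R).
  apply: (@squeeze_cvgr _ _ _ _ (cst 0) (fun n => l2norm (g n \- g0))) => //; last exact: cvg_cst.
  apply: nearW => n; rewrite l2norm_ge0/=.
  have [h1 h2] := cL2_mul_bounded (cL2B (g2 n) g02) cmeasurable_posind pos1.
  rewrite mul1r in h2; apply: le_trans h2.
  rewrite le_eqVlt; apply/orP; left; apply/eqP; apply: l2norm_ae.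
  - by apply: cmeasurableB; [case: (g2 n)|case: g'2].
  - by case: h1.
  - case: (Hg n) => _; apply: (@filterS _ _ (ae_filter_ringOfSetsType mu)) => w gw /=.
    congr normc; rewrite mulrBl; congr (_ - _); rewrite /posind.
    by case: ifP => [/gw ->|_]; rewrite ?mul0r ?mulr1.
split=> //; exists (g0 \* posind); last first.
  by apply: aeW => w w0; rewrite /= /posind w0 mulr0.
apply/is_fourierL2P => //; split=> //.
(* Approximants within [1 / (n + 1)] on both sides of the transform. *)
have /choice[u Hu] : forall n, exists u, [/\ cLp 1%:E u, cLp 2%:E u,
    l2norm (u \- f_ n) <= n.+1%:R^-1 & l2norm (fourier u \- g n) <= n.+1%:R^-1].
  move=> n; have e0 : 0 < n.+1%:R^-1 :> R by rewrite invr_gt0 ltr0n.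
  have [/(is_fourierL2P _ (f2 n))[_ [u [u12 uf ug]]] _] := Hg n.
  move/cvgrPdist_le : uf => /(_ _ e0)[N1 _ H1].
  move/cvgrPdist_le : ug => /(_ _ e0)[N2 _ H2].
  exists (u (maxn N1 N2)).
  have := H1 (maxn N1 N2) (leq_maxl _ _); have := H2 (maxn N1 N2) (leq_maxr _ _).
  rewrite /= !sub0r !normrN !ger0_norm ?l2norm_ge0// => ? ?.
  by split => //; case: (u12 (maxn N1 N2)).
exists u; split.
- by move=> n; case: (Hu n).
- apply: (l2norm_diagonal f2) => //; by move=> n; case: (Hu n).
- apply: (l2norm_diagonal g2) => //.
  + by move=> n; case: (Hu n) => ? ? _ _; exact: cL2_fourier.
  + by move=> n; case: (Hu n).
Qed.

End Closedness.

(** * Pointwise convergent subsequences *)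

Section Subsequences.
Context {R : realType}.

(** The sequence [n |-> (v i n)_i] lives in a product of compact segments, and
has a cluster point by Tychonoff's theorem; fixing finitely many coordinates up
to an error gives a neighbourhood of it, whence the subsequence.  The indices
satisfy [k <= s k] but need not increase. *)
Lemma diagonal_subsequence (v : nat -> nat -> R) (b : nat -> R) :
  (forall i n, `|v i n| <= b i) ->
  exists s : nat -> nat, (forall k, (k <= s k)%N) /\ forall i, cvgn (fun k => v i (s k)).
Proof.
move=> vb.
have cK : compact [set f : prod_topology (fun _ : nat => R) | forall i, `[- b i, b i]%classic (f i)].
  apply: (@tychonoff nat (fun=> R) (fun i => `[- b i, b i]%classic)) => i.
  exact: segment_compact.
pose V n : prod_topology (fun _ : nat => R) := fun i => v i n.
have [l [_ cl]] : [set f : prod_topology (fun _ : nat => R) | forall i, `[- b i, b i]%classic (f i)] `&`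
    cluster (V @ \oo) !=set0.
  have PF : ProperFilter (V @ \oo) by exact: fmap_proper_filter.
  apply: (cK _ PF); exists 0%N => // n _ i.
  by rewrite /= in_itv/= -ler_norml; exact: vb.
have lF : Filter (nbhs l) by exact: nbhs_filter.
have nb k e : 0 < e -> nbhs l [set f : prod_topology (fun _ : nat => R) |
    forall i, (i < k)%N -> `|f i - l i| < e].
  move=> e0; elim: k => [|k IH].
    by apply: (@filterS _ _ lF setT); [move=> f _ i|exact: (@filterT _ _ lF)].
  have hk : nbhs l [set f : prod_topology (fun _ : nat => R) | `|f k - l k| < e].
    have := @proj_continuous nat (fun=> R) k l => /cvgrPdist_lt/(_ e e0).
    by apply: (@filterS _ _ lF) => f /=; rewrite distrC.
  apply: (@filterS2 _ _ lF) hk IH => f /= fk fi i.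
  by rewrite ltnS leq_eqVlt => /predU1P[->//|/fi].
have /choice[s Hs] : forall k, exists n, (k <= n)%N /\ forall i, (i < k)%N ->
    `|v i n - l i| < k.+1%:R^-1.
  move=> k.
  have Ak : (V @ \oo) [set f | exists2 n, (k <= n)%N & f = V n].
    by exists k => // n /= kn; exists n.
  have k0 : 0 < k.+1%:R^-1 :> R by rewrite invr_gt0 ltr0n.
  have [f [[n kn ->] /= Hf]] := cl _ _ Ak (nb k _ k0).
  by exists n.
exists s; split; first by move=> k; case: (Hs k).
move=> i; apply/cvg_ex; exists (l i); apply/cvgrPdist_lt => e e0.
near=> k; rewrite distrC; apply: (@lt_trans _ _ k.+1%:R^-1).
  case: (Hs k) => _; apply; near: k; exact: nbhs_infty_gt.
near: k; have := @cvg_harmonic R => /cvgrPdist_lt/(_ e e0).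
by apply: filterS => k; rewrite sub0r normrN ger0_norm// invr_ge0.
Unshelve. all: by end_near. Qed.

Lemma cauchy_seq_cvg (u : nat -> R) :
  (forall e, 0 < e -> exists N, forall n m, (N <= n)%N -> (N <= m)%N -> `|u n - u m| <= e) ->
  cvgn u.
Proof.
move=> uC; apply: cauchy_cvg; apply/cauchy_exP => e e0.
have e2 : 0 < e / 2 by rewrite divr_gt0.
have [N HN] := uC _ e2; exists (u N); exists N => // n /= Nn.
apply: (le_lt_trans (HN N n (leqnn _) Nn)).
by rewrite ltr_pdivrMr// ltr_pMr// ltr1n.
Qed.

(** Convergence at a rational point close to [x] gives the Cauchy property at
[x]. *)
Lemma equicontinuous_cvg (F : nat -> R -> R) (x : R) :
  (forall e, 0 < e -> exists2 r, 0 < r &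
     forall n y, `|x - y| < r -> `|F n x - F n y| <= e) ->
  (forall q : rat, cvgn (fun n => F n (ratr q))) -> cvgn (fun n => F n x).
Proof.
move=> FE Fq; apply: cauchy_seq_cvg => e e0.
have e3 : 0 < e / 3 by rewrite divr_gt0.
have [r r0 Hr] := FE _ e3.
have [q /= Hq] : exists q : rat, ratr q \in `]x - r, x + r[.
  by apply: rat_in_itvoo; rewrite ltrBlDr -addrA ltrDl addr_gt0.
have xq : `|x - ratr q| < r.
  move: Hq; rewrite in_itv/= => /andP[q1 q2].
  by rewrite ltr_distlC q1 q2.
have [N _ HN] : \forall n \near \oo, `|limn (fun n => F n (ratr q)) - F n (ratr q)| <= e / 3 / 2.
  by move/cvgrPdist_le : (Fq q); apply; rewrite divr_gt0.
exists N => n m Nn Nm.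
have h1 := Hr n _ xq; have h2 := Hr m _ xq.
have h3 := HN n Nn; have h4 := HN m Nm; rewrite /= in h3 h4.
set L := limn _ in h3 h4.
rewrite (_ : F n x - F m x = (F n x - F n (ratr q)) + ((F n (ratr q) - L) + (L - F m (ratr q)))
    + (F m (ratr q) - F m x)); last by ring.
apply: (le_trans (ler_normD _ _)).
have := ler_normD (F n x - F n (ratr q)) ((F n (ratr q) - L) + (L - F m (ratr q))).
have := ler_normD (F n (ratr q) - L) (L - F m (ratr q)).
rewrite distrC in h3; rewrite [ `|F m x - _|]distrC in h2.
set a := `|_ + _ + _|; lra.
Qed.

End Subsequences.

(** * Dominated convergence for families indexed by the integers *)

Section EsumInt.
Context {R : realType}.

(** A tail of the dominating series is small, and the finitely many remaining
terms tend to [0]. *)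
Lemma esum_dct (a_ : nat -> int -> R) (b : int -> R) :
  (forall k j, 0 <= a_ k j) -> (forall k j, a_ k j <= b j) ->
  (\esum_(j in [set: int]) (b j)%:E < +oo)%E ->
  (forall j, a_ k j @[k --> \oo] --> (0 : R)) ->
  forall e : R, 0 < e -> exists K, forall k, (K <= k)%N ->
    (\esum_(j in [set: int]) (a_ k j)%:E <= e%:E)%E.
Proof.
move=> a0 ab bS al e e0.
have b0 j : 0 <= b j by apply: le_trans (a0 0%N j) (ab 0%N j).
have b0E n : (0 <= (b (int_of_index n))%:E)%E by rewrite lee_fin.
have a0E k n : (0 <= (a_ k (int_of_index n))%:E)%E by rewrite lee_fin.
have e2 : 0 < e / 2 by rewrite divr_gt0.
rewrite esum_int in bS; last by move=> j; rewrite lee_fin.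
have tail := nneseries_tail_cvg bS (fun n _ => b0E n).
(* The tail beyond [N] costs at most [e / 2]. *)
have [N HN] : exists N, (\sum_(N <= n <oo) (b (int_of_index n))%:E <= (e / 2)%:E)%E.
  have /fine_cvgP[[N1 _ H1] /cvgrPdist_le/(_ _ e2)[N2 _ H2]] := tail.
  exists (maxn N1 N2).
  rewrite -(fineK (H1 (maxn N1 N2) (leq_maxl _ _))) lee_fin.
  apply: (le_trans (ler_norm _)).
  by have := H2 (maxn N1 N2) (leq_maxr _ _); rewrite /= sub0r normrN.
have fin (M : nat) (e' : R) : 0 < e' -> exists K, forall k, (K <= k)%N ->
    \sum_(0 <= n < M) a_ k (int_of_index n) <= e'.
  elim: M e' => [|M IH] e' e'0.
    by exists 0%N => k _; rewrite big_nil ltW.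
  have e'2 : 0 < e' / 2 by rewrite divr_gt0.
  have [K1 H1] := IH _ e'2.
  have /cvgrPdist_le/(_ _ e'2)[K2 _ H2] := al (int_of_index M).
  exists (maxn K1 K2) => k; rewrite geq_max => /andP[k1 k2].
  rewrite big_nat_recr//= [leRHS]splitr; apply: lerD; first exact: H1.
  by have := H2 k k2; rewrite /= sub0r normrN ger0_norm.
have [K HK] := fin N _ e2.
exists K => k Kk; rewrite esum_int; last by move=> j; rewrite lee_fin.
rewrite (nneseries_split 0 N)// add0n sumEFin [e]splitr EFinD.
apply: leeD; first by rewrite lee_fin HK.
apply: le_trans HN; apply: lee_nneseries => n //.
by move=> _; rewrite lee_fin.
Qed.

End EsumInt.

(** * The wavelet modulus *)

Section ModulusOperator.
Context {R : realType}.
Local Notation mu := (@lebesgue_measure R).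
Implicit Types (f g : R -> R[i]).

Lemma cint_ae f g : cmeasurable f -> cmeasurable g -> {ae mu, forall x, f x = g x} ->
  cint f = cint g.
Proof.
move=> [fr fi] [gr gi] fg; apply: complex_ext => /=; congr fine;
  apply: ae_eq_integral => //; try exact/measurable_EFinP.
  by apply: (@filterS _ _ (ae_filter_ringOfSetsType mu)) fg => x /= -> _.
by apply: (@filterS _ _ (ae_filter_ringOfSetsType mu)) fg => x /= -> _.
Qed.

(** Convolution is linear, and blind to null sets: constant phases factor
out. *)
Lemma conv_phase f g v (c : R[i]) x : cLp 2%:E f -> cLp 2%:E g -> cLp 2%:E v ->
  {ae mu, forall y, f y = c * g y} -> convolution f v x = c * convolution g v x.
Proof.
move=> f2 g2 v2 fg; rewrite -cintZ; last exact: conv_section.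
have vm : cmeasurable (fun y => v (x - y)) by case: (cL2_reflect x v2).
apply: cint_ae.
- by apply: cmeasurableM => //; case: f2.
- by apply: cmeasurableZ; apply: cmeasurableM => //; case: g2.
- apply: (@filterS _ _ (ae_filter_ringOfSetsType mu)) fg => y /= ->.
  by rewrite mulrA.
Qed.

Lemma normc_dist (a b : R[i]) : `|normc a - normc b| <= normc (a - b).
Proof.
rewrite ler_norml; apply/andP; split.
  rewrite lerNl opprB lerBlDr -[in leRHS]opprB normcN.
  by have := le_normcD (b - a) a; rewrite subrK.
by rewrite lerBlDr; have := le_normcD (a - b) b; rewrite subrK.
Qed.

Lemma l2normD f g : cLp 2%:E f -> cLp 2%:E g -> l2norm (f \+ g) <= l2norm f + l2norm g.
Proof.
move=> f2 g2; have gN : cLp 2%:E ((fun=> 0) \- g) by exact: cL2B cL2_0 g2.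
have := l2norm_triangle f2 cL2_0 gN.
rewrite l2norm_sub0 (_ : l2norm (f \- _) = l2norm (f \+ g)); last first.
  by apply: eq_l2norm => x /=; rewrite sub0r opprK.
by rewrite (_ : l2norm (_ \- _) = l2norm g)//; apply: eq_l2norm => x /=; rewrite !sub0r opprK.
Qed.

Lemma distL2Z_sqr (h k : int -> R -> R[i]) : L2Zfam h -> L2Zfam k ->
  (\esum_(j in [set: int]) (l2norm (h j \- k j) ^+ 2)%:E = (distL2Z h k ^+ 2)%:E)%E.
Proof.
move=> hZ kZ; have [_ S] := L2ZfamB hZ kZ.
rewrite /distL2Z sqr_sqrtr; last exact/fine_ge0/sumsq_ge0.
by rewrite fineK// ge0_fin_numE// sumsq_ge0.
Qed.

Lemma distL2Z_ge0 (h k : int -> R -> R[i]) : 0 <= distL2Z h k.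
Proof. exact: sqrtr_ge0. Qed.

Lemma le_of_sqr_EFin (x y : R) : 0 <= x -> 0 <= y -> ((x ^+ 2)%:E <= (y ^+ 2)%:E)%E -> x <= y.
Proof. by move=> x0 y0; rewrite lee_fin ler_pXn2r// ?nnegrE. Qed.

Section Fixed.
Variables (psi_ : int -> R -> R[i]) (A B : R).
Hypothesis psi12 : forall j, cLp 1%:E (psi_ j) /\ cLp 2%:E (psi_ j).
Hypothesis A0 : 0 < A.
Hypothesis B0 : 0 < B.
Hypothesis lp : {ae mu, forall w, 0 < w ->
     (A%:E <= \esum_(j in [set: int]) (normc (fourier (psi_ j) w) ^+ 2)%:E <= B%:E)%E}.

Let conv2 f j : cLp 2%:E f -> cLp 2%:E (convolution f (psi_ j)).
Proof. by move=> f2; have [] := young f2 (psi12 j).1 (psi12 j).2. Qed.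

Let W := wavelet_modulus psi_.

Let cL2_W f j : cLp 2%:E f -> cLp 2%:E (W f j).
Proof.
move=> f2; have [h _] : cLp 2%:E (W f j) /\ l2norm (W f j) <= l2norm (convolution f (psi_ j)).
  apply: le_l2norm; last 2 first.
  - exact: conv2.
  - by move=> x; rewrite normc_real ger0_norm// normc_ge0.
  by apply: cmeasurable_real; apply: cmeasurable_normc; case: (conv2 j f2).
exact: h.
Qed.

Let l2norm_W f j : l2norm (W f j) = l2norm (convolution f (psi_ j)).
Proof. by apply: eq_l2norm => x; rewrite normc_real ger0_norm// normc_ge0. Qed.

Lemma wavelet_modulus_L2Z f : L2plus f -> L2Zfam (wavelet_modulus psi_ f).
Proof.
move=> fp; split; first by move=> j; apply: cL2_W; case: fp.
have /andP[_] := L2plus_frame psi12 A0 B0 lp fp.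
rewrite -/W; under eq_esum do rewrite -l2norm_W.
by move=> /le_lt_trans; apply; rewrite ltry.
Qed.

Lemma wavelet_modulus_lower f : L2plus f ->
  Num.sqrt A * l2norm f <= distL2Z (wavelet_modulus psi_ f) (fun _ _ => 0).
Proof.
move=> fp; have /andP[lo _] := L2plus_frame psi12 A0 B0 lp fp.
apply: le_of_sqr_EFin; rewrite ?mulr_ge0 ?sqrtr_ge0 ?l2norm_ge0 ?distL2Z_ge0//.
rewrite exprMn sqr_sqrtr ?(ltW A0)//; apply: (le_trans lo).
rewrite -(distL2Z_sqr (wavelet_modulus_L2Z fp) L2Zfam0) le_eqVlt; apply/orP; left; apply/eqP.
by apply: eq_esum => j _; rewrite l2norm_sub0 -/W l2norm_W.
Qed.

(** [||a| - |b|| <= |a - b|] pointwise, and the upper frame bound for [f - g]. *)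
Lemma wavelet_modulus_lipschitz f g : L2plus f -> L2plus g ->
  distL2Z (wavelet_modulus psi_ f) (wavelet_modulus psi_ g) <= Num.sqrt B * l2norm (f \- g).
Proof.
move=> fp gp; have [f2 g2] := (fp.1, gp.1).
have /andP[_ hi] := L2plus_frame psi12 A0 B0 lp (L2plusB fp gp).
apply: le_of_sqr_EFin; rewrite ?mulr_ge0 ?sqrtr_ge0 ?l2norm_ge0 ?distL2Z_ge0//.
rewrite -(distL2Z_sqr (wavelet_modulus_L2Z fp) (wavelet_modulus_L2Z gp)).
rewrite exprMn sqr_sqrtr ?(ltW B0)//; apply: le_trans hi.
apply: le_esum => j _; rewrite lee_fin lerXn2r ?nnegrE ?l2norm_ge0//.
have v2 := (psi12 j).2.
have [] // := @le_l2norm _ (W f j \- W g j) (convolution (f \- g) (psi_ j)).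
- by apply: cmeasurableB; [case: (cL2_W j f2)|case: (cL2_W j g2)].
- by apply: conv2; exact: cL2B.
- move=> x; rewrite convB//.
  have -> : (W f j \- W g j) x =
      (normc (convolution f (psi_ j) x) - normc (convolution g (psi_ j) x))%:C.
    by rewrite rmorphB.
  by rewrite normc_real; exact: normc_dist.
Qed.

(** An Arzela-Ascoli argument: for each [j] the functions [f_ n * psi_j] are
bounded by [M |psi_j|] and equicontinuous, so a subsequence converging at all
rational points, for all [j] and for both real and imaginary parts, converges
everywhere. *)
Lemma conv_pointwise_subsequence (f_ : nat -> R -> R[i]) (M : R) :
  (forall n, cLp 2%:E (f_ n)) -> (forall n, l2norm (f_ n) <= M) ->
  exists s : nat -> nat, (forall k, (k <= s k)%N) /\ forall j x,
    cvgn (fun k => complex.Re (convolution (f_ (s k)) (psi_ j) x)) /\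
    cvgn (fun k => complex.Im (convolution (f_ (s k)) (psi_ j) x)).
Proof.
move=> f2 fM; have M0 : 0 <= M by apply: le_trans (fM 0%N); exact: l2norm_ge0.
pose part (b : bool) (z : R[i]) := if b then complex.Re z else complex.Im z.
have part_le b (z w : R[i]) : `|part b z - part b w| <= normc (z - w).
  by case: b; rewrite /part -?ReB -?ImB; [exact: Re_le_normc|exact: Im_le_normc].
have part_norm b (z : R[i]) : `|part b z| <= normc z.
  by case: b; [exact: Re_le_normc|exact: Im_le_normc].
(* Indices encode a part (real or imaginary), a wavelet and a rational point. *)
pose v (i n : nat) : R := 
  if @choice.unpickle (bool * int * rat)%type i is Some (b, j, q)
  then part b (convolution (f_ n) (psi_ j) (ratr q)) else 0.
pose bd (i : nat) : R := 
  if @choice.unpickle (bool * int * rat)%type i is Some (b, j, q)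
  then M * l2norm (psi_ j) else 0.
have vb i n : `|v i n| <= bd i.
  rewrite /v /bd; case: (choice.unpickle i) => [[[b j] q]|]; last by rewrite normr0.
  apply: (le_trans (part_norm _ _)).
  apply: (le_trans (conv_bounded _ (f2 n) (psi12 j).2)).
  by rewrite ler_wpM2r// l2norm_ge0.
have [s [sk sc]] := diagonal_subsequence vb.
exists s; split=> // j x.
have H b : cvgn (fun k => part b (convolution (f_ (s k)) (psi_ j) x)).
  apply: (equicontinuous_cvg (F := fun k y => part b (convolution (f_ (s k)) (psi_ j) y))).
    move=> e e0; have M1 : 0 < M + 1 by rewrite ltr_wpDl.
    have eM : 0 < e / (M + 1) by rewrite divr_gt0.
    have [r r0 Hr] := conv_equicontinuous (psi12 j).1 (psi12 j).2 eM.
    exists r => // n y xy; apply: (le_trans (part_le _ _ _)).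
    apply: (le_trans (Hr _ _ _ (f2 _) xy)).
    apply: (@le_trans _ _ (e / (M + 1) * (M + 1))); last by rewrite mulfVK// gt_eqF.
    by rewrite ler_wpM2l ?(ltW eM)// (le_trans (fM _))// lerDl.
  move=> q; have := sc (choice.pickle (b, j, q)); rewrite /v.
  by under eq_fun do rewrite choice.pickleK.
by split; [exact: (H true)|exact: (H false)].
Qed.

End Fixed.
End ModulusOperator.

(** * Compactness of sequences with convergent moduli *)

Section Compactness.
Context {R : realType}.
Local Notation mu := (@lebesgue_measure R).
Implicit Types (f g : R -> R[i]).

Lemma normc_cvg0 (u : nat -> R[i]) (z : R[i]) :
  (complex.Re (u k) @[k --> \oo] --> complex.Re z) ->
  (complex.Im (u k) @[k --> \oo] --> complex.Im z) ->
  normc (u k - z) @[k --> \oo] --> (0 : R).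
Proof.
move=> ur ui.
apply: (@squeeze_cvgr _ _ _ _ (cst 0)
  (fun k => `|complex.Re (u k) - complex.Re z| + `|complex.Im (u k) - complex.Im z|)).
- by apply: nearW => k; rewrite normc_ge0/= -ReB -ImB; exact: normc_le.
- exact: cvg_cst.
- rewrite -[X in _ --> X](addr0 0); apply: cvgD; rewrite -[X in _ --> X](normr0 R);
    apply: cvg_norm.
  + by rewrite -[X in _ --> X](subrr (complex.Re z)); apply: cvgB => //; exact: cvg_cst.
  + by rewrite -[X in _ --> X](subrr (complex.Im z)); apply: cvgB => //; exact: cvg_cst.
Qed.

Lemma cmeasurable_cvg (u : nat -> R -> R[i]) f : (forall k, cmeasurable (u k)) ->
  (forall x, complex.Re (u k x) @[k --> \oo] --> complex.Re (f x)) ->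
  (forall x, complex.Im (u k x) @[k --> \oo] --> complex.Im (f x)) -> cmeasurable f.
Proof.
move=> um ur ui; split.
  apply: (measurable_fun_cvg (h := fun k x => complex.Re (u k x))) => //.
  by move=> k; case: (um k).
apply: (measurable_fun_cvg (h := fun k x => complex.Im (u k x))) => //.
by move=> k; case: (um k).
Qed.

(** The part of [|c - F|] not accounted for by [||c| - h|].  When [c] tends to
[F] it tends to [0] while staying below [|h| + |F|], a bound which does not
depend on [c]: this is what allows dominated convergence although no square
integrable bound on the functions [c] is available. *)
Definition modulus_defect (c F h : R[i]) : R :=
  Num.max 0 (normc (c - F) - normc ((normc c)%:C - h)).

Lemma modulus_defect_ge0 c F h : 0 <= modulus_defect c F h.
Proof. by rewrite /modulus_defect le_max lexx. Qed.

Lemma modulus_defect_le c F h : modulus_defect c F h <= normc h + normc F.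
Proof.
rewrite /modulus_defect ge_max addr_ge0 ?normc_ge0//= lerBlDr.
apply: (le_trans (le_normcD _ _)); rewrite normcN.
have := le_normcD ((normc c)%:C - h) h; rewrite subrK normc_real ger0_norm ?normc_ge0//.
lra.
Qed.

Lemma modulus_defect_dist c F h : modulus_defect c F h <= normc (c - F).
Proof. by rewrite /modulus_defect ge_max normc_ge0 lerBlDr lerDl normc_ge0. Qed.

Lemma dist_modulus_defect c F h :
  normc (c - F) <= modulus_defect c F h + normc ((normc c)%:C - h).
Proof. by rewrite -lerBlDr /modulus_defect le_max lexx orbT. Qed.

Lemma normc_realD (x y : R) : 0 <= x -> 0 <= y -> normc (x%:C + y%:C : R[i]) = x + y.
Proof. by move=> x0 y0; rewrite -rmorphD normc_real ger0_norm// addr_ge0. Qed.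

Lemma cL2_real f : cLp 2%:E f -> cLp 2%:E (fun x => (normc (f x))%:C).
Proof.
move=> f2; have [] // := @le_l2norm _ (fun x => (normc (f x))%:C) f.
  by apply: cmeasurable_real; apply: cmeasurable_normc; case: f2.
by move=> x; rewrite normc_real ger0_norm// normc_ge0.
Qed.

Lemma modulus_defect_L2 c F h : cLp 2%:E c -> cLp 2%:E F -> cLp 2%:E h ->
  let d x := (modulus_defect (c x) (F x) (h x))%:C in
  cLp 2%:E d /\ l2norm d <= l2norm h + l2norm F.
Proof.
move=> c2 F2 h2 d.
have hF2 := cL2D (cL2_real h2) (cL2_real F2).
have [] := @le_l2norm _ d _ _ hF2 _.
- apply: cmeasurable_real; apply: measurable_maxr; first exact: measurable_cst.
  apply: measurable_funB; apply: cmeasurable_normc.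
    by case: (cL2B c2 F2).
  by case: (cL2B (cL2_real c2) h2).
- move=> x; rewrite normc_real ger0_norm ?modulus_defect_ge0//.
  rewrite [leRHS]normc_realD ?normc_ge0//.
  exact: modulus_defect_le.
- move=> d2 dl; split => //; apply: (le_trans dl).
  apply: (le_trans (l2normD (cL2_real h2) (cL2_real F2))).
  rewrite le_eqVlt; apply/orP; left; apply/eqP.
  by congr (_ + _); apply: eq_l2norm => x; rewrite normc_real ger0_norm// normc_ge0.
Qed.

Lemma l2norm_dist_modulus_defect c F h : cLp 2%:E c -> cLp 2%:E F -> cLp 2%:E h ->
  l2norm (c \- F) <= l2norm (fun x => (modulus_defect (c x) (F x) (h x))%:C) +
    l2norm ((fun x => (normc (c x))%:C) \- h).
Proof.
move=> c2 F2 h2; have [d2 _] := modulus_defect_L2 c2 F2 h2.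
have k2 := cL2_real (cL2B (cL2_real c2) h2).
have [] := @le_l2norm _ (c \- F) _ _ (cL2D d2 k2) _.
- by case: (cL2B c2 F2).
- move=> x; rewrite [leRHS]normc_realD ?modulus_defect_ge0 ?normc_ge0//.
  exact: dist_modulus_defect.
- move=> _ le1; apply: (le_trans le1); apply: (le_trans (l2normD d2 k2)).
  rewrite lerD2l le_eqVlt; apply/orP; left; apply/eqP.
  by apply: eq_l2norm => x; rewrite normc_real ger0_norm// normc_ge0.
Qed.

Lemma modulus_defect_cvg (c_ : nat -> R -> R[i]) F h :
  (forall k, cLp 2%:E (c_ k)) -> cLp 2%:E F -> cLp 2%:E h ->
  (forall x, normc (c_ k x - F x) @[k --> \oo] --> (0 : R)) ->
  l2norm (fun x => (modulus_defect (c_ k x) (F x) (h x))%:C) @[k --> \oo] --> (0 : R).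
Proof.
move=> c2 F2 h2 cF.
have hF2 := cL2D (cL2_real h2) (cL2_real F2).
apply: (l2norm_dct (g := fun x =>
  normc (((fun x => (normc (h x))%:C) \+ (fun x => (normc (F x))%:C)) x) ^+ 2)).
- by move=> k; have [] := modulus_defect_L2 (c2 k) F2 h2.
- move=> x; apply: (@squeeze_cvgr _ _ _ _ (cst 0) (fun k => normc (c_ k x - F x))) => //.
    apply: nearW => k; rewrite normc_ge0 normc_real ger0_norm ?modulus_defect_ge0//.
    exact: modulus_defect_dist.
  exact: cvg_cst.
- exact: cL2_integrable.
- move=> k x; rewrite lerXn2r ?nnegrE ?normc_ge0//.
  rewrite normc_real ger0_norm ?modulus_defect_ge0//.
  rewrite [leRHS]normc_realD ?normc_ge0//.
  exact: modulus_defect_le.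
Qed.

Section Fixed.
Variables (psi_ : int -> R -> R[i]) (A B : R).
Hypothesis psi12 : forall j, cLp 1%:E (psi_ j) /\ cLp 2%:E (psi_ j).
Hypothesis A0 : 0 < A.
Hypothesis B0 : 0 < B.
Hypothesis lp : {ae mu, forall w, 0 < w ->
     (A%:E <= \esum_(j in [set: int]) (normc (fourier (psi_ j) w) ^+ 2)%:E <= B%:E)%E}.

Let conv2 f j : cLp 2%:E f -> cLp 2%:E (convolution f (psi_ j)).
Proof. by move=> f2; have [] := young f2 (psi12 j).1 (psi12 j).2. Qed.

(** The limits [F j] of the convolutions are first found pointwise; the defects
then give convergence in [L^2], for each [j] and summed over [j]; the lower
frame bound transfers the Cauchy property to the functions themselves. *)
Lemma wavelet_modulus_compact (f_ : nat -> R -> R[i]) h :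
  (forall n, L2plus (f_ n)) -> L2Zfam h ->
  (forall n, distL2Z (wavelet_modulus psi_ (f_ n)) h <= n.+1%:R^-1) ->
  exists f, [/\ L2plus f, distL2Z (wavelet_modulus psi_ f) h = 0 &
    forall e : R, 0 < e -> exists n, l2norm (f_ n \- f) <= e].
Proof.
move=> fp hZ fh.
have f2 n : cLp 2%:E (f_ n) by case: (fp n).
have h2 j : cLp 2%:E (h j) by case: hZ.
have WZ n := wavelet_modulus_L2Z psi12 A0 B0 lp (fp n).
have sA : 0 < Num.sqrt A by rewrite sqrtr_gt0.
(* The distances to [h] are at most [1], so the moduli have norm at most [1 +
   |h|]; the lower frame bound divides by [sqrt A]. *)
pose M := (1 + distL2Z h (fun _ _ => 0)) / Num.sqrt A.
have fM n : l2norm (f_ n) <= M.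
  rewrite ler_pdivlMr// mulrC.
  apply: (le_trans (wavelet_modulus_lower psi12 A0 B0 lp (fp n))).
  apply: (le_trans (distL2Z_triangle (WZ n) hZ L2Zfam0)); rewrite lerD2r.
  by apply: (le_trans (fh n)); rewrite invf_le1 ?ltr0n// ler1n.
have [s [ks sc]] := conv_pointwise_subsequence psi12 f2 fM.
pose c k j := convolution (f_ (s k)) (psi_ j).
have c2 k j : cLp 2%:E (c k j) by exact: conv2.
pose F j x : R[i] := limn (fun k => complex.Re (c k j x)) +i* limn (fun k => complex.Im (c k j x)).
have cFr j x : complex.Re (c k j x) @[k --> \oo] --> complex.Re (F j x) by exact: (sc j x).1.
have cFi j x : complex.Im (c k j x) @[k --> \oo] --> complex.Im (F j x) by exact: (sc j x).2.
have cF j x : normc (c k j x - F j x) @[k --> \oo] --> (0 : R) by exact: normc_cvg0.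
have Fm j : cmeasurable (F j).
  by apply: (cmeasurable_cvg (u := fun k => c k j)) => // k; case: (c2 k j).
have fsh k : distL2Z (wavelet_modulus psi_ (f_ (s k))) h <= k.+1%:R^-1.
  by apply: (le_trans (fh _)); rewrite lef_pV2 ?posrE ?ltr0n// ler_nat ltnS.

have layer k j : l2norm (wavelet_modulus psi_ (f_ (s k)) j \- h j) <= k.+1%:R^-1.
  apply: le_trans (fsh k); apply: le_of_sqr_EFin; rewrite ?l2norm_ge0 ?distL2Z_ge0//.
  rewrite -(distL2Z_sqr (WZ _) hZ); apply: esum_ge; exists [set j]; first by split.
  by rewrite fsbig_set1.
have cW k j : l2norm (c k j) = l2norm (wavelet_modulus psi_ (f_ (s k)) j).
  by apply: eq_l2norm => x; rewrite normc_real ger0_norm// normc_ge0.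
have F2h j : cLp 2%:E (F j) /\ l2norm (F j) <= l2norm (h j).
  (* Fatou's lemma along a tail of the sequence, where the norms are at most [|h
     j| + e]. *)
  have H (e : R) : 0 < e -> cLp 2%:E (F j) /\ l2norm (F j) <= l2norm (h j) + e.
    move=> e0; have [N _ HN] : \forall k \near \oo, (k.+1%:R^-1 : R) <= e.
      have := @cvg_harmonic R => /cvgrPdist_le/(_ e e0).
      by apply: filterS => k; rewrite sub0r normrN ger0_norm// invr_ge0.
    apply: (fatou_l2norm (f_ := fun k => c (k + N)%N j)) => //.
    - by rewrite addr_ge0 ?l2norm_ge0// ltW.
    - apply: aeW => x; split.
        by rewrite (cvg_shiftn N (fun k => complex.Re (c k j x))).
      by rewrite (cvg_shiftn N (fun k => complex.Im (c k j x))).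
    - move=> k; rewrite cW.
      have W2 : cLp 2%:E (wavelet_modulus psi_ (f_ (s (k + N))) j) by case: (WZ (s (k + N)%N)).
      apply: (le_trans (l2norm_le_dist W2 (h2 j))).
      by rewrite addrC lerD2l; apply: (le_trans (layer _ _)); apply: HN; rewrite /= leq_addl.
  split; first by case: (H 1 ltr01).
  by apply/ler_addgt0Pr => e e0; case: (H e e0).
have F2 j : cLp 2%:E (F j) by case: (F2h j).
pose d k j x : R[i] := (modulus_defect (c k j x) (F j x) (h j x))%:C.
have d2 k j : cLp 2%:E (d k j) by case: (modulus_defect_L2 (c2 k j) (F2 j) (h2 j)).
have dh k j : l2norm (d k j) <= 2 * l2norm (h j).
  case: (modulus_defect_L2 (c2 k j) (F2 j) (h2 j)) => _ /le_trans; apply.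
  by rewrite mulr_natl mulr2n lerD2l; case: (F2h j).
have d0 j : l2norm (d k j) @[k --> \oo] --> (0 : R) by exact: modulus_defect_cvg.
have sumd (e : R) : 0 < e -> exists K, forall k, (K <= k)%N ->
    (\esum_(j in [set: int]) (l2norm (d k j) ^+ 2)%:E <= e%:E)%E.
  (* Since [|F j| <= |h j|], the norm of each defect is at most twice that of [h
     j], a square summable bound. *)
  apply: (esum_dct (b := fun j => (2 * l2norm (h j)) ^+ 2)).
  - by move=> k j; exact: sqr_ge0.
  - by move=> k j; rewrite lerXn2r ?nnegrE ?mulr_ge0 ?l2norm_ge0.
  - have [_ hS] := hZ.
    have [] // := sumsq_triangle (fun j => l2norm_ge0 (h j)) (fun j => l2norm_ge0 (h j))
      (fun j => mulr_ge0 (ler0n R 2) (l2norm_ge0 (h j))) _ hS hS.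
    by move=> j; rewrite mulr_natl mulr2n.
  - move=> j; rewrite -[X in _ --> X](expr0n R 2).
    by apply: (@cvg_continuous_comp _ (fun z => z ^+ 2)) => //; exact: exprn_continuous.
pose S (u : int -> R) := Num.sqrt (fine (\esum_(j in [set: int]) (u j ^+ 2)%:E)%E).
have cFS (e : R) : 0 < e -> exists K, forall k, (K <= k)%N ->
    (\esum_(j in [set: int]) (l2norm (c k j \- F j) ^+ 2)%:E < +oo)%E /\
    S (fun j => l2norm (c k j \- F j)) <= e.
  move=> e0; have e2 : 0 < e / 2 by rewrite divr_gt0.
  have [K1 H1] := sumd ((e / 2) ^+ 2) (exprn_gt0 _ e2).
  have [K2 _ H2] : \forall k \near \oo, (k.+1%:R^-1 : R) <= e / 2.
    have := @cvg_harmonic R => /cvgrPdist_le/(_ _ e2).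
    by apply: filterS => k; rewrite sub0r normrN ger0_norm// invr_ge0.
  exists (maxn K1 K2) => k; rewrite geq_max => /andP[k1 k2].
  have [_ Wh] := L2ZfamB (WZ (s k)) hZ.
  have dS : (\esum_(j in [set: int]) (l2norm (d k j) ^+ 2)%:E < +oo)%E.
    by apply: (le_lt_trans (H1 k k1)); rewrite ltry.
  have [] := sumsq_triangle (fun j => l2norm_ge0 (d k j)) (fun j => l2norm_ge0 _)
    (fun j => l2norm_ge0 (c k j \- F j)) _ dS Wh.
    move=> j; exact: (l2norm_dist_modulus_defect (c2 k j) (F2 j) (h2 j)).
  move=> ? le2; split => //; apply: (le_trans le2).
  rewrite [leRHS]splitr; apply: lerD; last first.
    by apply: (le_trans (fsh k)); exact: H2.
  rewrite -(ger0_norm (ltW e2)) -sqrtr_sqr ler_sqrt ?sqr_ge0//.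
  by rewrite -lee_fin fineK ?H1// ge0_fin_numE// sumsq_ge0.
have fC (e : R) : 0 < e -> exists N, forall n m, (N <= n)%N -> (N <= m)%N ->
    l2norm (f_ (s n) \- f_ (s m)) <= e.
  move=> e0; have e2 : 0 < Num.sqrt A * e / 2 by rewrite divr_gt0// mulr_gt0.
  have [N HN] := cFS _ e2; exists N => n m Nn Nm.
  have [Sn en] := HN n Nn; have [Sm em] := HN m Nm.
  have [] := sumsq_triangle (fun j => l2norm_ge0 (c n j \- F j))
    (fun j => l2norm_ge0 (c m j \- F j)) (fun j => l2norm_ge0 (c n j \- c m j)) _ Sn Sm.
    move=> j; rewrite [l2norm (c m j \- _)]l2normC; exact: l2norm_triangle.
  move=> Snm le2.
  have /andP[lo _] := L2plus_frame psi12 A0 B0 lp (L2plusB (fp (s n)) (fp (s m))).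
  rewrite -(ler_pM2l sA).
  apply: (@le_trans _ _ (S (fun j => l2norm (c n j \- c m j)))); last first.
    by rewrite (splitr (Num.sqrt A * e)); exact: (le_trans le2 (lerD en em)).
  apply: le_of_sqr_EFin; rewrite ?mulr_ge0 ?sqrtr_ge0 ?l2norm_ge0//.
  rewrite exprMn sqr_sqrtr ?(ltW A0)// sqr_sqrtr; last exact/fine_ge0/sumsq_ge0.
  rewrite fineK ?ge0_fin_numE ?sumsq_ge0//; apply: (le_trans lo).
  rewrite le_eqVlt; apply/orP; left; apply/eqP; apply: eq_esum => j _.
  congr (_ ^+ 2)%:E; apply: eq_l2norm => x; rewrite convB//; by case: (psi12 j).
have [f fL ff] := cL2_complete (fun k => f2 (s k)) fC.
have fplus : L2plus f by exact: (L2plus_closed (fun k => fp (s k))).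
have WfZ := wavelet_modulus_L2Z psi12 A0 B0 lp fplus.
exists f; split => //; last first.
  move=> e e0; move/cvgrPdist_le : ff => /(_ e e0)[N _ HN]; exists (s N).
  by have := HN N (leqnn N); rewrite /= sub0r normrN ger0_norm ?l2norm_ge0.
apply/eqP; rewrite eq_le distL2Z_ge0 andbT; apply/ler_addgt0Pr => e e0; rewrite add0r.
have sB : 0 < Num.sqrt B by rewrite sqrtr_gt0.
have e2 : 0 < e / 2 by rewrite divr_gt0.
(* Half of [e] is spent on the Lipschitz bound, half on the distance to [h]. *)
have e3 : 0 < e / 2 / Num.sqrt B by rewrite divr_gt0.
have [N1 _ H1] : \forall k \near \oo, (k.+1%:R^-1 : R) <= e / 2.
  have := @cvg_harmonic R => /cvgrPdist_le/(_ _ e2).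
  by apply: filterS => k; rewrite sub0r normrN ger0_norm// invr_ge0.
move/cvgrPdist_le : ff => /(_ _ e3)[N2 _ H2].
set k := maxn N1 N2.
apply: (le_trans (distL2Z_triangle WfZ (WZ (s k)) hZ)).
rewrite [leRHS]splitr; apply: lerD.
  apply: (le_trans (wavelet_modulus_lipschitz psi12 A0 B0 lp fplus (fp (s k)))).
  rewrite mulrC -ler_pdivlMr// l2normC.
  by have := H2 k (leq_maxr _ _); rewrite /= sub0r normrN ger0_norm ?l2norm_ge0.
by apply: (le_trans (fsh k)); apply: H1; exact: leq_maxl.
Qed.

End Fixed.
End Compactness.

(** * The operator on classes modulo phase *)

Section Quotient.
Context {R : realType}.
Local Notation mu := (@lebesgue_measure R).
Variables (psi_ : int -> R -> R[i]) (A B : R).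
Hypothesis psi12 : forall j, cLp 1%:E (psi_ j) /\ cLp 2%:E (psi_ j).
Hypothesis A0 : 0 < A.
Hypothesis B0 : 0 < B.
Hypothesis lp : {ae mu, forall w, 0 < w ->
     (A%:E <= \esum_(j in [set: int]) (normc (fourier (psi_ j) w) ^+ 2)%:E <= B%:E)%E}.

Let U : L2plusS1 R -> L2Z R := wavelet_modulus_op psi_.

(** Representatives of one class differ by a constant phase almost everywhere,
which convolution turns into a constant phase everywhere. *)
Lemma wavelet_modulus_phase (f g : @L2plus R) : f = g %[mod L2plusS1 R] ->
  forall j x, wavelet_modulus psi_ (val f) j x = wavelet_modulus psi_ (val g) j x.
Proof.
move=> /eqmodP/asboolP[t fg] j x; rewrite /wavelet_modulus.
rewrite (conv_phase x (L2plus_L2 f) (L2plus_L2 g) (psi12 j).2 fg).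
by rewrite normcM normc_expi mul1r.
Qed.

Lemma wavelet_modulus_op_pi (f : @L2plus R) : exists h : @L2Zfam R,
  val h = wavelet_modulus psi_ (val f) /\ U (\pi_(L2plusS1 R) f) = \pi_(L2Z R) h.
Proof.
have fp : L2plus (val f) by exact: set_mem (valP f).
have hZ := wavelet_modulus_L2Z psi12 A0 B0 lp fp.
exists (SigSub (mem_set hZ)); split => //.
rewrite /U /wavelet_modulus_op; congr (\pi _); apply: val_inj.
have E : wavelet_modulus psi_ (val (repr (\pi_(L2plusS1 R) f))) = wavelet_modulus psi_ (val f).
  by apply/funext => j; apply/funext => x; apply: wavelet_modulus_phase; rewrite reprK.
by rewrite E val_insubd mem_set.
Qed.

Lemma wavelet_modulus_op_repr (f : @L2plus R) (j : int) :
  {ae mu, forall x, val (repr (U (\pi_(L2plusS1 R) f))) j x =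
    (normc (convolution (val f) (psi_ j) x))%:C}.
Proof.
have [h [hE ->]] := wavelet_modulus_op_pi f.
have /eqmodP/asboolP/(_ j) : repr (\pi_(L2Z R) h) = h %[mod L2Z R] by rewrite reprK.
by rewrite hE.
Qed.

(** Representatives of the classes at distance [mdist] need not be close, but
the phase [1] already bounds that distance by the norm of the difference. *)
Lemma wavelet_modulus_op_compact (F : nat -> L2plusS1 R) (H : L2Z R) :
  (forall n, mdist (U (F n)) H <= n.+1%:R^-1) ->
  exists2 G, U G = H & forall e : R, 0 < e -> exists n, mdist (F n) G <= e.
Proof.
move=> FH; pose f n := val (repr (F n)).
have fp n : L2plus (f n) by exact: set_mem (valP (repr (F n))).
have FE n : F n = \pi_(L2plusS1 R) (repr (F n)) by rewrite reprK.
have HE : H = \pi_(L2Z R) (repr H) by rewrite reprK.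
have fh n : distL2Z (wavelet_modulus psi_ (f n)) (val (repr H)) <= n.+1%:R^-1.
  apply: le_trans (FH n); rewrite (FE n).
  have [k [kE ->]] := wavelet_modulus_op_pi (repr (F n)).
  by rewrite -kE [in leRHS]HE mdist_L2Z.
have [g [gp gH fg]] := wavelet_modulus_compact psi12 A0 B0 lp fp (L2Z_fam (repr H)) fh.
pose g' : @L2plus R := SigSub (mem_set gp).
exists (\pi_(L2plusS1 R) g').
  have [k [kE ->]] := wavelet_modulus_op_pi g'.
  rewrite HE; apply: mdistL2Z_positivity; rewrite -[RHS]gH.
  by have := mdist_L2Z k (repr H); rewrite kE.
move=> e /fg[n fgn]; exists n; rewrite (FE n) mdist_L2plusS1.
apply: le_trans fgn; apply: (le_trans (distS1_le _ _ 0)).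
by rewrite le_eqVlt; apply/orP; left; apply/eqP; apply: eq_l2norm => x /=; rewrite expi0 mul1r.
Qed.

Lemma wavelet_modulus_op_closed : closed (range U).
Proof.
move=> H clH.
have /choice[F FH] : forall n, exists f, mdist (U f) H <= n.+1%:R^-1.
  move=> n; have n0 : 0 < n.+1%:R^-1 :> R by rewrite invr_gt0 ltr0n.
  have [_ [[f _ <-] fH]] := clH _ (nbhsx_ballx H _ n0).
  by exists f; rewrite metric_sym; move: fH; rewrite ballEmdist /= => /ltW.
by have [G GH _] := wavelet_modulus_op_compact FH; exists G.
Qed.

(** Otherwise there are classes whose images tend to [U g] while they stay at
distance at least [e] from [g]; by compactness some of them are close to a class
with the same image as [g], that is to [g] itself. *)
Lemma wavelet_modulus_op_inv_continuous (Uinv : L2Z R -> L2plusS1 R) :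
  cancel U Uinv -> {within range U, continuous Uinv}.
Proof.
have half_lt (x : R) : 0 < x -> x <= x / 2 -> False.
  by move=> x0; rewrite leNgt ltr_pdivrMr// ltr_pMr// ltr1n.
move=> UK; apply/subspace_continuousP => _ [g _ <-].
rewrite /from_subspace UK; apply/cvg_ballP => e e0; apply: contrapT => nH.
have /choice[F FH] : forall n, exists f, mdist (U f) (U g) <= n.+1%:R^-1 /\ e <= mdist f g.
  move=> n; have n0 : 0 < n.+1%:R^-1 :> R by rewrite invr_gt0 ltr0n.
  apply: contrapT => /forallNP Hn; apply: nH.
  apply/nbhs_ballP; exists n.+1%:R^-1 => //= y Hb [f _ fy].
  rewrite -fy in Hb *; rewrite UK ballEmdist /mkset.
  have [//|ef] := ltP (mdist g f) e; exfalso; apply: (Hn f); split.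
    by rewrite metric_sym; move: Hb; rewrite ballEmdist => /ltW.
  by rewrite metric_sym.
have [G UG FG] := wavelet_modulus_op_compact (fun n => (FH n).1).
have gG : g = G by rewrite -[g]UK -UG UK.
have e2 : 0 < e / 2 by rewrite divr_gt0.
have [n Fn] := FG _ e2; have [_] := FH n; rewrite gG => eF.
have {eF Fn} h : (e : R) <= e / 2 := le_trans eF Fn.
exact: (half_lt e e0 h).
Qed.

End Quotient.

Theorem theorem3p1 (R : realType) (a : R) (psi_ : int -> R -> R[i]) (A B : R)
  (a_gt1 : 1 < a)
  (psi_wavelets : wavelet_family a psi_)
  (psi_L1_L2 : forall j, cLp 1%:E (psi_ j) /\ cLp 2%:E (psi_ j))
  (psi_analytic : forall j,
     {ae (@lebesgue_measure R), forall w, w < 0 -> fourier (psi_ j) w = 0})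
  (A_gt0 : 0 < A) (B_gt0 : 0 < B)
  (littlewood_paley :
     {ae (@lebesgue_measure R), forall w, 0 < w ->
       (A%:E <= \esum_(j in [set: int]) (normc (fourier (psi_ j) w) ^+ 2)%:E
             <= B%:E)%E}) :
  let U : L2plusS1 R -> L2Z R := wavelet_modulus_op psi_ in
  (forall (f : @L2plus R) (j : int),
     {ae (@lebesgue_measure R), forall x,
       val (repr (U (\pi_(L2plusS1 R) f))) j x =
       (normc (convolution (val f) (psi_ j) x))%:C}) /\
  (injective U ->
     closed (range U) /\
     (forall Uinv : L2Z R -> L2plusS1 R, cancel U Uinv ->
        {within range U, continuous Uinv})).
Proof.
move=> U; split; first exact: (wavelet_modulus_op_repr psi_L1_L2 A_gt0 B_gt0 littlewood_paley).
move=> _; split; first exact: (wavelet_modulus_op_closed psi_L1_L2 A_gt0 B_gt0 littlewood_paley).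
move=> Uinv; exact: (wavelet_modulus_op_inv_continuous psi_L1_L2 A_gt0 B_gt0 littlewood_paley).
Qed.
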